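(* Let $X$ be a complex affine irreducible surface and $f:X\to\mathbb C$ a dominant morphism. Then there exists an integer $h_f\ge 0$ such that, for all but finitely many $y\in\mathbb C$, $$\dim_{\mathbb C} H^1(f^{-1}(y))=h_f .$$
   Context: Varieties are reduced. The fibre $f^{-1}(y)$ is regarded as a reduced affine curve (possibly empty). For a reduced complex affine curve $C$, $H^1(C)=\Omega^1(C)/d\Omega^0(C)$, where $\Omega^k(C)$ is the space of regular (Kähler) differential $k$-forms on $C$ over $\mathbb C$, $\Omega^0(C)$ is the ring of regular functions, and $d$ is the exterior derivative. *)

(* Defs.v *)
From HB Require Import structures.
From mathcomp Require Import all_boot all_order all_algebra.
From mathcomp Require Import complex mpoly.
From mathcomp Require Import boolp classical_sets functions cardinality reals.

Set Implicit Arguments.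
Unset Strict Implicit.
Unset Printing Implicit Defensive.

Import GRing.Theory.
Local Open Scope ring_scope.
Local Open Scope quotient_scope.
Local Open Scope classical_set_scope.

Section LinearAlgebra.
Context {K : fieldType} {V : lmodType K}.

Inductive lspan (S : set V) : V -> Prop :=
| lspan0 : lspan S 0
| lspanZD a u v : S u -> lspan S v -> lspan S (a *: u + v).

Lemma lspan_lin (S : set V) a u v :
  lspan S u -> lspan S v -> lspan S (a *: u + v).
Proof.
move=> Su Sv; elim: Su => [|b w u' Sw _ IH]; first by rewrite scaler0 add0r.
by rewrite scalerDr scalerA -addrA; exact: lspanZD.
Qed.

Lemma sub_lspan (S : set V) : S `<=` lspan S.
Proof.
move=> u Su; rewrite -[u]addr0 -[u]scale1r.
by apply: lspanZD => //; exact: lspan0.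
Qed.

Definition lspan_pred (S : set V) : V -> bool := fun v => `[< lspan S v >].

Lemma lspan_zmod_closed (S : set V) : zmod_closed (lspan_pred S).
Proof.
split=> [|u v]; first exact/asboolP/lspan0.
move=> /asboolP Su /asboolP Sv; apply/asboolP.
by rewrite addrC -scaleN1r; exact: lspan_lin.
Qed.

HB.instance Definition _ (S : set V) :=
  GRing.isZmodClosed.Build V (lspan_pred S) (lspan_zmod_closed S).

(* The quotient of V by the subspace spanned by S. *)
Definition lquot (S : set V) : Type :=
  Quotient.quot (GRing.ZmodClosed.clone V (lspan_pred S) _).

HB.instance Definition _ S := GRing.Zmodule.on (lquot S).

Definition lpi (S : set V) (v : V) : lquot S := \pi_(lquot S) v.

Lemma lpi_eq (S : set V) u v : lpi S u = lpi S v <-> lspan S (u - v).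
Proof.
have E := Quotient.idealrBE (GRing.ZmodClosed.clone V (lspan_pred S) _) u v.
split=> [e|Suv].
  by apply/asboolP; move: E; rewrite (introT eqP e).
by apply/eqP; rewrite -E; exact/asboolP.
Qed.

Lemma lpi_surj (S : set V) (x : lquot S) : exists v, x = lpi S v.
Proof. by exists (repr x); rewrite /lpi reprK. Qed.

Lemma lpiD (S : set V) : {morph lpi S : u v / u + v}.
Proof. exact: raddfD. Qed.

Definition lquot_scale (S : set V) (a : K) (x : lquot S) : lquot S :=
  lpi S (a *: repr x).

Lemma lquot_scaleE (S : set V) a v :
  lquot_scale a (lpi S v) = lpi S (a *: v).
Proof.
apply/lpi_eq; rewrite -scalerBr -[_ *: _]addr0; apply: lspan_lin.
  by apply/lpi_eq; rewrite /lpi reprK.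
exact: lspan0.
Qed.

Lemma lquot_scaleA (S : set V) a b (x : lquot S) :
  lquot_scale a (lquot_scale b x) = lquot_scale (a * b) x.
Proof. by have [v ->] := lpi_surj x; rewrite !lquot_scaleE scalerA. Qed.

Lemma lquot_scale1 (S : set V) : left_id 1 (@lquot_scale S).
Proof. by move=> x; have [v ->] := lpi_surj x; rewrite lquot_scaleE scale1r. Qed.

Lemma lquot_scaleDr (S : set V) : right_distributive (@lquot_scale S) +%R.
Proof.
move=> a x y; have [u ->] := lpi_surj x; have [v ->] := lpi_surj y.
by rewrite -lpiD !lquot_scaleE scalerDr lpiD.
Qed.

Lemma lquot_scaleDl (S : set V) (x : lquot S) :
  {morph (@lquot_scale S)^~ x : a b / a + b}.
Proof.
by move=> a b; have [v ->] := lpi_surj x; rewrite !lquot_scaleE scalerDl lpiD.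
Qed.

HB.instance Definition _ (S : set V) :=
  GRing.Zmodule_isLmodule.Build K (lquot S) (@lquot_scaleA S)
    (@lquot_scale1 S) (@lquot_scaleDr S) (@lquot_scaleDl S).

Lemma lpi_is_linear (S : set V) : linear (lpi S).
Proof. by move=> a u v; rewrite lpiD -lquot_scaleE. Qed.

HB.instance Definition _ (S : set V) :=
  GRing.isLinear.Build K V (lquot S) *:%R (lpi S) (@lpi_is_linear S).

Definition has_dim (n : nat) : Prop :=
  exists2 v2r : V -> 'rV[K]_n, linear v2r & bijective v2r.

End LinearAlgebra.

Arguments has_dim {K} V n.

Section AffineVarieties.
Context {K : fieldType} {n : nat}.
Implicit Types X Y Z : set ('I_n -> K).

Definition zariski_closed Z : Prop :=
  exists S : set {mpoly K[n]}, Z = [set x | forall p, S p -> p.@[x] = 0].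

Definition irreducible_set Z : Prop :=
  Z !=set0 /\
  forall Z1 Z2, zariski_closed Z1 -> zariski_closed Z2 ->
    Z `<=` Z1 `|` Z2 -> Z `<=` Z1 \/ Z `<=` Z2.

Definition affine_variety X : Prop := zariski_closed X /\ irreducible_set X.

Definition variety_chain X (d : nat) (W : nat -> set ('I_n -> K)) : Prop :=
  (forall i, (i <= d)%N -> affine_variety (W i) /\ W i `<=` X) /\
  (forall i, (i < d)%N -> W i `<` W i.+1).

Definition variety_dim X (d : nat) : Prop :=
  (exists W, variety_chain X d W) /\ ~ (exists W, variety_chain X d.+1 W).

Definition zariski_dense Z : Prop :=
  forall Y, zariski_closed Y -> Z `<=` Y -> Y = setT.

(* Only the values of f on X matter. *)
Definition regular_on X (f : ('I_n -> K) -> K) : Prop :=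
  exists p : {mpoly K[n]}, forall x, X x -> f x = p.@[x].

Definition vanishing_ideal Z : set {mpoly K[n]} :=
  [set g | forall x, Z x -> g.@[x] = 0].

(* The form sum_i w_i dx_i on affine n-space is encoded as i |-> w_i; finite
   functions (rather than row vectors) so that forms are a K-vector space. *)
Definition form : Type := {ffun 'I_n -> {mpoly K[n]}}.
HB.instance Definition _ := GRing.Lmodule.on form.

Definition form_scale (a : {mpoly K[n]}) (w : form) : form :=
  [ffun i => a * w i].

Definition form_d (g : {mpoly K[n]}) : form := [ffun i => mderiv i g].

(* Kaehler differentials of K[x]/I, I the ideal of Z, are the quotient of
   the module of forms by the submodule generated by I dx_1, ..., I dx_n and
   dI; see kaehler_universal. *)
Inductive kaehler_rel Z : form -> Prop :=
| kaehler_rel_ideal g w : vanishing_ideal Z g -> kaehler_rel Z (form_scale g w)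
| kaehler_rel_d a g : vanishing_ideal Z g ->
    kaehler_rel Z (form_scale a (form_d g)).

(* The regular functions on Z, as a K-vector space (not a nzRingType, since
   the zero ring occurs when Z is empty). *)
Definition Omega0 Z : lmodType K := lquot (vanishing_ideal Z).

Definition Omega1 Z : lmodType K := lquot (kaehler_rel Z).

Definition ext_d Z (x : Omega0 Z) : Omega1 Z :=
  lpi (kaehler_rel Z) (form_d (repr x)).

Lemma mnm_subUU i : (U_(i) - U_(i))%MM = 0%MM :> 'X_{1..n}.
Proof. by apply/mnmP => j; rewrite mnmBE subnn mnm0E. Qed.

Lemma form_dD g h : form_d (g + h) = form_d g + form_d h.
Proof. by apply/ffunP => i; rewrite !ffunE mderivD. Qed.

Lemma form_dZ c g : form_d (c *: g) = c *: form_d g.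
Proof. by apply/ffunP => i; rewrite !ffunE mderivZ. Qed.

Lemma form_dM g h :
  form_d (g * h) = form_scale g (form_d h) + form_scale h (form_d g).
Proof.
by apply/ffunP => i; rewrite !ffunE mderivM addrC [_ * h]mulrC.
Qed.

Lemma lspan_vanishing Z g : lspan (vanishing_ideal Z) g -> vanishing_ideal Z g.
Proof.
elim=> [|a u v Iu _ Iv] x Zx; first by rewrite meval0.
by rewrite mevalD mevalZ Iu // Iv // mulr0 addr0.
Qed.

Lemma ext_dE Z g : ext_d (lpi _ g : Omega0 Z) = lpi _ (form_d g).
Proof.
apply/lpi_eq; rewrite -scaleN1r -form_dZ -form_dD scaleN1r.
set h := _ - g; have Ih : vanishing_ideal Z h.
  by apply/lspan_vanishing/lpi_eq; rewrite /lpi reprK.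
apply: sub_lspan; have -> : form_d h = form_scale 1 (form_d h).
  by apply/ffunP => i; rewrite !ffunE mul1r.
exact: kaehler_rel_d.
Qed.

Lemma ext_d_linear Z : linear (@ext_d Z).
Proof.
move=> a x y; have [g ->] := lpi_surj x; have [h ->] := lpi_surj y.
by rewrite -linearP !ext_dE form_dD form_dZ linearP.
Qed.

HB.instance Definition _ Z :=
  GRing.isLinear.Build K (Omega0 Z) (Omega1 Z) *:%R (@ext_d Z)
    (@ext_d_linear Z).

(* A K-derivation of K[x]/I in a K[x]/I-module is the same thing as a
   K-derivation D of K[x], zero on I, in a K[x]-module M killed by I. *)
Lemma kaehler_universal Z (M : lmodType {mpoly K[n]}) (D : {mpoly K[n]} -> M) :
  (forall g h, D (g + h) = D g + D h) ->
  (forall g h, D (g * h) = g *: D h + h *: D g) ->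
  (forall c, D c%:MP = 0) ->
  (forall g m, vanishing_ideal Z g -> g *: m = 0 :> M) ->
  (forall g, vanishing_ideal Z g -> D g = 0) ->
  exists! u : Omega1 Z -> M,
    (forall a w w', u (lpi _ (form_scale a w + w')) =
                    a *: u (lpi _ w) + u (lpi _ w')) /\
    (forall g, u (ext_d (lpi _ g)) = D g).
Proof.
move=> DD DM DC IM ID.
pose phi (w : form) : M := \sum_i w i *: D 'X_i.
have phiP a w w' : phi (form_scale a w + w') = a *: phi w + phi w'.
  rewrite /phi scaler_sumr -big_split; apply: eq_bigr => i _ /=.
  by rewrite !ffunE scalerDl scalerA.
have scaleC c (w : form) : c *: w = form_scale c%:MP w.
  by apply/ffunP => i; rewrite !ffunE mul_mpolyC.
have phi0 : phi 0 = 0.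
  by rewrite /phi big1 // => i _; rewrite ffunE scale0r.
have phiD w w' : phi (w + w') = phi w + phi w'.
  have -> : w = form_scale 1 w by apply/ffunP => i; rewrite !ffunE mul1r.
  rewrite phiP scale1r; congr (phi _ + _).
  by apply/ffunP => i; rewrite !ffunE mul1r.
have phiZ a w : phi (form_scale a w) = a *: phi w.
  by rewrite -[form_scale a w]addr0 phiP phi0 addr0.
have phid g : phi (form_d g) = D g.
  have hC c : phi (form_d c%:MP) = D c%:MP.
    rewrite DC /phi big1 // => i _.
    by rewrite ffunE mderivC scale0r.
  have hM p q : phi (form_d p) = D p -> phi (form_d q) = D q ->
      phi (form_d (p * q)) = D (p * q).
    by move=> hp hq; rewrite form_dM phiD !phiZ hp hq DM.
  have hX i : phi (form_d 'X_i) = D 'X_i.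
    rewrite /phi (bigD1 i) //= big1 ?addr0 => [|j ji].
      by rewrite ffunE mderivX mnm1E eqxx scale1r mnm_subUU mpolyX0 scale1r.
    by rewrite ffunE mderivX mnm1E eq_sym (negbTE ji) scale0r scale0r.
  have h1 : phi (form_d 1) = D 1 by rewrite -mpolyC1.
  elim/mpolyind: g => [|c m p _ _ IH]; first by rewrite -mpolyC0.
  rewrite form_dD phiD IH DD; congr (_ + _).
  rewrite -mul_mpolyC; apply: (hM) => //.
  rewrite mpolyXE_id.
  apply: (big_ind (fun q => phi (form_d q) = D q)) => // i _.
  by elim: (m i) => [|k IHk]; rewrite ?expr0 // exprS; exact: (hM).
have phi_rel w : lspan (kaehler_rel Z) w -> phi w = 0.
  elim=> // c u v Su _ IH; rewrite phiD IH addr0 scaleC phiZ.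
  case: Su => [g w' Ig|b g Ig]; rewrite phiZ; first by rewrite (IM g) // scaler0.
  by rewrite phid (ID g Ig) !scaler0.
pose u (x : Omega1 Z) := phi (repr x).
have uE w : u (lpi _ w) = phi w.
  have /lpi_eq/phi_rel : lpi (kaehler_rel Z) (repr (lpi _ w : Omega1 Z)) = lpi _ w.
    by rewrite /lpi reprK.
  rewrite /u -scaleN1r scaleC phiD phiZ mpolyCN mpolyC1 scaleN1r => /eqP.
  by rewrite subr_eq0 => /eqP.
exists u; split=> [|u' [u'P u'd]].
  by split=> [a w w'|g]; rewrite ?ext_dE !uE.
apply/esym/funext => x; have [w ->] := lpi_surj x; rewrite uE.
have u'0 : u' (lpi _ 0) = 0.
  have := u'P 1 0 0; have -> : form_scale 1 0 + 0 = 0 :> form.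
    by apply/ffunP => i; rewrite !ffunE mulr0 addr0.
  by rewrite scale1r => /eqP; rewrite -subr_eq0 opprD addNKr oppr_eq0 => /eqP.
have -> : w = \sum_i (form_scale (w i) (form_d 'X_i) + 0).
  apply/ffunP => j; rewrite sum_ffunE (bigD1 j) //= big1 => [|i ij].
    rewrite !ffunE mderivX mnm1E eqxx scale1r mnm_subUU mpolyX0 mulr1.
    by rewrite !addr0.
  by rewrite !ffunE mderivX mnm1E (negbTE ij) scale0r mulr0 addr0.
apply: (big_ind (fun v => u' (lpi _ v) = phi v)) => [|v v' hv hv'|i _].
- by rewrite phi0 u'0.
- have -> : v + v' = form_scale 1 v + v'.
    by congr (_ + _); apply/ffunP => i; rewrite ffunE mul1r.
  by rewrite phiP u'P hv hv'.
- by rewrite phiP u'P phi0 u'0 phid -u'd ext_dE.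
Qed.

Definition H1 Z : lmodType K := lquot (range (@ext_d Z)).

End AffineVarieties.

Definition dominant {K : fieldType} {n : nat} (X : set ('I_n -> K))
    (f : ('I_n -> K) -> K) : Prop :=
  zariski_dense ((fun x (_ : 'I_1) => f x) @` X).

(* Main.v *)
Require Import Defs.
From HB Require Import structures.
From mathcomp Require Import all_boot all_order all_algebra.
From mathcomp Require Import perm complex mpoly.
From mathcomp Require Import boolp classical_sets functions cardinality reals.
From mathcomp Require finmap.
From mathcomp Require Import zify ring lra.

Set Implicit Arguments.
Unset Strict Implicit.
Unset Printing Implicit Defensive.

Import Order.TTheory GRing.Theory Num.Theory.
Local Open Scope ring_scope.

(** Let t be the restriction of f to X. After removing finitely many values
    of t, the coordinate ring of X is a free module over K[t, x] for a
    suitable function x, with a basis e_1, ..., e_m ([free_basis]). Putting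
    t = y makes the coordinate ring of the fibre over y a free K[x]-algebra
    A_y of rank m, whose structure constants have degrees in x bounded
    independently of y and whose discriminant is nonzero for almost all y;
    this discriminant does not vanish generically because the trace form of
    a domain of characteristic zero is nondegenerate
    ([trace_form_nondegenerate]). A nonzero discriminant makes A_y reduced,
    so by the Nullstellensatz the ideal defining A_y is the full vanishing
    ideal of the fibre.

    The heart of the proof bounds degrees in A_y, for fixed y, by constants
    that depend only on m and on the degrees of finitely many elements, such
    as the structure constants. On the fibre there is a derivation der that
    extends disc d/dx. Measure an element by its spectral degree, the growth
    rate of the degrees of its powers. Then x der multiplies the part of
    spectral degree q of an element by q disc, up to terms of strictly
    smaller degree, exactly as x d/dx acts on x^q ([der_leading]). Hence der
    can be inverted on elements of large degree, which gives two uniform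
    statements about forms on the fibre: every form is exact up to a form of
    bounded degree ([dvec_coker]), and an exact form of bounded degree has a
    primitive that lifts to a polynomial of bounded degree
    ([dvec_primitive]). The passage from functions to forms rests on the
    fact that disc times a form is a multiple of dx up to an exact form
    ([disc_form_exact]).

    Consequently H1 of the fibre is the cokernel of a linear map between
    spaces of fixed finite dimension, described by matrices whose entries
    are, up to a common nonzero factor, polynomials in y
    ([fibre_cohomology]). The rank of a matrix of polynomials is constant
    off a finite set ([rank_generic]), and so is the dimension of H1.

    That X has dimension two enters through chains of irreducible
    subvarieties. Three functions algebraically independent on X would give
    a chain of length three ([transc_chain]), and if every function were
    algebraic over t there would be no chain of length two ([dim2_transc]).
    These arguments and the Nullstellensatz use that K is uncountable
    ([amitsur]). *)

(** * Degree bounds for univariate polynomials *)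

Section DegreeBound.
Context {K : fieldType}.
Implicit Types (p : {poly K}) (r s : rat).

(** Degree bounds are rational because the slopes of Newton polygons are; a
    negative bound says that the polynomial is zero. *)
Definition dg p r : Prop := forall i : nat, r < i%:R -> p`_i = 0.

Lemma dg0 r : dg 0 r.
Proof. by move=> i _; rewrite coef0. Qed.

Lemma dgW p r s : r <= s -> dg p r -> dg p s.
Proof. by move=> rs h i si; apply: h; apply: le_lt_trans si. Qed.

Lemma dgD p1 p2 r : dg p1 r -> dg p2 r -> dg (p1 + p2) r.
Proof. by move=> h1 h2 i ri; rewrite coefD h1 // h2 // addr0. Qed.

Lemma dg_sum (I : Type) (s : seq I) (P : pred I) (F : I -> {poly K}) r :
  (forall i, P i -> dg (F i) r) -> dg (\sum_(i <- s | P i) F i) r.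
Proof.
by move=> h; apply: (big_ind (fun p => dg p r)) => //; [exact: dg0|move=> *; exact: dgD].
Qed.

Lemma dgM p1 p2 r s : dg p1 r -> dg p2 s -> dg (p1 * p2) (r + s).
Proof.
move=> h1 h2 i ri; rewrite coefM big1 // => j _.
have [rj|jr] := ltP r j%:R; first by rewrite h1 // mul0r.
rewrite h2 ?mulr0 // natrB; last by rewrite -ltnS.
lra.
Qed.

Lemma dg_prod (I : Type) (l : seq I) (F : I -> {poly K}) (r : I -> rat) :
  (forall i, dg (F i) (r i)) -> dg (\prod_(i <- l) F i) (\sum_(i <- l) r i).
Proof.
move=> h; elim: l => [|i l IH]; last by rewrite !big_cons; exact: dgM.
by rewrite !big_nil => -[|i]; rewrite ?ltxx // coef1.
Qed.

Lemma dgN p r : dg p r -> dg (- p) r.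
Proof. by move=> h i ri; rewrite coefN h // oppr0. Qed.

Lemma dgC (c : K) r : 0 <= r -> dg c%:P r.
Proof. by move=> r0 [|i] ri; rewrite coefC //; move: ri; rewrite ltNge r0. Qed.

Lemma dgZ (c : K) p r : dg p r -> dg (c *: p) r.
Proof. by move=> h i ri; rewrite coefZ h // mulr0. Qed.

Lemma dgXn n r : n%:R <= r -> dg 'X^n r.
Proof.
move=> nr i ri; rewrite coefXn; case: eqP => // E.
by move: nr; rewrite -E leNgt ri.
Qed.

Lemma dg_size p : dg p (size p).-1%:R.
Proof.
by move=> i; rewrite ltr_nat => h; rewrite nth_default //; case: (size p) h.
Qed.

Lemma dg_sizeP p r : dg p r -> p != 0 -> (size p).-1%:R <= r.
Proof.
move=> h p0; rewrite leNgt; apply/negP => /h.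
by move/eqP; rewrite -/(lead_coef p) lead_coef_eq0 (negbTE p0).
Qed.

Lemma dg_ge0 p r : dg p r -> p != 0 -> 0 <= r.
Proof. by move=> h /(dg_sizeP h); apply: le_trans; rewrite ler0n. Qed.

Lemma dg_cancel p1 p2 s : p1 != 0 -> dg (p1 * p2) s -> dg p2 (s - (size p1).-1%:R).
Proof.
move=> p10 h; have [->|p20] := eqVneq p2 0; first exact: dg0.
have := dg_sizeP h; rewrite mulf_neq0 // => /(_ isT).
rewrite size_mul // -subn1 => H; apply: dgW (@dg_size p2).
have s1 : (0 < size p1)%N by rewrite size_poly_gt0.
have s2 : (0 < size p2)%N by rewrite size_poly_gt0.
rewrite lerBrDl -natrD; apply: le_trans H; rewrite ler_nat.
by case: (size p1) s1 => // a _; case: (size p2) s2 => // b _; lia.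
Qed.

Lemma dg_deriv p r : dg p r -> dg p^`() r.
Proof.
move=> h i ri; rewrite coef_deriv h ?mul0rn //.
by apply: lt_trans ri _; rewrite ltr_nat.
Qed.

Lemma dg_det m (M : 'M[{poly K}]_m) r :
  (forall i j, dg (M i j) r) -> dg (\det M) (r *+ m).
Proof.
move=> h; apply: dg_sum => s _.
have H : dg (\prod_i M i (s i)) (r *+ m).
  have := @dg_prod _ (index_enum 'I_m) (fun i => M i (s i)) (fun _ => r) (fun i => h i _).
  by rewrite sumr_const card_ord.
by rewrite mulr_sign; case: ifP => _ //; exact: dgN.
Qed.

Lemma dg_coefM p1 p2 (i j : nat) s :
  dg p1 i%:R -> dg p2 s -> s <= j%:R -> (p1 * p2)`_(i + j) = p1`_i * p2`_j.
Proof.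
move=> h1 h2 sj.
have ij : (i < (i + j).+1)%N by lia.
rewrite coefM (bigD1 (Ordinal ij)) //= addKn big1 ?addr0 // => k /eqP ki.
have [ik|ki'] := ltnP i k; first by rewrite h1 ?mul0r // ltr_nat.
rewrite h2 ?mulr0 //; apply: le_lt_trans sj _; rewrite ltr_nat.
suff : (k != i :> nat) by lia.
by apply/eqP => E; apply: ki; apply/val_inj.
Qed.

End DegreeBound.

(** * Reduced bases of a lattice of polynomial vectors *)

(** A square matrix N of polynomials whose powers have degrees growing like
    n q is conjugate, over K[x], to a matrix whose entry (i, j) has degree
    at most rho_i + q - rho_j. The basis that achieves this is one of
    minimal total weight, where the weight of a row v measures the degrees
    of all v N^n at once; it is the analogue of a reduced (Popov) basis of a
    lattice over K[x]. *)
Section ReducedBasis.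
Context {K : fieldType} {m' : nat}.
Local Notation m := m'.+1.
Variables (N : 'M[{poly K}]_m) (q : rat) (e : nat).
Hypotheses (e_gt0 : (0 < e)%N) (qe : exists p : int, q * e%:R = p%:~R).

Definition orbdeg (v : 'rV[{poly K}]_m) (r : rat) : Prop :=
  forall n j, dg ((v *m N ^+ n) 0 j) (n%:R * q + r).

Lemma orbdegW v r s : r <= s -> orbdeg v r -> orbdeg v s.
Proof. by move=> rs h n j; apply: dgW (h n j); rewrite lerD2l. Qed.

Definition adapted (P : 'M[{poly K}]_m) (rho : 'I_m -> nat) : Prop :=
  P \in unitmx /\ forall i, orbdeg (row i P) ((rho i)%:R / e%:R).

(** All the bounds under comparison lie in (1/e)Z, so as soon as the extreme
    coefficients vanish the bound drops by a whole step 1/e. *)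
Lemma orbdeg_grid v (k : nat) :
  orbdeg v (k%:R / e%:R) ->
  (forall n j (i : nat), i%:R = n%:R * q + k%:R / e%:R ->
     ((v *m N ^+ n) 0 j)`_i = 0) ->
  orbdeg v (k%:R / e%:R - e%:R^-1).
Proof.
move=> h h0 n j i Hi.
have e0 : (0 : rat) < e%:R by rewrite ltr0n.
have [lt|] := ltP (n%:R * q + k%:R / e%:R) i%:R; first exact: h.
rewrite le_eqVlt => /orP[/eqP E|lt]; first exact: h0.
case: qe => p Ep.
have Ei : q = p%:~R / e%:R by rewrite -Ep mulfK ?gt_eqF.
have H1 : ((i * e)%:Z < n%:Z * p + k%:Z)%R.
  rewrite -(ltr_int rat) !(intrD, intrM).
  move: lt; rewrite -(ltr_pM2r e0) mulrDl divfK ?gt_eqF // Ei mulrA divfK ?gt_eqF //.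
  by rewrite -!pmulrn natrM.
have H2 : (n%:Z * p + k%:Z < (i * e)%:Z + 1)%R.
  rewrite -(ltr_int rat) !(intrD, intrM).
  move: Hi; rewrite -(ltr_pM2r e0) !mulrDl divfK ?gt_eqF // mulNr mulVf ?gt_eqF // Ei mulrA divfK ?gt_eqF //.
  rewrite -!pmulrn natrM; lra.
lia.
Qed.

(** Minimality excludes cancellation: if the leading terms of the rows
    cancelled in a P, then the combination of rows formed with these leading
    terms could replace one of the rows, by a unimodular operation, and it
    would have smaller weight. *)
Lemma adapted_reduced P rho :
  adapted P rho ->
  (forall P' rho', adapted P' rho' -> (\sum_i rho i <= \sum_i rho' i)%N) ->
  forall (a : 'rV_m) s, orbdeg (a *m P) s ->
  forall i, dg (a 0 i) (s - (rho i)%:R / e%:R).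
Proof.
move=> [Pu hP] hmin a s ha i0; apply: contrapT => h0.
have e0 : (0 : rat) < e%:R by rewrite ltr0n.
pose d i := (size (a 0 i)).-1.
pose w i : rat := (d i)%:R + (rho i)%:R / e%:R.
have ai0 : a 0 i0 != 0 by apply/eqP => E; apply: h0; rewrite E; exact: dg0.
have wi0 : s < w i0.
  rewrite ltNge; apply/negP => h; apply: h0; apply: dgW (@dg_size _ _).
  by rewrite lerBrDr.
(* w i is the degree of the i-th summand a_i P_i; among the summands of
   maximal degree, k is one where a_k has minimal degree, so that the
   quotients of leading terms X^(d i - d k) are polynomials. *)
pose k0 := [arg max_(i > i0 | a 0 i != 0) w i]%O.
have [k0a k0max sk0] : [/\ a 0 k0 != 0, forall i, a 0 i != 0 -> w i <= w k0 & s < w k0].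
  rewrite /k0; case: arg_maxP => // i ai imax; split => //.
  by apply: lt_le_trans wi0 _; exact: imax.
pose T i := (a 0 i != 0) && (w i == w k0).
pose k := [arg min_(i < k0 | T i) d i].
have [Tk kmin] : T k /\ forall i, T i -> (d k <= d i)%N.
  by rewrite /k; case: arg_minnP => //; rewrite /T k0a eqxx.
have {k0a} ka : a 0 k != 0 by case/andP: Tk.
have wk : w k = w k0 by case/andP: Tk => _ /eqP.
pose u i := if T i then lead_coef (a 0 i) *: 'X^(d i - d k) else 0.
have uk : u k = (lead_coef (a 0 k))%:P by rewrite /u Tk subnn expr0 alg_polyC.
have lk0 : lead_coef (a 0 k) != 0 by rewrite lead_coef_eq0.
pose ur : 'rV[{poly K}]_m := \row_i u i.
pose wr := ur - delta_mx 0 k.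
(* replaces the row k by ur P; its determinant is the nonzero constant u k *)
pose E := 1%:M + delta_mx k (0 : 'I_1) *m wr.
have rowE i : row i (E *m P) = if i == k then ur *m P else row i P.
  rewrite mulmxDl mul1mx raddfD /= -mulmxA row_mul rowE mul_delta_mx_cond.
  case: (eqVneq i k) => [->|ik] /=; last by rewrite mulr0n mul0mx addr0.
  rewrite mulr1n (_ : delta_mx 0 0 = 1%:M); last by apply/matrixP => x y; rewrite !mxE !ord1.
  by rewrite mul1mx mulmxBl -rowE addrC subrK.
have wd : wr *m delta_mx k (0 : 'I_1) = (u k - 1)%:M.
  by rewrite mulmxBl mul_delta_mx -colE; apply/matrixP => x y; rewrite !mxE !ord1 !mulr1n.
have Eu : E \in unitmx.
  pose c := ((lead_coef (a 0 k))^-1)%:P : {poly K}.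
  have [] // := @mulmx1_unit _ _ E (1%:M - c *: (delta_mx k (0 : 'I_1) *m wr)).
  rewrite /E; set Y := delta_mx k 0 *m wr.
  have YY : Y *m Y = (u k - 1) *: Y.
    by rewrite /Y mulmxA -(mulmxA _ wr) wd mul_mx_scalar -scalemxAl.
  rewrite mulmxDl mul1mx mulmxBr mulmx1 -scalemxAr YY scalerA mulrBr mulr1 uk.
  rewrite -polyCM mulVf // scalerBl scale1r opprB.
  by rewrite [Y + _]addrC subrK subrK.
have hur : orbdeg (ur *m P) ((rho k)%:R / e%:R).
  move=> n j; rewrite -mulmxA mxE; apply: dg_sum => i _; rewrite mxE /u.
  case: ifP => [Ti|_]; last by rewrite mul0r; exact: dg0.
  have Hw : (d i)%:R + (rho i)%:R / e%:R = (d k)%:R + (rho k)%:R / e%:R :> rat.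
    by case/andP: Ti => _ /eqP; rewrite -wk.
  have := hP i n j; rewrite -row_mul mxE => H.
  have := dgM (dgZ (lead_coef (a 0 i)) (dgXn (lexx (d i - d k)%:R))) H.
  apply: dgW; rewrite natrB ?kmin //; lra.
have hur' : orbdeg (ur *m P) ((rho k)%:R / e%:R - e%:R^-1).
  apply: orbdeg_grid => // n j i Hi.
  have := ha n j; rewrite -[in X in X -> _]mulmxA mxE => /(_ (i + d k)%N) Ha.
  rewrite -mulmxA mxE coef_sum -[RHS]Ha; last first.
    by move: sk0; rewrite -wk natrD Hi /w; lra.
  rewrite coef_sum; apply: eq_bigr => l _; rewrite mxE /u.
  set z := (P *m _) l j.
  have Hz : dg z (n%:R * q + (rho l)%:R / e%:R).
    by have := hP l n j; rewrite -row_mul mxE.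
  case: ifP => [Tl|nT].
    have Hw : (d l)%:R + (rho l)%:R / e%:R = (d k)%:R + (rho k)%:R / e%:R :> rat.
      by case/andP: Tl => _ /eqP; rewrite -wk.
    have dkl : (d k <= d l)%N by exact: kmin.
    rewrite -scalerAl coefZ coefXnM.
    case: ltnP => [lt|le].
      rewrite mulr0.
      have : z = 0.
        apply: contrapT => /eqP z0; have := dg_ge0 Hz z0.
        have : (i%:R : rat) < (d l)%:R - (d k)%:R by rewrite -natrB // ltr_nat.
        rewrite Hi; lra.
      by move=> ->; rewrite mulr0 coef0.
    have -> : (i + d k = d l + (i - (d l - d k)))%N.
      by rewrite subnBA // subnKC // addnC -leq_subLR.
    rewrite (dg_coefM (@dg_size _ _) Hz) 1?mulrC //.
    by rewrite natrB // natrB // Hi; lra.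
  have [->|al] := eqVneq (a 0 l) 0; first by rewrite !mul0r !coef0.
  rewrite mul0r coef0 (dgM (@dg_size _ _) Hz) //.
  have : w l < w k.
    rewrite lt_neqAle [in X in X && _]wk (wk) k0max // andbT; move: nT; rewrite /T al /=.
    by move=> ->.
  by rewrite /w natrD Hi -/(d l); lra.
pose rho' i := if i == k then (rho k).-1 else rho i.
have rk0 : (0 < rho k)%N.
  rewrite lt0n; apply/eqP => r0.
  have z0 : row k (E *m P) = 0.
    rewrite rowE eqxx; apply/rowP => j; rewrite [RHS]mxE.
    have := hur' 0%N j; rewrite expr0 mulmx1 r0 mul0r => H.
    apply: contrapT => /eqP z0; have := dg_ge0 H z0; rewrite mul0r !add0r.
    by rewrite oppr_ge0 invr_le0 leNgt e0.
  have : E *m P \in unitmx by rewrite unitmx_mul Eu.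
  move/mulmxV => H; have := congr1 (row k) H; rewrite row_mul z0 mul0mx.
  by move/rowP/(_ k); rewrite !mxE eqxx => /esym/eqP; rewrite oner_eq0.
have ad' : adapted (E *m P) rho'.
  split=> [|i]; first by rewrite unitmx_mul Eu.
  rewrite rowE /rho'; case: (eqVneq i k) => [_|_]; last exact: hP.
  apply: orbdegW hur'; rewrite -subn1 natrB //; lra.
have := hmin _ _ ad'.
rewrite (bigD1 k) //= [X in (_ <= X)%N](bigD1 k) //= /rho' eqxx.
rewrite [X in (_ <= _ + X)%N](eq_bigr rho); last by move=> i ik; rewrite ifN.
by rewrite leq_add2r; case: (rho k) rk0 => //= r _; rewrite ltnn.
Qed.

Hypothesis Nbd : exists B, forall n i j, dg ((N ^+ n) i j) (n%:R * q + B).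

Lemma exists_adapted : exists P rho, adapted P rho.
Proof.
have [B hB] := Nbd; have e0 : (0 : rat) < e%:R by rewrite ltr0n.
exists 1%:M, (fun=> Num.bound `|B * e%:R|); split; first exact: unitmx1.
move=> i n j; rewrite -row_mul mul1mx mxE; apply: dgW (hB n i j).
rewrite lerD2l ler_pdivlMr //; apply: le_trans (ler_norm _) _.
exact/ltW/archi_boundP/normr_ge0.
Qed.

Lemma reduced_basis : exists (P : 'M[{poly K}]_m) (rho : 'I_m -> rat),
  P \in unitmx /\ forall i j, dg ((P *m N *m invmx P) i j) (rho i + q - rho j).
Proof.
have [P0 [r0 A0]] := exists_adapted.
pose Q n := `[< exists P rho, adapted P rho /\ \sum_i rho i = n >]%N.
have exQ : exists n, Q n by exists (\sum_i r0 i)%N; apply/asboolP; exists P0, r0.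
have [n /asboolP[P [rho [A <-]]] nmin] := ex_minnP exQ.
exists P, (fun i => (rho i)%:R / e%:R); split; first by case: A.
move=> i j; have := @adapted_reduced P rho A.
have Hmin P' rho' : adapted P' rho' -> (\sum_i rho i <= \sum_i rho' i)%N.
  by move=> A'; apply: nmin; apply/asboolP; exists P', rho'.
move=> /(_ Hmin (row i (P *m N *m invmx P)) ((rho i)%:R / e%:R + q)).
rewrite -row_mul mulmxKV; last by case: A.
move=> H; have := H _ j; rewrite mxE; apply => k l.
rewrite row_mul -mulmxA -[N *m N ^+ k]/(N * N ^+ k) -exprS.
apply: dgW (A.2 i k.+1 l); rewrite -natr1 mulrDl mul1r; lra.
Qed.

Lemma char_poly_conj (P : 'M[{poly K}]_m) :
  P \in unitmx -> char_poly (P *m N *m invmx P) = char_poly N.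
Proof.
move=> Pu; pose lift := map_mx (@polyC {poly K}).
have E : char_poly_mx (P *m N *m invmx P) =
    lift _ _ P *m char_poly_mx N *m lift _ _ (invmx P).
  rewrite /char_poly_mx /lift mulmxBr mulmxBl -!map_mxM /=; congr (_ - _).
  by rewrite scalar_mxC -mulmxA -map_mxM /= mulmxV // map_mx1 mulmx1.
rewrite /char_poly E !det_mulmx mulrAC -det_mulmx -map_mxM /= mulmxV //.
by rewrite map_mx1 det1 mul1r.
Qed.

(** In the adapted basis the entry (i, j) of the matrix has degree at most
    rho_i + q - rho_j. Along a permutation the weights rho cancel, so with
    the indeterminate counted with weight q every term of the determinant
    has weight at most m q. *)
Lemma dg_char_poly k : (k <= m)%N -> dg (char_poly N)`_k ((m - k)%:R * q).
Proof.
have [P [rho [Pu h]]] := reduced_basis; rewrite -(char_poly_conj Pu).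
move: (P *m N *m invmx P) h => N' h km.
(* weight of the indeterminate of the characteristic polynomial: q *)
pose wdg (p : {poly {poly K}}) (w : rat) := forall i, dg p`_i (w - i%:R * q).
have w0 w : wdg 0 w by move=> i; rewrite coef0; exact: dg0.
have wM p1 p2 w1 w2 : wdg p1 w1 -> wdg p2 w2 -> wdg (p1 * p2) (w1 + w2).
  move=> h1 h2 i; rewrite coefM; apply: dg_sum => j _.
  apply: dgW (dgM (h1 j) (h2 (i - j)%N)); rewrite natrB ?mulrBl -1?ltnS //; lra.
have wD p1 p2 w : wdg p1 w -> wdg p2 w -> wdg (p1 + p2) w.
  by move=> h1 h2 i; rewrite coefD; exact: dgD.
have wN p w : wdg p w -> wdg (- p) w.
  by move=> h1 i; rewrite coefN; exact: dgN.
have wE i j : wdg (char_poly_mx N' i j) (rho i + q - rho j).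
  rewrite !mxE; apply: wD; last first.
    apply: wN => -[|k']; rewrite coefC //= ?mul0r ?subr0; [exact: h|exact: dg0].
  case: eqVneq => [->|_]; last by rewrite mulr0n; exact: w0.
  rewrite mulr1n => -[|[|k']]; rewrite coefX /=; [exact: dg0| |exact: dg0].
  by rewrite -polyC1; apply: dgC; lra.
suff H : wdg (char_poly N') (m%:R * q) by move: (H k); rewrite natrB // mulrBl.
rewrite /char_poly /determinant; apply: (big_ind (fun p => wdg p _)) => //.
  by move=> *; exact: wD.
move=> s _; rewrite mulr_sign.
suff : wdg (\prod_i char_poly_mx N' i (s i)) (m%:R * q).
  by case: ifP => // _; exact: wN.
have -> : m%:R * q = \sum_i (rho i + q - rho (s i)).
  rewrite big_split big_split /= sumrN [X in _ - X](reindex_inj (@perm_inj _ s^-1%g)) /=.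
  under [X in _ - X]eq_bigr do rewrite permKV.
  by rewrite sumr_const card_ord mulr_natl; lra.
elim: (index_enum _) => [|i l IH]; last by rewrite !big_cons; exact: wM.
rewrite !big_nil => -[|i]; rewrite coef1 /=; last exact: dg0.
by rewrite mul0r subr0 -polyC1; exact: dgC.
Qed.

End ReducedBasis.

(** * Free algebras over K[x]: trace, dual basis, derivation *)

(** The algebra A is free over K[x] with basis e; co gives the coordinates.
    When the discriminant of the trace form is nonzero, A is generically
    etale over K[x], and d/dx extends to a derivation after multiplication
    by the discriminant. *)
Section FreeAlgebra.
Context {K : numClosedFieldType} {m' : nat}.
Local Notation m := m'.+1.
Context {A : comNzRingType} (iota : {rmorphism {poly K} -> A}).
Variables (co : A -> 'I_m -> {poly K}) (e : 'I_m -> A).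
Hypothesis coK : forall a, a = \sum_i iota (co a i) * e i.
Hypothesis coE : forall P i, co (\sum_j iota (P j) * e j) i = P i.

Lemma co_inj a b : co a =1 co b -> a = b.
Proof. by move=> h; rewrite (coK a) (coK b); apply: eq_bigr => i _; rewrite h. Qed.

Lemma coD a b i : co (a + b) i = co a i + co b i.
Proof.
rewrite [in LHS](coK a) [in LHS](coK b) -big_split /=.
under eq_bigr do rewrite -mulrDl -rmorphD.
by rewrite (coE (fun i => co a i + co b i)).
Qed.

Lemma coZ P a i : co (iota P * a) i = P * co a i.
Proof.
rewrite [in LHS](coK a) mulr_sumr; under eq_bigr do rewrite mulrA -rmorphM.
by rewrite (coE (fun i => P * co a i)).
Qed.

Lemma co0 i : co 0 i = 0.
Proof. by apply/(addrI (co 0 i)); rewrite -coD !addr0. Qed.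

Lemma coN a i : co (- a) i = - co a i.
Proof. by apply/eqP; rewrite -addr_eq0 -coD addNr co0. Qed.

Lemma co_sum (I : Type) (s : seq I) (P : pred I) (F : I -> A) i :
  co (\sum_(j <- s | P j) F j) i = \sum_(j <- s | P j) co (F j) i.
Proof.
by apply: (big_morph (fun a => co a i)) => [a b|]; rewrite ?coD ?co0.
Qed.

Lemma co_e i j : co (e i) j = (i == j)%:R.
Proof.
have -> : e i = \sum_j iota ((i == j)%:R) * e j.
  rewrite (bigD1 i) //= eqxx rmorph1 mul1r big1 ?addr0 // => k /negbTE ki.
  by rewrite eq_sym ki rmorph0 mul0r.
by rewrite (coE (fun j => (i == j)%:R)).
Qed.

Definition Mx a : 'M[{poly K}]_m := \matrix_(l, i) co (a * e i) l.

Lemma mulr_e a i : a * e i = \sum_l iota (Mx a l i) * e l.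
Proof. by rewrite [LHS]coK; apply: eq_bigr => l _; rewrite mxE. Qed.

Lemma MxD a b : Mx (a + b) = Mx a + Mx b.
Proof. by apply/matrixP => l i; rewrite !mxE mulrDl coD. Qed.

Lemma MxZ P a : Mx (iota P * a) = P *: Mx a.
Proof. by apply/matrixP => l i; rewrite !mxE -mulrA coZ. Qed.

Lemma co_mul a b l : co (a * b) l = \sum_i Mx a l i * co b i.
Proof.
rewrite {1}(coK b) mulr_sumr co_sum; apply: eq_bigr => i _.
by rewrite mulrCA coZ mulrC mxE.
Qed.

Lemma MxM a b : Mx (a * b) = Mx a *m Mx b.
Proof.
apply/matrixP => l i; rewrite !mxE -mulrA co_mul; apply: eq_bigr => k _.
by rewrite [Mx b k i]mxE.
Qed.

Lemma Mx1 : Mx 1 = 1%:M.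
Proof. by apply/matrixP => l i; rewrite !mxE mul1r co_e eq_sym. Qed.

Lemma Mx_sum (I : Type) (s : seq I) (P : pred I) (F : I -> A) :
  Mx (\sum_(j <- s | P j) F j) = \sum_(j <- s | P j) Mx (F j).
Proof.
apply: (big_morph Mx) => [a b|]; rewrite ?MxD //.
by apply/matrixP => l i; rewrite !mxE mul0r co0.
Qed.

Lemma MxX a n : Mx (a ^+ n) = (Mx a) ^+ n.
Proof. by elim: n => [|n IH]; rewrite ?expr0 ?Mx1 // !exprS MxM IH. Qed.

Lemma Mx_iota P : Mx (iota P) = P%:M.
Proof. by rewrite -[iota P]mulr1 MxZ Mx1 scalemx1. Qed.

Lemma Mx_inj : injective Mx.
Proof.
move=> a b h; apply: co_inj => i.
by rewrite -[a]mulr1 -[b]mulr1 !co_mul h.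
Qed.

Definition atr a : {poly K} := \tr (Mx a).

Lemma atrZ P a : atr (iota P * a) = P * atr a.
Proof. by rewrite /atr MxZ mxtraceZ. Qed.

Lemma atr_sum (I : Type) (s : seq I) (P : pred I) (F : I -> A) :
  atr (\sum_(j <- s | P j) F j) = \sum_(j <- s | P j) atr (F j).
Proof. by rewrite /atr Mx_sum raddf_sum. Qed.

Definition Gram : 'M[{poly K}]_m := \matrix_(i, j) atr (e i * e j).

Definition disc : {poly K} := \det Gram.

Hypothesis disc0 : disc != 0.

(** The Gram matrix of the trace form has determinant disc, so the traces of
    a e_j determine a. *)
Lemma atr_nondeg a b : (forall j, atr (a * e j) = atr (b * e j)) -> a = b.
Proof.
move=> h; apply: co_inj => i.
have Gc c j : \sum_i co c i * Gram i j = atr (c * e j).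
  rewrite {2}(coK c) mulr_suml atr_sum; apply: eq_bigr => k _.
  by rewrite -mulrA atrZ mxE.
have E c : \row_i co c i *m Gram = \row_j atr (c * e j).
  by apply/rowP => j; rewrite !mxE -Gc; apply: eq_bigr => k _; rewrite mxE.
have : \row_i co a i *m Gram = \row_i co b i *m Gram.
  by rewrite !E; apply/rowP => j; rewrite !mxE h.
move/(congr1 (mulmx^~ (\adj Gram))); rewrite -!mulmxA mul_mx_adj !mul_mx_scalar.
by move/rowP/(_ i); rewrite !mxE => /(mulfI disc0).
Qed.

(** The basis dual to e for the trace form, multiplied by the discriminant
    so that its coordinates are polynomials. *)
Definition esh i : A := \sum_j iota (\adj Gram i j) * e j.

Lemma atr_esh i j : atr (esh i * e j) = disc *+ (i == j).
Proof.
rewrite /esh mulr_suml atr_sum.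
have -> : \sum_k atr (iota (\adj Gram i k) * e k * e j) = (\adj Gram *m Gram) i j.
  by rewrite [RHS]mxE; apply: eq_bigr => k _; rewrite -mulrA atrZ [Gram _ _]mxE.
by rewrite mul_adj_mx mxE.
Qed.

(** In the dual basis multiplication acts by the transposed matrix, because
    it is self-adjoint for the trace form. *)
Lemma mulr_esh a k : a * esh k = \sum_i iota (Mx a k i) * esh i.
Proof.
apply: atr_nondeg => j.
have -> : a * esh k * e j = esh k * (a * e j) by ring.
rewrite mulr_e mulr_sumr mulr_suml !atr_sum.
rewrite (bigD1 k) //= big1 => [|l lk]; last first.
  by rewrite mulrCA atrZ atr_esh eq_sym (negbTE lk) mulr0.
rewrite mulrCA atrZ atr_esh eqxx (bigD1 j) //= big1 => [|l lj].
  by rewrite -mulrA atrZ atr_esh eqxx !addr0.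
by rewrite -mulrA atrZ atr_esh (negbTE lj) mulr0.
Qed.

Lemma sum_e_esh : \sum_l e l * esh l = iota disc.
Proof.
apply: atr_nondeg => j; rewrite atrZ mulr_suml atr_sum.
rewrite {2}/atr /mxtrace mulr_sumr; apply: eq_bigr => l _.
have -> : e l * esh l * e j = esh l * (e j * e l) by ring.
rewrite mulr_e mulr_sumr atr_sum (bigD1 l) //= big1 => [|k kl].
  by rewrite mulrCA atrZ atr_esh eqxx addr0 mulrC.
by rewrite mulrCA atrZ atr_esh eq_sym (negbTE kl) mulr0.
Qed.

(** The sum over l and i of M'(l, i) e_l e_i^*, where M' is the derivative
    of the matrix of multiplication by a and e^* the dual basis scaled by
    the discriminant. Unlike the solution of the equation P(a) = 0 for
    da/dx, this formula needs no division. *)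
Definition der a : A := \sum_l \sum_i iota (Mx a l i)^`() * (e l * esh i).

Lemma derD a b : der (a + b) = der a + der b.
Proof.
rewrite /der -big_split; apply: eq_bigr => l _ /=; rewrite -big_split.
by apply: eq_bigr => i _ /=; rewrite MxD mxE derivD rmorphD mulrDl.
Qed.

(** Differentiate Mx (a b) = Mx a Mx b; the two halves are recombined by
    letting a act on e and b on the dual basis. *)
Lemma derM a b : der (a * b) = a * der b + b * der a.
Proof.
have -> : der (a * b) =
    \sum_k \sum_i iota (Mx b k i)^`() * (a * e k) * esh i +
    \sum_l \sum_k iota (Mx a l k)^`() * e l * (b * esh k).
  transitivity (\sum_l \sum_i \sum_k (iota (Mx b k i)^`() * (iota (Mx a l k) * e l) * esh i
      + iota (Mx a l k)^`() * e l * (iota (Mx b k i) * esh i))).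
    apply: eq_bigr => l _; apply: eq_bigr => i _; rewrite MxM mxE raddf_sum rmorph_sum.
    rewrite mulr_suml; apply: eq_bigr => k _; rewrite /= derivM rmorphD !rmorphM /=; ring.
  under eq_bigr do under eq_bigr do rewrite big_split /=.
  under eq_bigr do rewrite big_split /=; rewrite big_split /=; congr (_ + _).
    under eq_bigr do rewrite exchange_big /=; rewrite exchange_big /=.
    apply: eq_bigr => k _; rewrite exchange_big /=; apply: eq_bigr => i _.
    by rewrite mulr_e mulr_sumr mulr_suml.
  apply: eq_bigr => l _; rewrite exchange_big /=; apply: eq_bigr => k _.
  by rewrite mulr_esh mulr_sumr.
rewrite /der !mulr_sumr; congr (_ + _); apply: eq_bigr => l _; rewrite mulr_sumr;
  apply: eq_bigr => i _; ring.
Qed.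

Lemma der_iota P : der (iota P) = iota (P^`() * disc).
Proof.
rewrite rmorphM -sum_e_esh mulr_sumr; apply: eq_bigr => l _.
rewrite (bigD1 l) //= big1 => [|i il].
  by rewrite addr0 Mx_iota mxE eqxx mulr1n.
by rewrite Mx_iota mxE eq_sym (negbTE il) mulr0n raddf0 rmorph0 mul0r.
Qed.

End FreeAlgebra.

(** * Uniform bounds for exact forms on a free K[x]-algebra *)

Section MpolyBounds.
Context {R : idomainType} {n : nat}.
Implicit Types p q : {mpoly R[n]}.

Lemma mpoly_ring_ind (P : {mpoly R[n]} -> Prop) :
  (forall c, P c%:MP) -> (forall p q, P p -> P q -> P (p + q)) ->
  (forall c p, P p -> P (c *: p)) -> (forall i p, P p -> P ('X_i * p)) ->
  forall p, P p.
Proof.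
move=> PC PD PZ PX; apply: mpolyind => [|c m p _ _ Pp]; first by rewrite -mpolyC0.
apply: PD => //; apply: PZ; rewrite mpolyXE_id.
elim: (index_enum _) => [|i s IH]; first by rewrite big_nil -mpolyC1.
rewrite big_cons; elim: (m i) => [|k IHk]; first by rewrite expr0 mul1r.
by rewrite exprS -mulrA; exact: PX.
Qed.

Lemma msizeM_add p q : (msize (p * q) <= msize p + msize q)%N.
Proof.
have [->|p0] := eqVneq p 0; first by rewrite mul0r msize0.
have [->|q0] := eqVneq q 0; first by rewrite mulr0 msize0.
by rewrite msizeM // leq_pred.
Qed.

Lemma msizeM_leq p q a b : (msize p <= a)%N -> (msize q <= b)%N -> (msize (p * q) <= a + b)%N.
Proof. by move=> pa qb; apply: leq_trans (msizeM_add _ _) _; rewrite leq_add. Qed.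

Lemma msize_sum_leq (I : Type) (s : seq I) (P : pred I) (F : I -> {mpoly R[n]}) a :
  (forall i, P i -> (msize (F i) <= a)%N) -> (msize (\sum_(i <- s | P i) F i) <= a)%N.
Proof.
move=> h; apply: (big_ind (fun p => msize p <= a)%N) => //; first by rewrite msize0.
by move=> p q pa qa; apply: leq_trans (msizeD_le _ _) _; rewrite geq_max pa.
Qed.

Lemma msizeX_leq p a k : (msize p <= a)%N -> (msize (p ^+ k) <= k * a + 1)%N.
Proof.
move=> pa; elim: k => [|k IH]; first by rewrite expr0 msize1.
by rewrite exprS mulSn -addnA; exact: msizeM_leq.
Qed.

(** The polynomial P evaluated at xx. *)
Definition lift (xx : {mpoly R[n]}) (P : {poly R}) : {mpoly R[n]} :=
  (map_poly (@mpolyC n R) P).[xx].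

Lemma lift_is_zmod_morphism xx : zmod_morphism (lift xx).
Proof. by move=> P Q; rewrite /lift rmorphB hornerD hornerN. Qed.

Lemma lift_is_monoid_morphism xx : monoid_morphism (lift xx).
Proof. by split=> [|P Q]; rewrite /lift ?rmorph1 ?hornerC // rmorphM hornerM. Qed.

HB.instance Definition _ xx :=
  GRing.isZmodMorphism.Build {poly R} {mpoly R[n]} (lift xx) (lift_is_zmod_morphism xx).
HB.instance Definition _ xx :=
  GRing.isMonoidMorphism.Build {poly R} {mpoly R[n]} (lift xx) (lift_is_monoid_morphism xx).

Lemma liftC xx c : lift xx c%:P = c%:MP.
Proof. by rewrite /lift map_polyC hornerC. Qed.

Lemma liftX xx : lift xx 'X = xx.
Proof. by rewrite /lift map_polyX hornerX. Qed.

Lemma mderiv_lift xx k P : mderiv k (lift xx P) = lift xx P^`() * mderiv k xx.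
Proof.
elim/poly_ind: P => [|P c IH]; first by rewrite (raddf0 deriv) (rmorph0 (lift xx)) mderiv0 mul0r.
rewrite rmorphD rmorphM /= liftX liftC mderivD mderivM IH mderivC addr0.
rewrite derivMXaddC rmorphD rmorphM /= liftX; ring.
Qed.

Lemma msize_lift xx (P : {poly R}) a b : (msize xx <= a)%N -> (size P <= b)%N ->
  (msize (lift xx P) <= b * a + 1)%N.
Proof.
move=> xa Pb; rewrite /lift horner_coef; apply: msize_sum_leq => i _.
rewrite coef_map mul_mpolyC; apply: leq_trans (msizeZ_le _ _) _.
apply: leq_trans (msizeX_leq _ xa) _; rewrite leq_add2r leq_mul2r.
have h1 : (size (map_poly (@mpolyC n R) P) <= size P)%N by exact: size_poly.
by apply/orP; right; apply: leq_trans (leq_trans (ltnW (ltn_ord i)) h1) Pb.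
Qed.

End MpolyBounds.

(** Throughout, kap bounds the degrees of the structure constants. The final
    bounds are functions of m and kap, and of the sizes of lifts to
    polynomials, which is what makes them uniform in a family of algebras. *)
Section SpectralDegree.
Context {K : numClosedFieldType} {m' : nat}.
Local Notation m := m'.+1.
Context {A : comNzRingType} (iota : {rmorphism {poly K} -> A}).
Variables (co : A -> 'I_m -> {poly K}) (e : 'I_m -> A).
Hypothesis coK : forall a, a = \sum_i iota (co a i) * e i.
Hypothesis coE : forall P i, co (\sum_j iota (P j) * e j) i = P i.
Local Notation Mx := (Mx co e).
Local Notation atr := (atr co e).
Local Notation disc := (disc co e).
Local Notation Gram := (Gram co e).
Local Notation esh := (esh iota co e).
Local Notation der := (der iota co e).
Hypothesis disc0 : disc != 0.
Variable kap : rat.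
Hypothesis kap0 : 0 <= kap.
Hypothesis co_ee : forall i j k, dg (co (e i * e j) k) kap.
Hypothesis co_1 : forall k, dg (co 1 k) kap.

(** The naive degree, which depends on the basis and is submultiplicative
    only up to kap. *)
Definition adeg a (r : rat) : Prop := forall i, dg (co a i) r.

(** The spectral degree is at most q when the degrees of the powers of a
    grow at most like n q. It behaves like the largest order of pole at
    infinity, in the normalisation where x has degree 1: it is subadditive
    on products, and powers have proportional degree. *)
Definition spdeg (q : rat) a : Prop :=
  exists B, forall n, adeg (a ^+ n) (n%:R * q + B).

Lemma adegW a r s : r <= s -> adeg a r -> adeg a s.
Proof. by move=> rs h i; exact: dgW (h i). Qed.

Lemma adeg0 r : adeg 0 r.
Proof. by move=> i; rewrite (co0 coK coE); exact: dg0. Qed.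

Lemma adegD a b r : adeg a r -> adeg b r -> adeg (a + b) r.
Proof. by move=> h1 h2 i; rewrite (coD coK coE); exact: dgD. Qed.

Lemma adegN a r : adeg a r -> adeg (- a) r.
Proof. by move=> h1 i; rewrite (coN coK coE); exact: dgN. Qed.

Lemma adegB a b r : adeg a r -> adeg b r -> adeg (a - b) r.
Proof. by move=> h1 h2; apply: adegD => //; exact: adegN. Qed.

Lemma adeg_sum (I : Type) (s : seq I) (P : pred I) (F : I -> A) r :
  (forall i, P i -> adeg (F i) r) -> adeg (\sum_(i <- s | P i) F i) r.
Proof.
by move=> h; apply: (big_ind (fun p => adeg p r)) => //; [exact: adeg0|move=> *; exact: adegD].
Qed.

Lemma adegZ P a r s : dg P s -> adeg a r -> adeg (iota P * a) (s + r).
Proof. by move=> h1 h2 i; rewrite (coZ coK coE); exact: dgM. Qed.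

Lemma adeg_e i : adeg (e i) 0.
Proof.
move=> j; rewrite (co_e coE); case: eqP => _; last exact: dg0.
by rewrite -polyC1; exact: dgC.
Qed.

Lemma adegM a b r s : adeg a r -> adeg b s -> adeg (a * b) (r + s + kap).
Proof.
move=> h1 h2; rewrite (coK a) mulr_suml; apply: adeg_sum => i _.
rewrite -mulrA -!addrA; apply: adegZ => //.
rewrite (coK b) mulr_sumr; apply: adeg_sum => j _.
by rewrite mulrCA; apply: adegZ => // k; exact: co_ee.
Qed.

Lemma adeg_iota P r : dg P r -> adeg (iota P) (r + kap).
Proof. by move=> h; rewrite -[iota P]mulr1; apply: adegZ => // k; exact: co_1. Qed.

Lemma adeg_exists a : exists r, adeg a r.
Proof.
exists (\sum_i (size (co a i)).-1%:R) => i; apply: dgW (@dg_size _ _).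
by rewrite (bigD1 i) //= lerDl sumr_ge0 // => j _; exact: ler0n.
Qed.

Lemma spdegW a r s : r <= s -> spdeg r a -> spdeg s a.
Proof.
move=> rs [B h]; exists B => n; apply: adegW (h n).
by rewrite lerD2r ler_wpM2l.
Qed.

Lemma adeg_spdeg a r : adeg a r -> spdeg (r + kap) a.
Proof.
move=> h; exists kap; elim=> [|n IH].
  by rewrite expr0 mul0r add0r => k; exact: co_1.
by rewrite exprS; apply: adegW (adegM h IH); rewrite -natr1 mulrDl mul1r; lra.
Qed.

Lemma spdeg_iota P r : dg P r -> spdeg r (iota P).
Proof.
move=> h; exists kap => n; rewrite -rmorphXn; apply: adeg_iota.
elim: n => [|n IH]; first by rewrite mul0r expr0 -polyC1; exact: dgC.
by rewrite exprS; apply: dgW (dgM h IH); rewrite -natr1 mulrDl mul1r; lra.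
Qed.

Lemma spdegM a b r s : spdeg r a -> spdeg s b -> spdeg (r + s) (a * b).
Proof.
move=> [B h] [B' h']; exists (B + B' + kap) => n; rewrite exprMn.
by apply: adegW (adegM (h n) (h' n)); rewrite mulrDr; lra.
Qed.

Lemma adegMn a r n : adeg a r -> adeg (a *+ n) r.
Proof.
by move=> h; elim: n => [|n IH]; [rewrite mulr0n; exact: adeg0|rewrite mulrSr; exact: adegD].
Qed.

Lemma spdegD a b r : spdeg r a -> spdeg r b -> spdeg r (a + b).
Proof.
move=> [B h] [B' h']; exists (B + B' + kap) => n; rewrite exprDn; apply: adeg_sum => i _.
apply: adegMn; apply: adegW (adegM (h (n - i)%N) (h' i)).
have ni : (i <= n)%N by rewrite -ltnS.
by rewrite natrB //; lra.
Qed.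

Lemma spdeg_sum (I : Type) (s : seq I) (P : pred I) (F : I -> A) r :
  (forall i, P i -> spdeg r (F i)) -> spdeg r (\sum_(i <- s | P i) F i).
Proof.
move=> h; apply: (big_ind (spdeg r)) => //; last by move=> *; exact: spdegD.
by rewrite -(rmorph0 iota); apply: spdeg_iota; exact: dg0.
Qed.

Lemma spdegN a r : spdeg r a -> spdeg r (- a).
Proof.
move=> [B h]; exists B => n; rewrite exprNn -signr_odd mulr_sign.
by case: ifP => _; [exact: adegN|].
Qed.

Lemma spdegB a b r : spdeg r a -> spdeg r b -> spdeg r (a - b).
Proof. by move=> h1 h2; apply: spdegD => //; exact: spdegN. Qed.

Lemma spdegMn a r n : spdeg r a -> spdeg r (a *+ n).
Proof.
move=> h; rewrite -mulr_natl -(rmorph_nat iota) -[r]add0r; apply: spdegM => //.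
by apply: spdeg_iota; rewrite -polyC_natr; exact: dgC.
Qed.

Lemma spdegX a r n : spdeg r a -> spdeg (n%:R * r) (a ^+ n).
Proof.
move=> [B h]; exists B => k; rewrite -exprM; apply: adegW (h _).
by rewrite natrM mulrA [k%:R * _]mulrC.
Qed.

(** A bound for the powers of a^n extends to all powers of a, by writing an
    exponent as a multiple of n plus a remainder. *)
Lemma spdeg_root a r n : (0 < n)%N -> spdeg (n%:R * r) (a ^+ n) -> spdeg r a.
Proof.
move=> n0 [B h].
have [f hf] := choice (fun j => adeg_exists (a ^+ j)).
pose F := \sum_(j < n) (`|f j| + n%:R * `|r|).
exists (B + F + kap) => k; rewrite {1}(divn_eq k n) exprD mulnC exprM.
apply: adegW (adegM (h _) (hf _)).
rewrite !addrA lerD2r mulrA -natrM.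
have jn : (k %% n < n)%N by rewrite ltn_mod.
have -> : (k %/ n * n)%:R = k%:R - (k %% n)%:R :> rat.
  by rewrite {2}(divn_eq k n) natrD addrK.
have H : `|f (k %% n)%N| + n%:R * `|r| <= F.
  rewrite /F (bigD1 (Ordinal jn)) //= lerDl sumr_ge0 // => j _.
  by rewrite addr_ge0 // mulr_ge0.
have H1 : - ((k %% n)%:R * r) <= n%:R * `|r|.
  rewrite -mulrN; apply: le_trans (_ : (k %% n)%:R * `|r| <= _).
    by rewrite ler_wpM2l // -normrN ler_norm.
  by rewrite ler_wpM2r // ler_nat ltnW.
have H2 := ler_norm (f (k %% n)%N).
rewrite mulrBl; lra.
Qed.

Lemma adeg_cancel P a r : P != 0 -> adeg (iota P * a) r -> adeg a (r - (size P).-1%:R).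
Proof.
by move=> P0 h i; apply: dg_cancel => //; rewrite -(coZ coK coE).
Qed.

Lemma size_expP (P : {poly K}) n : P != 0 -> (size (P ^+ n)).-1 = ((size P).-1 * n)%N.
Proof. by move=> P0; rewrite size_exp. Qed.

Lemma spdeg_cancel P a r : P != 0 -> spdeg r (iota P * a) ->
  spdeg (r - (size P).-1%:R) a.
Proof.
move=> P0 [B h]; exists B => n.
have Pn : P ^+ n != 0 by rewrite expf_neq0.
have := h n; rewrite exprMn -rmorphXn => /(adeg_cancel Pn).
by rewrite size_expP // natrM; apply: adegW; lra.
Qed.

(** This is where reduced bases enter: the bound is the exact one, without
    the loss that a basis of A chosen in advance would cause. *)
Lemma spdeg_char a q : spdeg q a -> forall k, (k <= m)%N ->
  dg (char_poly (Mx a))`_k ((m - k)%:R * q).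
Proof.
move=> [B h]; apply: (@dg_char_poly _ _ _ _ `|denq q|%N).
- by rewrite absz_gt0 denq_neq0.
- exists (numq q); rewrite -{1}(divq_num_den q) pmulrn absz_denq.
  by rewrite divfK // intr_eq0 denq_neq0.
- exists (B + kap) => n l i; rewrite -(MxX coK coE) mxE.
  by apply: adegW (adegM (h n) (adeg_e i)) l; lra.
Qed.

Lemma spdeg_tr a q : spdeg q a -> dg (atr a) q.
Proof.
move=> /spdeg_char /(_ m'); rewrite leqnSn => /(_ isT).
rewrite -[m' in X in dg X]/(m.-1) char_poly_trace // subSnn mul1r => /dgN.
by rewrite opprK.
Qed.

Lemma dg_Gram i j : dg (Gram i j) (2%:R * kap).
Proof.
rewrite mxE; apply: spdeg_tr; have := adeg_spdeg (@adeg_e i).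
move=> h; apply: spdegW (spdegM h (adeg_spdeg (@adeg_e j))); lra.
Qed.

Definition kadj : rat := 2%:R * kap *+ m'.

Lemma kadj0 : (0 <= kadj)%R.
Proof. by rewrite mulrn_wge0 // mulr_ge0. Qed.

Lemma dg_adj i j : dg ((\adj Gram) i j) kadj.
Proof.
rewrite mxE /cofactor -signr_odd mulr_sign.
have H : dg (\det (row' j (col' i Gram))) kadj.
  by apply: dg_det => x y; rewrite [_ x y]mxE [_ _ y]mxE; exact: dg_Gram.
by case: ifP => _ //; exact: dgN.
Qed.

Lemma dg_disc : dg disc (2%:R * kap *+ m).
Proof. by apply: dg_det => i j; exact: dg_Gram. Qed.

(** The coordinates of a are recovered from the traces of a e_j through the
    inverse of the Gram matrix, and a trace is bounded by the spectral
    degree. So the two notions of degree differ by a constant. *)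
Lemma spdeg_adeg a q : spdeg q a -> adeg a (q + (kap + kadj)).
Proof.
move=> h i.
have E : disc * co a i = \sum_j atr (a * e j) * (\adj Gram) j i.
  have Gc j : \sum_i co a i * Gram i j = atr (a * e j).
    rewrite {2}(coK a) mulr_suml (atr_sum coK coE); apply: eq_bigr => k _.
    by rewrite -mulrA (atrZ coK coE) mxE.
  have : (\row_i co a i *m Gram) = \row_j atr (a * e j).
    apply/rowP => j; rewrite !mxE -Gc; apply: eq_bigr => k _.
    by congr (_ * _); rewrite mxE.
  move/(congr1 (mulmx^~ (\adj Gram))); rewrite -mulmxA mul_mx_adj mul_mx_scalar.
  move/rowP/(_ i); rewrite mxE [(\row_i _) _ _]mxE => ->.
  by rewrite mxE; apply: eq_bigr => j _; rewrite [(\row_j _) _ _]mxE.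
have : dg (disc * co a i) (q + (kap + kadj)).
  rewrite E; apply: dg_sum => j _; rewrite addrA; apply: dgM (dg_adj _ _).
  have := adeg_spdeg (@adeg_e j); rewrite add0r => H.
  by apply: spdeg_tr; apply: spdegM.
by move/(dg_cancel disc0); apply: dgW; rewrite gerBl ler0n.
Qed.

(** An element whose spectral degree is below every bound has coordinates of
    negative degree. *)
Lemma spdeg_nilp a : (forall q, spdeg q a) -> a = 0.
Proof.
move=> h; apply: (co_inj coK) => i; rewrite (co0 coK coE); apply: contrapT => /eqP c0.
have := dg_ge0 (spdeg_adeg (h (- (kap + kadj) - 1)) i) c0; lra.
Qed.

(** The powers of a nilpotent element have no growth at all; this shows that
    A is reduced. *)
Lemma nilp0 (a : A) n : a ^+ n = 0 -> a = 0.
Proof.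
move=> an; apply: spdeg_nilp => q; apply: (@spdeg_root _ _ n.+1) => //.
rewrite exprS an mulr0 -(rmorph0 iota); apply: spdeg_iota; exact: dg0.
Qed.

Lemma adeg_esh i : adeg (esh i) kadj.
Proof. by move=> j; rewrite /esh coE; exact: dg_adj. Qed.

Definition kder : rat := kap + kadj + kap.

Lemma adeg_der a r : adeg a r -> adeg (der a) (r + kder).
Proof.
move=> h; apply: adeg_sum => l _; apply: adeg_sum => i _.
have -> : r + kder = (r + 0 + kap) + (0 + kadj + kap) by rewrite /kder; lra.
apply: adegZ; last by apply: adegM; [exact: adeg_e|exact: adeg_esh].
by apply: dg_deriv; rewrite mxE; exact: (adegM h (@adeg_e i)).
Qed.

Lemma char_poly_root a : \sum_(k < m.+1) iota (char_poly (Mx a))`_k * a ^+ k = 0.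
Proof.
apply: (Mx_inj coK coE); rewrite (Mx_sum coK coE).
have -> : Mx 0 = 0 by rewrite -(rmorph0 iota) (Mx_iota coK coE) raddf0.
rewrite -[RHS](@Cayley_Hamilton _ _ (Mx a)).
rewrite -[char_poly (Mx a) in RHS]coefK poly_def rmorph_sum size_char_poly.
apply: eq_bigr => k _; rewrite /= horner_mxZ rmorphXn /= horner_mx_X.
by rewrite (MxZ coK coE) (MxX coK coE).
Qed.

Lemma dg_lead (c : {poly K}) n : dg c n%:R -> dg (c`_n *: 'X^n - c) (n%:R - 1).
Proof.
move=> h i; rewrite ltrBlDr natr1 ltr_nat ltnS leq_eqVlt => /orP[/eqP <-|ni].
  by rewrite coefB coefZ coefXn eqxx mulr1 subrr.
by rewrite coefB coefZ coefXn (gtn_eqF ni) mulr0 h ?subrr // ltr_nat.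
Qed.

Lemma spdeg_divn a r n : (0 < n)%N -> spdeg r (a *+ n) -> spdeg r a.
Proof.
move=> n0 h; have -> : a = iota (n%:R^-1)%:P * (a *+ n).
  rewrite mulrnAr -mulrnAl -rmorphMn -polyCMn -[_^-1 *+ n]mulr_natr.
  by rewrite mulVf ?pnatr_eq0 -?lt0n // rmorph1 mul1r.
by rewrite -[r]add0r; apply: spdegM => //; apply: spdeg_iota; exact: dgC.
Qed.

Lemma char_poly_top a : (char_poly (Mx a))`_m = 1.
Proof. by have /monicP := char_poly_monic (Mx a); rewrite /lead_coef size_char_poly. Qed.

(** Converse of [spdeg_char]: Cayley-Hamilton expresses a^n through lower
    powers, and the bounds propagate along this recursion. *)
Lemma char_spdeg a q :
  (forall k, (k < m)%N -> dg (char_poly (Mx a))`_k ((m - k)%:R * q)) -> spdeg q a.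
Proof.
move=> h; have [f hf] := choice (fun j => adeg_exists (a ^+ j)).
exists (\sum_(j < m) (`|f j| + `|j%:R * q|)) => n.
have [N] := ubnP n; elim: N n => // N IH n; rewrite ltnS => nN.
have [nm|mn] := ltnP n m.
  apply: adegW (hf n); rewrite (bigD1 (Ordinal nm)) //=.
  have := ler_norm (f n); have := ler_norm (- (n%:R * q)); rewrite normrN.
  have : 0 <= \sum_(i < m | i != Ordinal nm) (`|f i| + `|i%:R * q|).
    by rewrite sumr_ge0 // => j _; rewrite addr_ge0.
  lra.
have := char_poly_root a; rewrite big_ord_recr /= char_poly_top rmorph1 mul1r.
move/eqP; rewrite addrC addr_eq0 => /eqP E.
rewrite -(subnK mn) exprD E mulrN; apply: adegN; rewrite mulr_sumr.
apply: adeg_sum => k _; rewrite mulrCA -exprD.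
have km := ltn_ord k.
have lt : (n - m + k < N)%N by lia.
apply: adegW (adegZ (h k (ltn_ord k)) (IH _ lt)).
by rewrite addrA -mulrDl -natrD (_ : (m - k + (n - m + k) = n - m + m)%N) //; lia.
Qed.

(** The smallest spectral degree of a is the largest slope of the Newton
    polygon of its characteristic polynomial, hence a rational number with
    denominator at most m. *)
Lemma slope a : a != 0 -> exists p e : nat,
  [/\ (0 < e <= m)%N, spdeg (p%:R / e%:R) a & forall q, spdeg q a -> p%:R / e%:R <= q].
Proof.
move=> a0; pose c k := (char_poly (Mx a))`_k.
have [k0 ck0] : exists k : 'I_m, c k != 0.
  apply: contrapT => h; case/eqP: a0; apply: (@nilp0 _ m).
  have := char_poly_root a; rewrite big_ord_recr /= char_poly_top rmorph1 mul1r.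
  rewrite big1 ?add0r // => k _; have [->|ck] := eqVneq (char_poly (Mx a))`_k 0.
    by rewrite rmorph0 mul0r.
  by case: h; exists k.
pose w (k : 'I_m) : rat := (size (c k)).-1%:R / (m - k)%:R.
have [k ck kmax] : exists2 k : 'I_m, c k != 0 & forall j : 'I_m, c j != 0 -> w j <= w k.
  pose k := [arg max_(i > k0 | c i != 0) w i]%O; exists k; rewrite /k; case: arg_maxP => //.
have mk (j : 'I_m) : 0 < (m - j)%:R :> rat by rewrite ltr0n subn_gt0.
exists (size (c k)).-1, (m - k)%N; split.
- by rewrite subn_gt0 ltn_ord leq_subr.
- apply: char_spdeg => j jm; have [E|cj] := eqVneq (c j) 0.
    by rewrite -/(c j) E; exact: dg0.
  apply: dgW (@dg_size _ _); have := kmax (Ordinal jm) cj.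
  by rewrite /w /= ler_pdivrMr ?(mk (Ordinal jm)) // mulrC.
- move=> q /spdeg_char /(_ k (ltnW (ltn_ord k))) /dg_sizeP /(_ ck).
  by rewrite ler_pdivrMr ?mk // mulrC.
Qed.

Definition cst (c : K) : A := iota c%:P.

Lemma spdeg_cst c a r : spdeg r a -> spdeg r (cst c * a).
Proof.
by move=> h; rewrite -[r]add0r; apply: spdegM h; apply: spdeg_iota; exact: dgC.
Qed.

Section Homogenization.
Variables u z : A.

(** The homogenisation z^N g(u / z), for g of degree at most N. *)
Definition hom N (g : {poly K}) : A := \sum_(i < N.+1) cst g`_i * u ^+ i * z ^+ (N - i).

Lemma homD N g h : hom N (g + h) = hom N g + hom N h.
Proof.
rewrite -big_split; apply: eq_bigr => i _ /=.
by rewrite coefD /cst polyCD rmorphD !mulrDl.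
Qed.

Lemma homZ N c g : hom N (c *: g) = cst c * hom N g.
Proof.
rewrite mulr_sumr; apply: eq_bigr => i _ /=.
by rewrite coefZ /cst polyCM rmorphM !mulrA.
Qed.

Lemma hom0 N : hom N 0 = 0.
Proof. by rewrite /hom big1 // => i _; rewrite coef0 /cst polyC0 rmorph0 !mul0r. Qed.

Lemma hom_sum N (I : Type) (s : seq I) (F : I -> {poly K}) :
  hom N (\sum_(i <- s) F i) = \sum_(i <- s) hom N (F i).
Proof. by apply: (big_morph (hom N)) => [g h|]; rewrite ?homD ?hom0. Qed.

Lemma homXn N i : (i <= N)%N -> hom N 'X^i = u ^+ i * z ^+ (N - i).
Proof.
move=> iN; rewrite /hom (bigD1 (Ordinal (iN : (i < N.+1)%N))) //= coefXn eqxx.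
rewrite /cst polyC1 rmorph1 mul1r big1 ?addr0 // => j ji.
rewrite coefXn; case: eqP => [E|_]; last by rewrite /cst polyC0 rmorph0 !mul0r.
by case/eqP: ji; apply: val_inj.
Qed.

Lemma poly_expand N (g : {poly K}) : (size g <= N.+1)%N -> g = \sum_(i < N.+1) g`_i *: 'X^i.
Proof. by move=> gN; rewrite -poly_def; apply/polyP => i; rewrite coef_poly; case: ltnP => // h; rewrite nth_default // (leq_trans gN). Qed.

Lemma homM N N' (g h : {poly K}) : (size g <= N.+1)%N -> (size h <= N'.+1)%N ->
  hom (N + N') (g * h) = hom N g * hom N' h.
Proof.
move=> gN hN; rewrite {1}(poly_expand gN) mulr_suml hom_sum [hom N g in RHS]/hom mulr_suml.
apply: eq_bigr => i _; rewrite {1}(poly_expand hN) mulr_sumr hom_sum [hom N' h in RHS]/hom mulr_sumr.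
apply: eq_bigr => j _.
have iN := ltn_ord i; have jN := ltn_ord j.
rewrite -scalerAl -scalerAr -exprD !homZ homXn; last by rewrite leq_add.
have -> : (N + N' - (i + j) = (N - i) + (N' - j))%N by lia.
rewrite !exprD; ring.
Qed.

Lemma spdeg_hom p N (g : {poly K}) : spdeg p u -> spdeg p z -> spdeg (N%:R * p) (hom N g).
Proof.
move=> hu hz; apply: spdeg_sum => i _; rewrite -mulrA; apply: spdeg_cst.
apply: spdegW (spdegM (spdegX i hu) (spdegX (N - i) hz)).
by rewrite -mulrDl -natrD subnKC // -ltnS.
Qed.

End Homogenization.

Local Notation "'xA" := (iota 'X).
Definition ell : rat := (size disc).-1%:R.

Lemma der_sum (I : Type) (s : seq I) (P : pred I) (F : I -> A) :
  der (\sum_(i <- s | P i) F i) = \sum_(i <- s | P i) der (F i).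
Proof.
apply: (big_morph der) => [a b|]; first exact: (derD coK coE).
by rewrite -(rmorph0 iota) (der_iota coK coE disc0) raddf0 mul0r.
Qed.

Lemma der_cst c a : der (cst c * a) = cst c * der a.
Proof.
rewrite (derM coK coE disc0) (der_iota coK coE disc0) derivC mul0r rmorph0.
by rewrite mulr0 addr0.
Qed.

Lemma der_exp a n : der (a ^+ n.+1) = n.+1%:R * a ^+ n * der a.
Proof.
elim: n => [|n IH]; first by rewrite expr1 expr0 !mul1r.
rewrite exprS (derM coK coE disc0) IH exprS; ring.
Qed.

Lemma der_Xn k : 'xA * der (iota 'X^k) = k%:R * iota 'X^k * iota disc.
Proof.
rewrite (der_iota coK coE disc0) derivXn.
case: k => [|k]; first by rewrite mulr0n mul0r rmorph0 mulr0 !mul0r.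
rewrite rmorphM rmorphMn /= exprS rmorphM /= -mulr_natl; ring.
Qed.

(** Euler's identity. The operator x der - (deg) disc kills the powers of x
    and satisfies the Leibniz rule, so it acts on b, which is a times a
    homogeneous expression in a^f and x^p, through the derivative of that
    expression. *)
Lemma der_hom a (p f d : nat) (h : {poly K}) : (size h <= d.+1)%N ->
  let u := a ^+ f in let z := iota 'X^p in
  let b := a * hom u z d h in
  'xA * der b *+ f - iota disc * b *+ (d * p * f + p) =
  hom u z d (h + f%:R *: ('X * h^`())) * ('xA * der a *+ f - iota disc * a *+ p).
Proof.
move=> hd u z b.
pose L c := 'xA * der c *+ f - iota disc * c *+ (d * p * f + p).
set r := _ - _ *+ p.
have Lsum (F : 'I_d.+1 -> A) : L (\sum_i F i) = \sum_i L (F i).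
  by rewrite /L der_sum !mulr_sumr -!sumrMnl sumrB.
have Lcst c x : L (cst c * x) = cst c * L x.
  by rewrite /L der_cst mulrBr !mulrnAr; congr (_ *+ _ - _ *+ _); ring.
rewrite -/(L b) /b /hom mulr_sumr Lsum mulr_suml; apply: eq_bigr => i _.
have -> : a * (cst h`_i * u ^+ i * z ^+ (d - i)) = cst h`_i * (a * u ^+ i * z ^+ (d - i)) by ring.
have -> : (h + f%:R *: ('X * h^`()))`_i = h`_i * (1 + f * i)%:R.
  rewrite coefD coefZ coefXM; case: (i : nat) => [|j]; rewrite /= ?muln0 ?mulr0 ?addr0 ?mulr1 //.
  by rewrite coef_deriv -mulr_natr natrD natrM; ring.
have -> : cst (h`_i * (1 + f * i)%:R) = cst h`_i * (1 + f * i)%:R.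
  by rewrite /cst polyCM rmorphM polyC_natr rmorph_nat.
rewrite Lcst -!mulrA; congr (_ * _).
have id : (i <= d)%N by rewrite -ltnS.
have -> : z ^+ (d - i) = iota 'X^(p * (d - i)) by rewrite /z -rmorphXn exprM.
have -> : a * (u ^+ i * iota 'X^(p * (d - i))) = a ^+ (f * i).+1 * iota 'X^(p * (d - i)).
  by rewrite /u -exprM exprS mulrA.
rewrite /L (derM coK coE disc0) der_exp mulrDr.
have -> : 'xA * (a ^+ (f * i).+1 * der (iota 'X^(p * (d - i)))) =
  a ^+ (f * i).+1 * ((p * (d - i))%:R * iota 'X^(p * (d - i)) * iota disc).
  by rewrite -der_Xn; ring.
rewrite /r /u -!exprM exprS -[_ *+ f]mulr_natr -[_ *+ (_ + _)]mulr_natr.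
rewrite -[_ *+ f]mulr_natr -[_ *+ p]mulr_natr.
rewrite -[(f * i).+1%:R]natr1 !natrD !natrM natrB //.
set Z := iota 'X^_; ring.
Qed.

Lemma prod_dvd_exp (h : {poly K}) (rs : seq K) :
  (forall al, al \in rs -> root h al) ->
  \prod_(al <- rs) ('X - al%:P) %| h ^+ size rs.
Proof.
elim: rs => [|al rs IH] hr; first by rewrite big_nil expr0 dvd1p.
rewrite big_cons exprS; apply: dvdp_mul.
  by rewrite dvdp_XsubCl hr ?inE ?eqxx.
by apply: IH => be bs; apply: hr; rewrite inE bs orbT.
Qed.

(** At a root of h the first polynomial takes the value of e0 X h', which is
    nonzero since the roots are simple and nonzero; at 0 it takes the value
    of h. *)
Lemma coprime_euler (s : seq K) (e0 : nat) : uniq s -> 0 \notin s -> (0 < e0)%N ->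
  let h := \prod_(al <- s) ('X - al%:P) in
  coprimep (h + e0%:R *: ('X * h^`())) ('X * h).
Proof.
move=> us s0 e_gt0; set h := \prod_(al <- s) _; rewrite /= coprimep_sym.
apply: Pdiv.ClosedField.root_coprimep => x; rewrite rootM => /orP[|hx].
  rewrite rootX => /eqP ->; rewrite hornerD hornerZ hornerM hornerX mul0r mulr0 addr0.
  by rewrite -[_ == 0]/(root h 0) root_prod_XsubC.
have xs : x \in s by rewrite -root_prod_XsubC.
have x0 : x != 0 by apply: contraNneq s0 => <-.
have Eh : h = ('X - x%:P) * \prod_(al <- rem x s) ('X - al%:P).
  by rewrite /h (perm_big _ (perm_to_rem xs)) big_cons.
move: hx; rewrite hornerD hornerZ hornerM hornerX => /rootP ->; rewrite add0r.
rewrite !mulf_neq0 ?pnatr_eq0 -?lt0n //.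
rewrite Eh derivM derivXsubC mul1r hornerD hornerM hornerXsubC subrr mul0r addr0.
by rewrite -[_ == 0]/(root _ x) root_prod_XsubC mem_rem_uniq // inE eqxx.
Qed.

(** On x^q, the operator x der raises the degree by exactly ell, the degree
    of the discriminant; c measures the possible excess for other elements. *)
Definition shift_bound c := forall q a, spdeg q a -> spdeg (q + ell + c) ('xA * der a).

Lemma spdeg_Xn n : spdeg n%:R (iota 'X^n).
Proof. by apply: spdeg_iota; exact: dgXn. Qed.

Lemma spdeg_disc : spdeg ell (iota disc).
Proof. by apply: spdeg_iota; exact: dg_size. Qed.

(** A lower bound for the gain 1 / (m f) in [shift_bound_step], uniform in
    the denominator f <= m of the slope. *)
Definition eps : rat := (m * m)%:R^-1.

(** Let u = a^f and z = x^p, which have the same spectral degree p, and let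
    g be the leading form of the characteristic polynomial of u. Homogenised
    at u, z, the polynomial g has smaller degree than expected, by
    Cayley-Hamilton, and so has X h, where h has the nonzero roots of g as
    simple roots. Hence b = a h(u, z) has degree smaller than expected by at
    least eps, and the hypothesis applied to b bounds x der b. By [der_hom]
    this bounds (h + f X h')(u, z) times the left-hand side. The factor h +
    f X h' is coprime to X h by [coprime_euler], so a power of z times the
    left-hand side is bounded, and that power can be cancelled. *)
Lemma shift_bound_step (c : rat) a (p f : nat) : 0 <= c -> shift_bound c ->
  (0 < f <= m)%N -> spdeg (p%:R / f%:R) a ->
  spdeg (p%:R / f%:R + ell + c - eps)
    ('xA * der a *+ f - iota disc * a *+ p).
Proof.
rewrite /eps => c0 hc /andP[e_gt0 em] ha; set q := p%:R / f%:R in ha *.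
have e0 : 0 < f%:R :> rat by rewrite ltr0n.
have eq_p : f%:R * q = p%:R by rewrite /q mulrC divfK ?gt_eqF.
set u := a ^+ f; set z := iota 'X^p.
have hu : spdeg p%:R u by rewrite -eq_p; exact: spdegX.
have hz : spdeg p%:R z by exact: spdeg_Xn.
pose ck k := (char_poly (Mx u))`_k.
(* the leading form: the coefficients of extreme degree (m - k) p *)
pose g := \poly_(k < m.+1) (ck k)`_((m - k) * p).
have gm : g`_m = 1 by rewrite coef_poly ltnSn subnn mul0n /ck char_poly_top coef1.
have g_size : size g = m.+1.
  apply/eqP; rewrite eqn_leq size_poly /=; rewrite ltnNge; apply/negP => h.
  by move: gm; rewrite nth_default // => /esym/eqP; rewrite oner_eq0.
have hg : spdeg (m%:R * p%:R - 1) (hom u z m g).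
  have -> : hom u z m g = \sum_(k < m.+1) iota ((ck k)`_((m - k) * p) *: 'X^((m - k) * p) - ck k) * u ^+ k.
    transitivity (hom u z m g - \sum_(k < m.+1) iota (ck k) * u ^+ k).
      by rewrite char_poly_root subr0.
    rewrite /hom -sumrB; apply: eq_bigr => k _.
    rewrite coef_poly ltn_ord rmorphB mulrBl -mul_polyC rmorphM.
    rewrite [X in iota 'X^X]mulnC exprM rmorphXn.
    by rewrite /cst; congr (_ - _); ring.
  apply: spdeg_sum => k _; have km : (k <= m)%N by rewrite -ltnS.
  have H : dg (ck k) ((m - k) * p)%:R by rewrite natrM; exact: spdeg_char.
  apply: spdegW (spdegM (spdeg_iota (dg_lead H)) (spdegX k hu)).
  by rewrite natrM natrB //; lra.
have [rs Hrs] := closed_field_poly_normal g.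
have {}Hrs : g = \prod_(al <- rs) ('X - al%:P).
  by rewrite Hrs /lead_coef g_size gm scale1r.
have rs_size : size rs = m.
  by apply/eqP; rewrite -eqSS -g_size Hrs size_prod_XsubC.
pose s := [seq al <- undup rs | al != 0].
pose h := \prod_(al <- s) ('X - al%:P).
pose d := size s.
have us : uniq s by rewrite filter_uniq ?undup_uniq.
have s0 : 0 \notin s by rewrite mem_filter eqxx.
have h_size : size h = d.+1 by rewrite size_prod_XsubC.
have h0 : h != 0 by rewrite -size_poly_eq0 h_size.
have Xh_size : size ('X * h) = d.+2 by rewrite mulrC size_mulX // h_size.
(* this divisibility turns the drop of 1 in the degree of g(u, z) into a
   drop of 1 / m for (X h)(u, z) *)
have /dvdpP[g2 Hg2] : g %| ('X * h) ^+ m.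
  rewrite Hrs -rs_size; apply: prod_dvd_exp => al alr.
  rewrite rootM rootX; have [//|al0 /=] := eqVneq al 0.
  by rewrite root_prod_XsubC mem_filter al0 mem_undup.
have g2_size : (size g2 <= (m * d).+1)%N.
  have [->|g20] := eqVneq g2 0; first by rewrite size_poly0.
  have g0 : g != 0 by rewrite -size_poly_eq0 g_size.
  have Xh0 : 'X * h != 0 by rewrite -size_poly_eq0 Xh_size.
  have : (size (('X * h) ^+ m)).-1 = (d.+1 * m)%N by rewrite size_exp Xh_size.
  rewrite Hg2 size_mul // g_size addnS /=; case: (size g2) => //= k; rewrite mulSn [(d * m)%N]mulnC; clear; lia.
have hXh : spdeg (d.+1%:R * p%:R - m%:R^-1) (hom u z d.+1 ('X * h)).
  apply: (@spdeg_root _ _ m) => //.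
  have powE : hom u z d.+1 ('X * h) ^+ m = hom u z (m * d.+1) (('X * h) ^+ m).
    have num_size n : (size (('X * h) ^+ n) <= (n * d.+1).+1)%N.
      have := size_exp ('X * h) n; rewrite Xh_size /=.
      by case: (size _) => //= k ->; rewrite mulnC.
    elim: (m) => [|n IH].
      by rewrite !expr0 /hom big_ord1 coef1 /= /cst polyC1 rmorph1 !mul1r expr0.
    by rewrite !exprS IH mulSn homM // Xh_size.
  rewrite powE Hg2 [g2 * g]mulrC mulnS homM ?g_size //.
  apply: spdegW (spdegM hg (spdeg_hom _ _ hu hz)) => //.
  rewrite mulrBr mulfV ?pnatr_eq0 // natrM -natr1; lra.
have XhE : hom u z d.+1 ('X * h) = u * hom u z d h.
  rewrite -[d.+1]add1n homM ?size_polyX ?h_size //; congr (_ * _).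
  by rewrite -[in LHS](expr1 'X) homXn // expr1 expr0 mulr1.
set b := a * hom u z d h.
have hb : spdeg (q + d%:R * p%:R - (m * f)%:R^-1) b.
  apply: (@spdeg_root _ _ f) => //.
  have -> : b ^+ f = hom u z d.+1 ('X * h) * hom u z d h ^+ f.-1.
    by rewrite XhE -mulrA -exprS prednK // /b exprMn.
  apply: spdegW (spdegM hXh (spdegX _ (spdeg_hom _ _ hu hz))).
  have Hmf : f%:R * (m * f)%:R^-1 = m%:R^-1 :> rat.
    by rewrite natrM invfM mulrCA divff ?gt_eqF // mulr1.
  have -> : f.-1%:R = f%:R - 1 :> rat by rewrite -subn1 natrB.
  rewrite mulrBr mulrDr eq_p Hmf -[d.+1%:R]natr1.
  by rewrite le_eqVlt; apply/orP; left; apply/eqP; ring.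
have ee : (m * m)%:R^-1 <= (m * f)%:R^-1 :> rat.
  by rewrite lef_pV2 ?posrE ?ltr0n ?muln_gt0 // ler_nat leq_mul2l em orbT.
have ee' : (m * m)%:R^-1 <= m%:R^-1 :> rat.
  by rewrite lef_pV2 ?posrE ?ltr0n ?muln_gt0 // ler_nat leq_pmulr.
move: (m * m)%:R^-1 (m * f)%:R^-1 m%:R^-1 ee ee' hXh hb => E2 E1 E3 ee ee' hXh hb.
set r := _ - _ *+ p.
have hr : spdeg (q + ell + c) r.
  apply: spdegB; apply: spdegMn; first exact: hc.
  by apply: spdegW (spdegM spdeg_disc ha); lra.
have /Bezout_eq1_coprimepP[[al be] /= Hbez] := coprime_euler us s0 e_gt0.
rewrite -/h in Hbez; set H := h + _ in Hbez.
have hHr : spdeg (q + d%:R * p%:R + ell + c - E2) (hom u z d H * r).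
  rewrite -der_hom ?h_size // -/b; apply: spdegB; apply: spdegMn.
    by apply: spdegW (hc _ _ hb); move: (d%:R * p%:R) => ?; lra.
  by apply: spdegW (spdegM spdeg_disc hb); move: (d%:R * p%:R) => ?; lra.
have H_size : (size H <= d.+1)%N.
  rewrite -h_size; apply: leq_trans (size_polyD _ _) _; rewrite geq_max leqnn /=.
  apply: leq_trans (size_scale_leq _ _) _; have [->|h'0] := eqVneq h^`() 0.
    by rewrite mulr0 size_poly0.
  by rewrite mulrC size_mulX // lt_size_deriv.
pose N := maxn (size al) (size be).
have Ez : z ^+ (N + d.+1) = hom u z N.+1 al * hom u z d H + hom u z N be * hom u z d.+1 ('X * h).
  rewrite -!homM ?Xh_size ?H_size //; last 2 first.
  - by apply: leq_trans (leqnSn _); rewrite /N leq_maxr.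
  - by do 2 apply: leqW; rewrite /N leq_maxl.
  rewrite addSnnS -homD Hbez -(expr0 'X) homXn // expr0 mul1r subn0 //.
have hz' : spdeg (p%:R * (N + d.+1)%:R + (q + ell + c - E2)) (iota ('X^(p * (N + d.+1))) * r).
  have -> : iota 'X^(p * (N + d.+1)) = z ^+ (N + d.+1) by rewrite exprM rmorphXn.
  rewrite Ez mulrDl -!mulrA; apply: spdegD.
    apply: spdegW (spdegM (spdeg_hom _ _ hu hz) hHr); rewrite natrD -[N.+1%:R]natr1 -[d.+1%:R]natr1.
    rewrite !mulrDl !mulrDr !mul1r !mulr1 ![p%:R * _]mulrC; move: (N%:R * p%:R) (d%:R * p%:R) => ? ?; lra.
  rewrite [hom u z d.+1 _ * r]mulrC mulrA mulrAC.
  apply: spdegW (spdegM (spdegM (spdeg_hom _ _ hu hz) hXh) hr); rewrite natrD -[d.+1%:R]natr1.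
  rewrite !mulrDl !mulrDr !mul1r !mulr1 ![p%:R * _]mulrC; move: (N%:R * p%:R) (d%:R * p%:R) => ? ?; lra.
have Xn0 : 'X^(p * (N + d.+1)) != 0 :> {poly K} by rewrite monic_neq0 ?monicXn.
have := spdeg_cancel Xn0 hz'; rewrite [size _]size_polyXn /= natrM; apply: spdegW; move: (p%:R * _) => ?; lra.
Qed.

Lemma spdeg0 q : spdeg q 0.
Proof. by rewrite -(rmorph0 iota); apply: spdeg_iota; exact: dg0. Qed.

Lemma der0 : der 0 = 0.
Proof. by apply/(addrI (der 0)); rewrite -(derD coK coE) !addr0. Qed.

Lemma ell0 : (0 <= ell)%R.
Proof. exact: ler0n. Qed.

Lemma eps_gt0 : (0 < eps)%R.
Proof. by rewrite invr_gt0 ltr0n. Qed.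

Lemma kder0 : (0 <= kder)%R.
Proof. by rewrite /kder !addr_ge0 // kadj0. Qed.

(** A crude bound, by comparison of the spectral degree with the naive one. *)
Lemma shift_bound_init : shift_bound (kap + kadj + kder + kap + 1).
Proof.
move=> q a /spdeg_adeg /adeg_der /adeg_spdeg h.
have := spdegM (spdeg_Xn 1) h; rewrite expr1; apply: spdegW.
have := ell0; lra.
Qed.

(** x der a is proportional to disc a up to the better behaved difference of
    [shift_bound_step], and disc a has no excess. *)
Lemma shift_bound_improve (c : rat) : 0 <= c -> shift_bound c ->
  shift_bound (Num.max 0 (c - eps)).
Proof.
move=> c0 hc q a ha; have [->|a0] := eqVneq a 0.
  by rewrite der0 mulr0; exact: spdeg0.
have [p [f [/andP[f0 fm] hpf]]] := slope a0 => /(_ _ ha) pfq.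
apply: (@spdeg_divn _ _ f) => //.
have H1 := shift_bound_step c0 hc (introT andP (conj f0 fm)) hpf.
move: (p%:R / f%:R) hpf pfq H1 => r hpf pfq H1.
have -> : 'xA * der a *+ f = ('xA * der a *+ f - iota disc * a *+ p) + iota disc * a *+ p.
  by rewrite subrK.
have c1 : c - eps <= Num.max 0 (c - eps) by rewrite le_max lexx orbT.
have c2 : 0 <= Num.max 0 (c - eps) by rewrite le_max lexx.
move: (Num.max 0 (c - eps)) c1 c2 => M c1 c2.
apply: spdegD; first by apply: spdegW H1; lra.
apply: spdegMn; apply: spdegW (spdegM spdeg_disc hpf); lra.
Qed.

(** The excess decreases by the fixed amount eps at each step, so it
    disappears after finitely many. *)
Lemma shift_bound0 : shift_bound 0.
Proof.
set c := kap + kadj + kder + kap + 1.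
have c0 : 0 <= c by rewrite /c !addr_ge0 // ?kadj0 ?kder0.
have e0 := eps_gt0.
have H n : shift_bound (Num.max 0 (c - n%:R * eps)).
  elim: n => [|n IH].
    by rewrite mul0r subr0 max_r //; exact: shift_bound_init.
  have := shift_bound_improve _ IH; rewrite le_max lexx => /(_ isT) h.
  move=> q a ha; apply: spdegW (h q a ha); rewrite lerD2l.
  rewrite ge_max; apply/andP; split; first by rewrite le_max lexx.
  rewrite -natr1 mulrDl mul1r !le_max.
  have [h0|h0] := leP 0 (c - n%:R * eps); last by apply/orP; left; lra.
  by apply/orP; right; lra.
have := H (Num.Def.archi_bound (c / eps)); rewrite max_l //.
have := archi_boundP (divr_ge0 c0 (ltW e0)).
by rewrite ltr_pdivrMr // => h; lra.
Qed.

(** The operator x der acts on the leading part of slope p / f as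
    multiplication by p / f times the discriminant, as x d/dx does on
    x^(p/f). *)
Lemma der_leading a (p f : nat) : (0 < f <= m)%N -> spdeg (p%:R / f%:R) a ->
  spdeg (p%:R / f%:R + ell - eps) ('xA * der a *+ f - iota disc * a *+ p).
Proof.
move=> fm ha; have := shift_bound_step (lexx 0) shift_bound0 fm ha.
by rewrite addr0.
Qed.

(** If the slope r of a is positive, then the leading part of x der a is r
    disc a, of degree r + ell. *)
Lemma spdeg_der_inv a q : spdeg q ('xA * der a) -> spdeg (Num.max 0 (q - ell)) a.
Proof.
move=> h; have [->|a0] := eqVneq a 0; first exact: spdeg0.
have [p [f [/andP[f0 fm] hpf hmin]]] := slope a0.
have [p0|p0] := posnP p.
  by move: hpf; rewrite p0 mul0r; apply: spdegW; rewrite le_max lexx.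
apply: spdegW (hpf); set r := p%:R / f%:R in hmin hpf *.
rewrite le_max; apply/orP; right.
have H : spdeg (Num.max q (r + ell - eps) - ell) a.
  apply: spdeg_cancel disc0 _; apply: (@spdeg_divn _ _ p) => //.
  have -> : iota disc * a *+ p = 'xA * der a *+ f - ('xA * der a *+ f - iota disc * a *+ p).
    by rewrite opprB addrCA subrr addr0.
  apply: spdegB.
    by apply: spdegMn; apply: spdegW h; rewrite le_max lexx.
  apply: spdegW (der_leading (introT andP (conj f0 fm)) hpf).
  by rewrite le_max lexx orbT.
have := hmin _ H; have e0 := eps_gt0.
by case: (leP q (r + ell - eps)) => h1; lra.
Qed.

Lemma divr_disc a : exists b r, a = iota disc * b + r /\ adeg r ell.
Proof.
exists (\sum_i iota (co a i %/ disc) * e i), (\sum_i iota (co a i %% disc) * e i); split.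
  rewrite {1}(coK a) mulr_sumr -big_split; apply: eq_bigr => i _ /=.
  by rewrite {1}(divp_eq (co a i) disc) rmorphD rmorphM /=; ring.
move=> i; rewrite coE; apply: dgW (@dg_size _ _); rewrite ler_nat.
have := ltn_modp (co a i) disc; rewrite disc0.
by case: (size disc) => // n; rewrite ltnS /=; case: (size _) => //= k; apply: ltnW.
Qed.

Lemma ell_le : (ell <= 2%:R * kap *+ m)%R.
Proof. exact: dg_sizeP dg_disc disc0. Qed.

Definition kder_coker : rat := 2%:R * kap *+ m + (kap + kap + kadj).

(** Integration term by term. If x b has slope p / f, then (f / p) x b is a
    primitive of the leading part of b by [der_leading]; the remainder,
    divided by disc, has degree smaller by eps, and one starts again until
    the degree is bounded. *)
Lemma der_coker b : exists a, adeg (iota disc * b - der a) kder_coker.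
Proof.
have [q hq] := adeg_exists b; have {hq} hq := adeg_spdeg hq.
have e0 := eps_gt0.
have [N hN] : exists N : nat, spdeg (kap + N%:R * eps) b.
  exists (Num.Def.archi_bound (`|q| / eps)); apply: spdegW hq.
  rewrite addrC lerD2l; apply: le_trans (ler_norm q) _.
  have := archi_boundP (divr_ge0 (normr_ge0 q) (ltW e0)).
  by rewrite ltr_pdivrMr //; apply: ltW.
have base b' : spdeg kap b' -> exists a, adeg (iota disc * b' - der a) kder_coker.
  move=> h; exists 0; rewrite der0 subr0.
  apply: adegW (adegZ dg_disc (spdeg_adeg h)); rewrite /kder_coker; lra.
elim: N b hN {q hq} => [|N IH] b; first by rewrite mul0r addr0; exact: base.
have X0 : 'X != 0 :> {poly K} by rewrite polyX_eq0.
have sizeX1 : (size ('X : {poly K})).-1%:R = 1 :> rat by rewrite size_polyX.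
move=> hb; have [xb0|xb0] := eqVneq ('xA * b) 0.
  apply: base; have := spdeg0 (kap + 1); rewrite -xb0.
  by move/(spdeg_cancel X0); apply: spdegW; rewrite sizeX1; lra.
have [p [f [/andP[f0 fm] hpf hmin]]] := slope xb0.
have hX : spdeg 1 'xA by have := spdeg_Xn 1; rewrite expr1.
have [p0|p0] := posnP p.
  apply: base; move: hpf; rewrite p0 mul0r => /(spdeg_cancel X0).
  by apply: spdegW; rewrite sizeX1 sub0r (le_trans _ kap0) // lerN10.
have hle : p%:R / f%:R <= 1 + (kap + N.+1%:R * eps) by apply: hmin; exact: spdegM.
pose a1 := cst (f%:R / p%:R) * ('xA * b).
have hr2 : spdeg (kap + N%:R * eps + ell) (iota disc * b - der a1).
  rewrite -[_ - _]opprB; apply: spdegN; apply: (@spdeg_divn _ _ p) => //.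
  have -> : (der a1 - iota disc * b) *+ p = der ('xA * b) *+ f - iota disc * b *+ p.
    rewrite mulrnBl; congr (_ - _); rewrite der_cst -mulrnAl -[RHS]mulr_natl; congr (_ * _).
    rewrite /cst -rmorphMn -polyCMn -[_ / _ *+ p]mulr_natr divfK ?pnatr_eq0 -?lt0n //.
    by rewrite polyC_natr rmorph_nat.
  have := der_leading (introT andP (conj f0 fm)) hpf.
  have -> : 'xA * der ('xA * b) *+ f - iota disc * ('xA * b) *+ p =
      'xA * (der ('xA * b) *+ f - iota disc * b *+ p).
    by rewrite mulrBr !mulrnAr; congr (_ - _ *+ _); ring.
  move/(spdeg_cancel X0); apply: spdegW; rewrite sizeX1.
  by move: hle; rewrite -natr1 mulrDl mul1r; lra.
have [b2 [r0 [Er hr0]]] := divr_disc (iota disc * b - der a1).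
have hb2 : spdeg (kap + N%:R * eps) b2.
  have Eb : iota disc * b2 = (iota disc * b - der a1) - r0 by rewrite Er addrK.
  have : spdeg (kap + N%:R * eps + ell) (iota disc * b2).
    rewrite Eb; apply: spdegB => //; apply: spdegW (adeg_spdeg hr0).
    have : 0 <= N%:R * eps by rewrite mulr_ge0 // ltW.
    lra.
  by move/(spdeg_cancel disc0); apply: spdegW; rewrite -/ell; lra.
have [a2 h2] := IH b2 hb2; exists (a1 + a2).
rewrite (derD coK coE) opprD addrA Er -addrA [r0 - _]addrC addrA.
apply: adegD => //; apply: adegW hr0; apply: le_trans ell_le _.
by rewrite /kder_coker lerDl !addr_ge0 // kadj0.
Qed.

(** Here A is presented as a quotient pi of a polynomial ring. A form on the
    curve with ring A is a family (v k) of coefficients of the dX_k; dvec g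
    is the form dg. Forms with coefficients in A are not yet divided by the
    differentials of the kernel J of pi: for g in J the form u dg is d(u g),
    since g du vanishes in A, hence it is exact, and the cokernel of dvec is
    the first cohomology. *)
Section Forms.
Variables (n : nat) (pi : {rmorphism {mpoly K[n]} -> A}).
Variables (xx : {mpoly K[n]}) (el : 'I_m -> {mpoly K[n]}).
Hypothesis pi_C : forall c, pi c%:MP = cst c.
Hypothesis pi_xx : pi xx = 'xA.
Hypothesis pi_el : forall i, pi (el i) = e i.
Hypothesis pi_X : forall j, adeg (pi 'X_j) kap.
Hypothesis pi_dxx : forall k, adeg (pi (mderiv k xx)) kap.
Hypothesis pi_del : forall i k, adeg (pi (mderiv k (el i))) kap.
Variable N0 : nat.
Hypothesis xx_size : (msize xx <= N0)%N.
Hypothesis el_size : forall i, (msize (el i) <= N0)%N.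

Local Notation lft := (lift xx).

Lemma pi_lift P : pi (lft P) = iota P.
Proof.
elim/poly_ind: P => [|P c IH]; first by rewrite !rmorph0.
by rewrite !rmorphD !rmorphM /= liftX liftC pi_C pi_xx IH.
Qed.

(** The standard lift of an element of A to a polynomial, through its
    coordinates. *)
Definition rep a : {mpoly K[n]} := \sum_i lft (co a i) * el i.

Lemma repK a : pi (rep a) = a.
Proof.
rewrite [RHS]coK rmorph_sum; apply: eq_bigr => i _.
by rewrite rmorphM pi_lift pi_el.
Qed.

Definition nbound (r : rat) : nat := (Num.Def.archi_bound `|r|).+1.

Lemma dg_nbound (P : {poly K}) r : dg P r -> (size P <= nbound r)%N.
Proof.
move=> h; have [->|P0] := eqVneq P 0; first by rewrite size_poly0.
have := le_lt_trans (le_trans (dg_sizeP h P0) (ler_norm r)) (archi_boundP (normr_ge0 r)).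
by rewrite ltr_nat /nbound; case: (size P) => //= s; apply: ltnW.
Qed.

Definition msz_rep (r : rat) : nat := nbound r * N0 + 1 + N0.

Lemma msize_rep a r : adeg a r -> (msize (rep a) <= msz_rep r)%N.
Proof.
move=> h; apply: msize_sum_leq => i _; apply: msizeM_leq => //.
by apply: msize_lift => //; exact: dg_nbound.
Qed.

Definition dvec (g : {mpoly K[n]}) (k : 'I_n) : A := pi (mderiv k g).

Lemma dvecD g h k : dvec (g + h) k = dvec g k + dvec h k.
Proof. by rewrite /dvec mderivD rmorphD. Qed.

Lemma dvecB g h k : dvec (g - h) k = dvec g k - dvec h k.
Proof. by rewrite /dvec mderivB rmorphB. Qed.

Lemma dvec_sum (I : Type) (s : seq I) (P : pred I) (F : I -> {mpoly K[n]}) k :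
  dvec (\sum_(i <- s | P i) F i) k = \sum_(i <- s | P i) dvec (F i) k.
Proof. by rewrite /dvec linear_sum rmorph_sum. Qed.

Lemma dvecM g h k : dvec (g * h) k = pi g * dvec h k + pi h * dvec g k.
Proof. by rewrite /dvec mderivM rmorphD !rmorphM; ring. Qed.

(** Multiples of dg, for g in the kernel of pi, are exact. *)
Lemma dvec_ker u g k : pi g = 0 -> dvec (u * g) k = pi u * dvec g k.
Proof. by move=> g0; rewrite dvecM g0 mul0r addr0. Qed.

Definition DX (j : 'I_n) : A := der (pi 'X_j).

(** Pairing of a form with the derivation der. *)
Definition contract (v : 'I_n -> A) : A := \sum_j v j * DX j.

Lemma dvec_X i k : dvec 'X_i k = (i == k)%:R.
Proof.
rewrite /dvec mderivX mnm1E; case: eqP => [->|_]; last by rewrite scale0r rmorph0.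
by rewrite scale1r (_ : (U_(k) - U_(k))%MM = 0%MM) ?mpolyX0 ?rmorph1 //;
  apply/mnmP => j; rewrite mnmBE subnn mnm0E.
Qed.

Lemma contract_dvec g : contract (dvec g) = der (pi g).
Proof.
move: g; apply: mpoly_ring_ind => [c|g h IHg IHh|c g IH|i g IH].
- rewrite /contract big1 => [|j _]; last by rewrite /dvec mderivC rmorph0 mul0r.
  by rewrite pi_C /cst (der_iota coK coE disc0) derivC mul0r rmorph0.
- rewrite rmorphD (derD coK coE) -IHg -IHh -big_split; apply: eq_bigr => j _ /=.
  by rewrite dvecD mulrDl.
- rewrite -mul_mpolyC rmorphM pi_C der_cst -IH mulr_sumr; apply: eq_bigr => j _.
  by rewrite dvecM /dvec mderivC rmorph0 mulr0 addr0 pi_C mulrA.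
- rewrite rmorphM (derM coK coE disc0) -IH mulr_sumr.
  rewrite (_ : der (pi 'X_i) = \sum_j dvec 'X_i j * DX j); last first.
    rewrite (bigD1 i) //= big1 => [|j ji]; first by rewrite dvec_X eqxx mul1r addr0.
    by rewrite dvec_X eq_sym (negbTE ji) mul0r.
  rewrite mulr_sumr -big_split; apply: eq_bigr => j _ /=.
  by rewrite dvecM mulrDl !mulrA.
Qed.

(** Together with the rel j i, which express X_j e_i in the basis, the
    generators of the kernel of pi. *)
Definition rel1 : {mpoly K[n]} := 1 - rep 1.
Definition rel (j : 'I_n) (i : 'I_m) : {mpoly K[n]} :=
  'X_j * el i - \sum_l lft (Mx (pi 'X_j) l i) * el l.

Lemma rel1_ker : pi rel1 = 0.
Proof. by rewrite rmorphB rmorph1 repK subrr. Qed.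

Lemma rel_ker j i : pi (rel j i) = 0.
Proof.
rewrite rmorphB rmorphM pi_el (mulr_e coK) rmorph_sum -sumrB big1 // => l _.
by rewrite rmorphM pi_lift pi_el subrr.
Qed.

Lemma repD a b : rep (a + b) = rep a + rep b.
Proof.
rewrite -big_split; apply: eq_bigr => i _ /=.
by rewrite (coD coK coE) rmorphD mulrDl.
Qed.

Lemma repZ P a : rep (iota P * a) = lft P * rep a.
Proof.
rewrite mulr_sumr; apply: eq_bigr => i _ /=.
by rewrite (coZ coK coE) rmorphM mulrA.
Qed.

(** Rewriting a polynomial monomial by monomial into its standard lift uses
    only the relations rel and rel1. *)
Lemma rel_gen g : exists (U : 'I_n -> 'I_m -> {mpoly K[n]}) (U1 : {mpoly K[n]}),
  g - rep (pi g) = \sum_j \sum_i U j i * rel j i + U1 * rel1.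
Proof.
move: g; apply: mpoly_ring_ind => [c|g h [U [U1 E]] [V [V1 F]]|c g [U [U1 E]]|j g [U [U1 E]]].
- exists (fun _ _ => 0), c%:MP; rewrite big1 ?add0r => [|j _]; last first.
    by rewrite big1 // => i _; rewrite mul0r.
  by rewrite /rel1 mulrBr mulr1 pi_C -[cst c]mulr1 repZ liftC.
- exists (fun j i => U j i + V j i), (U1 + V1).
  rewrite rmorphD repD opprD addrACA E F mulrDl addrACA; congr (_ + _).
  rewrite -big_split; apply: eq_bigr => j _ /=; rewrite -big_split.
  by apply: eq_bigr => i _ /=; rewrite mulrDl.
- exists (fun j i => c%:MP * U j i), (c%:MP * U1).
  rewrite -mul_mpolyC rmorphM pi_C repZ liftC -mulrBr E mulrDr mulr_sumr mulrA.
  congr (_ + _); apply: eq_bigr => j _; rewrite mulr_sumr; apply: eq_bigr => i _.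
  by rewrite mulrA.
- exists (fun j' i => 'X_j * U j' i + (if j' == j then lft (co (pi g) i) else 0)), ('X_j * U1).
  have -> : 'X_j * g - rep (pi ('X_j * g)) =
      'X_j * (g - rep (pi g)) + ('X_j * rep (pi g) - rep (pi ('X_j * g))) by ring.
  rewrite E mulrDr mulr_sumr mulrA addrAC; congr (_ + _).
  have -> : 'X_j * rep (pi g) - rep (pi ('X_j * g)) = \sum_i lft (co (pi g) i) * rel j i.
    rewrite /rep mulr_sumr.
    under [X in _ - X]eq_bigr => l _.
      rewrite rmorphM (co_mul coK coE) rmorph_sum mulr_suml.
      under eq_bigr do rewrite rmorphM.
      over.
    rewrite exchange_big /= -sumrB; apply: eq_bigr => i _.
    rewrite /rel mulrBr mulr_sumr mulrCA; congr (_ - _); apply: eq_bigr => l _; ring.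
  rewrite [\sum_i lft _ * _](_ : _ = \sum_j' \sum_i (if j' == j then lft (co (pi g) i) else 0) * rel j' i).
    rewrite -big_split; apply: eq_bigr => j' _ /=; rewrite mulr_sumr -big_split.
    by apply: eq_bigr => i _ /=; rewrite mulrDl mulrA.
  rewrite [RHS](bigD1 j) //= eqxx [X in _ = _ + X]big1 ?addr0 // => j' /negbTE ->.
  by rewrite big1 // => i _; rewrite mul0r.
Qed.

(** Multiply d(rel j i) by e_i^* and sum over i: the terms in e_i^* de_i
    cancel by duality, and disc dX_j - der(X_j) dx remains. *)
Lemma disc_form v k : iota disc * v k =
  contract v * dvec xx k + \sum_j \sum_i (v j * esh i) * dvec (rel j i) k.
Proof.
have Hj j : \sum_i esh i * dvec (rel j i) k = iota disc *+ (j == k) - DX j * dvec xx k.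
  have E i : dvec (rel j i) k = e i *+ (j == k) + pi 'X_j * dvec (el i) k -
      \sum_l (iota (Mx (pi 'X_j) l i) * dvec (el l) k + iota (Mx (pi 'X_j) l i)^`() * e l * dvec xx k).
    rewrite dvecB dvecM dvec_X pi_el dvec_sum mulr_natr addrC [in X in X - _]addrC.
    rewrite [X in _ = X - _]addrC addrC; congr (_ - _); first by rewrite addrC.
    apply: eq_bigr => l _; rewrite dvecM pi_lift pi_el; congr (_ + _).
    by rewrite {1}/dvec mderiv_lift rmorphM pi_lift -/(dvec xx k); ring.
  under eq_bigr do rewrite E mulrBr mulrDr.
  rewrite sumrB big_split /=.
  have -> : \sum_i esh i * (e i *+ (j == k)) = iota disc *+ (j == k).
    under eq_bigr do rewrite mulrnAr mulrC.
    by rewrite sumrMnl (sum_e_esh coK coE disc0).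
  rewrite -addrA; congr (_ + _).
  have -> : \sum_i esh i * \sum_l (iota (Mx (pi 'X_j) l i) * dvec (el l) k +
      iota (Mx (pi 'X_j) l i)^`() * e l * dvec xx k) =
    \sum_l pi 'X_j * esh l * dvec (el l) k + DX j * dvec xx k.
    under eq_bigr do rewrite mulr_sumr.
    rewrite exchange_big /= /DX /der mulr_suml -big_split /=; apply: eq_bigr => l _.
    rewrite (mulr_esh coK coE disc0) !mulr_suml -big_split; apply: eq_bigr => i _ /=; ring.
  rewrite opprD addrA -[RHS]add0r; congr (_ + _); apply/eqP; rewrite subr_eq0; apply/eqP.
  by apply: eq_bigr => i _; ring.
have -> : \sum_j \sum_i v j * esh i * dvec (rel j i) k =
    \sum_j (v j * iota disc *+ (j == k) - v j * DX j * dvec xx k).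
  apply: eq_bigr => j _; under eq_bigr do rewrite -mulrA.
  by rewrite -mulr_sumr Hj mulrBr mulrnAr mulrA.
rewrite sumrB /contract mulr_suml addrC subrK (bigD1 k) //= eqxx mulr1n big1 ?addr0 1?mulrC //.
by move=> j /negbTE ->; rewrite mulr0n.
Qed.

Definition kX : rat := kap + kder.
Definition kd : rat := 2%:R * kap *+ m.

Lemma kX0 : (0 <= kX)%R. Proof. by rewrite addr_ge0 // kder0. Qed.
Lemma kd0 : (0 <= kd)%R. Proof. by rewrite mulrn_wge0 // mulr_ge0. Qed.

Lemma adeg_contract v r : (forall j, adeg (v j) r) -> adeg (contract v) (r + kX + kap).
Proof.
by move=> h; apply: adeg_sum => j _; apply: adegM => //; apply: adeg_der.
Qed.

Lemma contractB v w : contract (fun k => v k - w k) = contract v - contract w.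
Proof. by rewrite /contract -sumrB; apply: eq_bigr => j _; rewrite mulrBl. Qed.

Lemma contractZ a v : contract (fun k => a * v k) = a * contract v.
Proof. by rewrite /contract mulr_sumr; apply: eq_bigr => j _; rewrite mulrA. Qed.

Lemma adeg_dvec_lft P i k r : dg P r -> adeg (dvec (lft P * el i) k) (r + 2%:R * kap).
Proof.
move=> h; rewrite dvecM pi_lift pi_el; apply: adegD.
  by apply: adegW (adegZ h (pi_del i k)); have := kap0; lra.
rewrite /dvec mderiv_lift rmorphM pi_lift.
apply: adegW (adegM (adeg_e i) (adegZ (dg_deriv h) (pi_dxx k))); have := kap0; lra.
Qed.

Lemma adeg_dvec_rep a k r : adeg a r -> adeg (dvec (rep a) k) (r + 2%:R * kap).
Proof. by move=> h; rewrite dvec_sum; apply: adeg_sum => i _; exact: adeg_dvec_lft. Qed.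

Lemma dg_MxX j l i : dg (Mx (pi 'X_j) l i) (2%:R * kap).
Proof. by rewrite mxE; apply: adegW (adegM (pi_X j) (adeg_e i)) _; have := kap0; lra. Qed.

Lemma adeg_dvec_rel j i k : adeg (dvec (rel j i) k) (4%:R * kap).
Proof.
rewrite dvecB; apply: adegB.
  rewrite dvecM dvec_X pi_el; apply: adegD.
    by apply: adegW (adegM (pi_X j) (pi_del i k)); have := kap0; lra.
  by rewrite mulr_natr; apply: adegMn; apply: adegW (adeg_e i); have := kap0; lra.
rewrite dvec_sum; apply: adeg_sum => l _.
by apply: adegW (adeg_dvec_lft _ _ (dg_MxX j l i)); have := kap0; lra.
Qed.

Lemma adeg_dvec_rel1 k : adeg (dvec rel1 k) (4%:R * kap).
Proof.
rewrite dvecB; apply: adegB.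
  by rewrite /dvec -mpolyC1 mderivC rmorph0; exact: adeg0.
have h1 : adeg 1 kap by move=> i; exact: co_1.
by apply: adegW (adeg_dvec_rep _ h1); have := kap0; lra.
Qed.

Lemma divr_disc_family (I : Type) (v : I -> A) : exists v1 v0 : I -> A,
  forall j, v j = iota disc * v1 j + v0 j /\ adeg (v0 j) kd.
Proof.
have [F hF] := choice (fun j => divr_disc (v j)).
have [G hG] := choice hF; exists F, G => j; have [E h] := hG j; split => //.
by apply: adegW h; exact: ell_le.
Qed.

Lemma disc_form_exact v : exists g, forall k,
  iota disc * v k = contract v * dvec xx k + dvec g k.
Proof.
exists (\sum_j \sum_i rep (v j * esh i) * rel j i) => k; rewrite disc_form; congr (_ + _).
rewrite dvec_sum; apply: eq_bigr => j _; rewrite dvec_sum; apply: eq_bigr => i _.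
by rewrite dvec_ker ?rel_ker // repK.
Qed.

Lemma kder_coker0 : (0 <= kder_coker)%R.
Proof. by rewrite /kder_coker -/kd; have := kd0; have := kap0; have := kadj0; lra. Qed.

Definition kform : rat := kder_coker + (kd + kX + kap).
Lemma kform0 : (0 <= kform)%R.
Proof. by rewrite /kform; have := kder_coker0; have := kd0; have := kX0; have := kap0; lra. Qed.

(** A bound for the degree of the forms modulo exact ones; a function of m
    and kap alone. *)
Definition kcoh : rat := kd + kd + (kform + kap + kap).

(** Divide v by disc: up to a form of bounded degree, v is disc v1, which is
    contract v1 dx up to an exact form. By [der_coker] the coefficient b of
    dx, multiplied by disc, is der a up to bounded degree. Then b dx - da
    has bounded contraction, and one more division by disc makes it bounded
    up to an exact form. *)
Lemma dvec_coker v : exists g, forall k, adeg (v k - dvec g k) kcoh.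
Proof.
have [v1 [v0 hv]] := divr_disc_family v.
have [g1 hg1] := disc_form_exact v1.
set b := contract v1 in hg1.
have [a ha] := der_coker b.
pose w k := b * dvec xx k - dvec (rep a) k.
have hw : contract w = iota disc * b - der a.
  rewrite contractB contractZ !contract_dvec repK pi_xx (der_iota coK coE disc0).
  by rewrite derivX mul1r mulrC.
have [w1 [w0 hw01]] := divr_disc_family w.
have [g2 hg2] := disc_form_exact w1.
set c := contract w1 in hg2.
have hc : adeg c kform.
  have Ec : iota disc * c = contract w - contract w0.
    rewrite -contractB -contractZ; apply: eq_bigr => k _; congr (_ * _).
    by rewrite (hw01 k).1 addrK.
  have : adeg (iota disc * c) kform.
    rewrite Ec; apply: adegB; rewrite /kform.
      by rewrite hw; apply: adegW ha; have := kd0; have := kX0; have := kap0; lra.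
    apply: adegW (adeg_contract (fun j => (hw01 j).2)).
    by have := kder_coker0; lra.
  by move/(adeg_cancel disc0); apply: adegW; rewrite gerBl ler0n.
exists (g1 + rep a + g2) => k.
have -> : v k - dvec (g1 + rep a + g2) k = v0 k + w0 k + c * dvec xx k.
  have E1 : v0 k = v k - (b * dvec xx k + dvec g1 k) by rewrite -hg1 (hv k).1 addrC addKr.
  have E2 : w0 k = w k - (c * dvec xx k + dvec g2 k) by rewrite -hg2 (hw01 k).1 addrC addKr.
  by rewrite E1 E2 !dvecD /w; ring.
rewrite /kcoh; apply: adegD.
  apply: adegD; [apply: adegW (hv k).2|apply: adegW (hw01 k).2].
    by have := kap0; have := kd0; have := kform0; lra.
  by have := kap0; have := kd0; have := kform0; lra.
by apply: adegW (adegM hc (pi_dxx k)); have := kd0; lra.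
Qed.

Definition kprim (r : rat) : rat := 1 + (r + kX + kap + kap) + (kap + kadj).
Definition krem (r : rat) : rat := r + (kprim r + 2%:R * kap) + (kd + 4%:R * kap + kap).

Definition msz_rel : nat := 2 + N0 + (nbound (2%:R * kap) * N0 + 1 + N0).
Definition msz_rel1 : nat := 1 + msz_rep kap.
Definition msz_prim (r : rat) : nat :=
  msz_rep (kprim r) + (msz_rep kd + msz_rep (krem r + kadj + kap) + msz_rel +
                       (msz_rep kd + msz_rel1)).

Lemma msize_rel j i : (msize (rel j i) <= msz_rel)%N.
Proof.
rewrite /rel /msz_rel; apply: leq_trans (msizeD_le _ _) _; rewrite geq_max; apply/andP; split.
  apply: leq_trans (leq_addr _ _); apply: msizeM_leq => //.
  by rewrite msizeX mdeg1.
rewrite msizeN; apply: leq_trans (leq_addl _ _); apply: msize_sum_leq => l _.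
apply: msizeM_leq => //; apply: msize_lift => //; apply: dg_nbound; exact: dg_MxX.
Qed.

Lemma msize_rel1 : (msize rel1 <= msz_rel1)%N.
Proof.
rewrite /rel1 /msz_rel1; apply: leq_trans (msizeD_le _ _) _; rewrite geq_max.
rewrite msize1 leq_addr msizeN /=; apply: leq_trans (leq_addl _ _).
by apply: msize_rep => i; exact: co_1.
Qed.

(** The function pi g is bounded by [spdeg_der_inv]. It remains to bound a
    form dh with h in the kernel: write h in the generators rel, with
    coefficients divided by disc. The part divisible by disc has contraction
    zero, so [disc_form] rewrites it in the generators with coefficients
    bounded in terms of the form itself. *)
Lemma dvec_primitive r g : 0 <= r -> (forall k, adeg (dvec g k) r) ->
  exists2 g', (msize g' <= msz_prim r)%N & forall k, dvec g' k = dvec g k.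
Proof.
move=> r0 hg; set a := pi g.
have ha : adeg a (kprim r).
  have hx : spdeg 1 'xA by have := spdeg_Xn 1; rewrite expr1.
  have hda : spdeg (1 + (r + kX + kap + kap)) ('xA * der a).
    apply: spdegM => //; apply: adeg_spdeg; rewrite -contract_dvec.
    exact: adeg_contract.
  apply: spdeg_adeg; apply: spdegW (spdeg_der_inv hda).
  by rewrite ge_max gerBl ell0 andbT; have := kX0; have := kap0; lra.
have [U [U1 hU]] := rel_gen g; rewrite -/a in hU.
set h := g - rep a in hU.
have [u1 [u0 hu]] := divr_disc_family (fun ji => pi (U ji.1 ji.2)).
have [s1 [s0 hs]] := divr_disc_family (fun _ : unit => pi U1).
pose w k := \sum_j \sum_i u1 (j, i) * dvec (rel j i) k + s1 tt * dvec rel1 k.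
pose w' k := \sum_j \sum_i u0 (j, i) * dvec (rel j i) k + s0 tt * dvec rel1 k.
have hdw k : dvec h k = iota disc * w k + w' k.
  rewrite hU dvecD dvec_ker ?rel1_ker // (hs tt).1 dvec_sum.
  rewrite /w /w' mulrDr mulr_sumr addrACA -big_split; congr (_ + _); last by ring.
  apply: eq_bigr => j _; rewrite dvec_sum mulr_sumr -big_split; apply: eq_bigr => i _ /=.
  by rewrite dvec_ker ?rel_ker // (hu (j, i)).1; ring.
have hw k : adeg (w k) (krem r).
  have : adeg (iota disc * w k) (krem r).
    have -> : iota disc * w k = dvec g k - dvec (rep a) k - w' k by rewrite -dvecB hdw addrK.
    have kp0 : 0 <= kprim r by rewrite /kprim; have := kX0; have := kap0; have := kadj0; lra.
    have k4 : 0 <= kd + 4%:R * kap + kap by have := kd0; have := kap0; lra.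
    have k2 : 0 <= 2%:R * kap by rewrite mulr_ge0.
    apply: adegB.
      apply: adegB; first by apply: adegW (hg k); rewrite /krem; lra.
      by apply: adegW (adeg_dvec_rep k ha); rewrite /krem; lra.
    have hk : kd + 4%:R * kap + kap <= krem r by rewrite /krem; lra.
    apply: adegD.
      apply: adeg_sum => j _; apply: adeg_sum => i _.
      by apply: adegW hk (adegM (hu (j, i)).2 (adeg_dvec_rel j i k)).
    by apply: adegW hk (adegM (hs tt).2 (adeg_dvec_rel1 k)).
  by move/(adeg_cancel disc0); apply: adegW; rewrite gerBl ler0n.
have cw : contract w = 0.
  have cr j i : contract (dvec (rel j i)) = 0 by rewrite contract_dvec rel_ker der0.
  have cr1 : contract (dvec rel1) = 0 by rewrite contract_dvec rel1_ker der0.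
  have -> : contract w = \sum_j \sum_i u1 (j, i) * contract (dvec (rel j i)) + s1 tt * contract (dvec rel1).
    rewrite -contractZ /contract -[RHS]/(_ + _).
    under [X in X + _]eq_bigr => j _ do under eq_bigr => i _ do rewrite mulr_sumr.
    under [X in X + _]eq_bigr => j _ do rewrite exchange_big /=.
    rewrite exchange_big -big_split; apply: eq_bigr => k _ /=.
    rewrite mulrDl; congr (_ + _); rewrite mulr_suml; apply: eq_bigr => j _.
    by rewrite mulr_suml; apply: eq_bigr => i _; rewrite mulrA.
  rewrite cr1 mulr0 addr0 big1 // => j _; rewrite big1 // => i _.
  by rewrite cr mulr0.
(* a primitive of dh in which only the bounded remainders u0, s0 and the
   bounded form w occur *)
pose h' := \sum_j \sum_i (rep (u0 (j, i)) + rep (w j * esh i)) * rel j i + rep (s0 tt) * rel1.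
have hh' k : dvec h' k = dvec h k.
  rewrite hdw disc_form cw mul0r add0r /w' /h' dvecD dvec_ker ?rel1_ker // repK.
  rewrite addrA addrC -[RHS]addrC; congr (_ + _).
  rewrite dvec_sum -big_split; apply: eq_bigr => j _; rewrite dvec_sum -big_split.
  by apply: eq_bigr => i _ /=; rewrite dvec_ker ?rel_ker // rmorphD !repK mulrDl addrC.
exists (rep a + h') => [|k]; last by rewrite dvecD hh' /h dvecB addrC subrK.
rewrite /msz_prim; apply: leq_trans (msizeD_le _ _) _; rewrite geq_max; apply/andP; split.
  by apply: leq_trans (leq_addr _ _); exact: msize_rep.
apply: leq_trans (leq_addl _ _); apply: leq_trans (msizeD_le _ _) _; rewrite geq_max; apply/andP; split.
  apply: leq_trans (leq_addr _ _); apply: msize_sum_leq => j _; apply: msize_sum_leq => i _.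
  apply: msizeM_leq; last exact: msize_rel.
  apply: leq_trans (msizeD_le _ _) _; rewrite geq_max; apply/andP; split.
    by apply: leq_trans (leq_addr _ _); apply: msize_rep; exact: (hu (j, i)).2.
  apply: leq_trans (leq_addl _ _); apply: msize_rep; apply: adegM; first exact: hw.
  exact: adeg_esh.
apply: leq_trans (leq_addl _ _); apply: msizeM_leq; last exact: msize_rel1.
by apply: msize_rep; exact: (hs tt).2.
Qed.

End Forms.

End SpectralDegree.

(** * The first cohomology as a cokernel of matrices *)

Section CokernelDimension.
Context {K : fieldType}.

(** The rank of the space of all u P1 with u P2 = 0. *)
Lemma rank_solutions W N N' (P1 : 'M[K]_(W, N)) (P2 : 'M_(W, N')) :
  (\rank (kermx P2 *m P1) = \rank (row_mx P1 P2) - \rank P2)%N.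
Proof.
have := mxrank_mul_ker (kermx P2) P1.
have E : (kermx P2 :&: kermx P1 :=: kermx (row_mx P1 P2))%MS.
  apply/eqmxP/andP; split.
    apply/sub_kermxP; rewrite mul_mx_row.
    have /sub_kermxP -> := capmxSr (kermx P2) (kermx P1).
    have /sub_kermxP -> := capmxSl (kermx P2) (kermx P1).
    by rewrite row_mx0.
  have := mulmx_ker (row_mx P1 P2); rewrite mul_mx_row -[X in _ = X -> _]row_mx0.
  by move/eq_row_mx => [h1 h2]; rewrite sub_capmx; apply/andP; split; apply/sub_kermxP.
rewrite E !mxrank_ker; have := rank_leq_row (row_mx P1 P2); have := rank_leq_row P2.
have : (\rank P2 <= \rank (row_mx P1 P2))%N.
  have -> : P2 = row_mx P1 P2 *m col_mx 0 1%:M.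
    by rewrite mul_row_col mulmx0 mulmx1 add0r.
  by apply: leq_trans (mxrankM_maxl _ _) _; rewrite mul_row_col mulmx0 mulmx1 add0r.
lia.
Qed.

Lemma has_dim_coker (H : lmodType K) W N N' (F : 'rV[K]_N -> H)
    (P1 : 'M[K]_(W, N)) (P2 : 'M_(W, N')) :
  linear F -> (forall h, exists c, F c = h) ->
  (forall c, F c = 0 <-> exists2 u : 'rV_W, u *m P1 = c & u *m P2 = 0) ->
  has_dim H (N - (\rank (row_mx P1 P2) - \rank P2)).
Proof.
move=> linF Fsurj Fker; rewrite -rank_solutions.
set Q := kermx P2 *m P1.
have FkerQ c : F c = 0 <-> (c <= Q)%MS.
  rewrite Fker; split=> [[u <- /sub_kermxP u2]|/submxP[u ->]].
    by rewrite /Q; exact: submxMr.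
  by exists (u *m kermx P2); rewrite -mulmxA // mulmx_ker mulmx0.
have FB a b : F (a - b) = F a - F b.
  by have := linF (-1) b a; rewrite !scaleN1r [- b + a]addrC [- F b + _]addrC.
rewrite -mxrank_coker.
pose B := col_base (cokermx Q).
have Bfull : row_full B by exact: col_base_full.
have kerB (c : 'rV_N) : c *m B = 0 <-> (c <= Q)%MS.
  rewrite submxE; split=> [h|/eqP h].
    by rewrite -(mulmx_base (cokermx Q)) mulmxA -/B h mul0mx.
  apply: (row_free_inj (row_base_free (cokermx Q))).
  by rewrite /= -mulmxA mulmx_base h mul0mx.
have [s hs] := choice Fsurj.
have sB c c' : F c = F c' -> c *m B = c' *m B.
  move=> E; apply/eqP; rewrite -subr_eq0 -mulmxBl; apply/eqP/kerB/FkerQ.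
  by rewrite FB E subrr.
exists (fun h => s h *m B) => [a x y|].
  rewrite scalemxAl -mulmxDl; apply: sB.
  by rewrite hs linF !hs.
exists (fun v => F (v *m pinvmx B)) => [h|v].
  apply/eqP; rewrite -[X in _ == X]hs -subr_eq0 -FB; apply/eqP/FkerQ/kerB.
  by rewrite mulmxBl -[_ *m pinvmx B *m B]mulmxA mulVpmx // mulmx1 subrr.
by rewrite (sB _ _ (hs _)) -mulmxA mulVpmx // mulmx1.
Qed.

End CokernelDimension.

Section GenericRank.
Context {K : fieldType}.

(** Take a value y0 of maximal rank r. A minor of size r of M, in suitable
    bases, is a polynomial in y which does not vanish at y0. *)
Lemma rank_generic a b (M : 'M[{poly K}]_(a, b)) :
  exists r, exists2 d : {poly K}, d != 0 &
  forall y, d.[y] != 0 -> \rank (map_mx (horner_eval y) M) = r.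
Proof.
pose rk y := \rank (map_mx (horner_eval y) M).
pose Q n := `[< exists y, rk y = n >].
have exQ : exists n, Q n by exists (rk 0); apply/asboolP; exists 0.
have ubQ n : Q n -> (n <= a)%N by move=> /asboolP[y <-]; exact: rank_leq_row.
have [r /asboolP[y0 ry0] rmax] := ex_maxnP exQ ubQ.
pose A := map_mx (horner_eval y0) M.
have [L [R LR]] : exists (L : 'M_(r, a)) (R : 'M_(b, r)), L *m A *m R = 1%:M.
  rewrite -ry0 -/A; exists (pinvmx (col_base A)), (pinvmx (row_base A)).
  rewrite -[X in _ *m X *m _](mulmx_base A).
  rewrite [pinvmx (col_base A) *m _]mulmxA mulVpmx ?col_base_full // mul1mx.
  by rewrite mulmxVp // row_base_free.
pose lf p q (B : 'M[K]_(p, q)) := map_mx polyC B.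
pose d := \det (lf _ _ L *m M *m lf _ _ R).
have dE y : d.[y] = \det (L *m map_mx (horner_eval y) M *m R).
  rewrite -[d.[y]]/(horner_eval y d) -det_map_mx !map_mxM /=.
  by congr (\det (_ *m _ *m _)); apply/matrixP => i j; rewrite !mxE /horner_eval hornerC.
have d0 : d != 0.
  apply: contraTneq (oner_neq0 K) => d0.
  by rewrite -(det1 K r) -LR -dE d0 horner0 eqxx.
exists r; exists d => // y dy; apply/eqP; rewrite eqn_leq; apply/andP; split.
  by apply: rmax; apply/asboolP; exists y.
have : \rank (L *m map_mx (horner_eval y) M *m R) = r.
  by apply: mxrank_unit; rewrite unitmxE unitfE -dE.
by move=> <-; apply: leq_trans (mxrankM_maxl _ _) (mxrankM_maxr _ _).
Qed.

End GenericRank.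

Section FibreCohomology.
Context {K : fieldType} {n : nat}.

(** The Kaehler relations are themselves exact modulo the ideal: a dg with g
    in the ideal equals d(a g) - g da. *)
Lemma H1_eq0 (Z : set ('I_n -> K)) (w : @Defs.form K n) :
  lpi (range (@ext_d K n Z)) (lpi (kaehler_rel Z) w) = 0 <->
  exists g, forall k, vanishing_ideal Z (w k - mderiv k g).
Proof.
have vD g h : vanishing_ideal Z g -> vanishing_ideal Z h -> vanishing_ideal Z (g + h).
  by move=> hg hh x Zx; rewrite mevalD hg // hh // addr0.
have vM g h : vanishing_ideal Z g -> vanishing_ideal Z (h * g).
  by move=> hg x Zx; rewrite mevalM hg // mulr0.
have vZ c g : vanishing_ideal Z g -> vanishing_ideal Z (c *: g).
  by move=> hg x Zx; rewrite mevalZ hg // mulr0.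
have v0 : vanishing_ideal Z 0 by move=> x _; rewrite meval0.
pose E (u : @Defs.form K n) := exists g, forall k, vanishing_ideal Z (u k - mderiv k g).
have E0 : E 0.
  by exists 0 => k; rewrite mderiv0 subr0 ffunE; exact: v0.
have Elin c u v : E u -> E v -> E (c *: u + v).
  move=> [g hg] [h hh]; exists (c *: g + h) => k; rewrite mderivD mderivZ !ffunE.
  have -> : c *: u k + v k - (c *: g^`M(k) + h^`M(k)) = c *: (u k - g^`M(k)) + (v k - h^`M(k)).
    by rewrite scalerBr opprD addrACA.
  by apply: vD; [apply: vZ|].
have relE u : kaehler_rel Z u -> E u.
  case=> [g w' hg|a g hg].
    by exists 0 => k; rewrite mderiv0 subr0 !ffunE mulrC; exact: vM.
  exists (a * g) => k; rewrite !ffunE mderivM opprD addrCA subrr addr0.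
  by rewrite -mulNr; exact: vM.
have lspanE u : lspan (kaehler_rel Z) u -> E u.
  by elim=> // c u' v' /relE hu _; exact: Elin.
have pi0 (V : lmodType K) (S : set V) v : lpi S v = 0 <-> lspan S v.
  rewrite -[0](raddf0 (lpi S)) -[X in lspan _ X]subr0; exact: lpi_eq.
rewrite pi0; split.
  suff H x : lspan (range (@ext_d K n Z)) x -> forall u, x = lpi (kaehler_rel Z) u -> E u.
    by move=> h; exact: H h _ erefl.
  elim=> [u /esym/pi0/lspanE //|c x' y [z _ <-] _ IH u].
  have [g ->] := lpi_surj z; have [v Ev] := lpi_surj y.
  rewrite ext_dE Ev -linearP => /esym/lpi_eq/lspanE Eu.
  have -> : u = 1 *: (u - (c *: form_d g + v)) + (c *: form_d g + v).
    by rewrite scale1r subrK.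
  apply: (Elin) => //; apply: (Elin); last exact: IH.
  by exists g => k; rewrite ffunE subrr; exact: v0.
move=> [g hg].
have -> : lpi (kaehler_rel Z) w = ext_d (lpi (vanishing_ideal Z) g : Omega0 Z).
  rewrite ext_dE; apply/lpi_eq.
  have -> : w - form_d g = \sum_k form_scale (w k - mderiv k g) [ffun j => (j == k)%:R].
    apply/ffunP => j; rewrite sum_ffunE (bigD1 j) //= big1 => [|k kj].
      by rewrite !ffunE eqxx mulr1 addr0.
    by rewrite !ffunE eq_sym (negbTE kj) mulr0.
  apply: (big_ind (lspan (kaehler_rel Z))); first exact: lspan0.
    by move=> u v hu hv; rewrite -[u]scale1r; exact: lspan_lin.
  by move=> k _; apply: sub_lspan; exact: kaehler_rel_ideal.
by apply: sub_lspan; exists (lpi _ g).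
Qed.

(** A presentation of H1: the b_i generate it, and the linear relations
    between them are the u P1 with u P2 = 0. The columns of P2 are there to
    express that a derivative has no coordinates beyond those of P1. *)
Lemma H1_dim (Z : set ('I_n -> K)) N W N' (b : 'I_N -> @Defs.form K n)
    (P1 : 'M[K]_(W, N)) (P2 : 'M_(W, N')) :
  (forall w : @Defs.form K n, exists (c : 'rV_N) g,
     forall k, vanishing_ideal Z ((w - \sum_i c 0 i *: b i) k - mderiv k g)) ->
  (forall c : 'rV_N,
     (exists g, forall k, vanishing_ideal Z ((\sum_i c 0 i *: b i) k - mderiv k g)) <->
     exists2 u : 'rV_W, u *m P1 = c & u *m P2 = 0) ->
  has_dim (H1 Z) (N - (\rank (row_mx P1 P2) - \rank P2)).
Proof.
move=> hsurj hker.
pose F (c : 'rV_N) : H1 Z :=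
  lpi (range (@ext_d K n Z)) (lpi (kaehler_rel Z) (\sum_i c 0 i *: b i)).
apply: (@has_dim_coker _ _ _ _ _ F).
- move=> a u v; rewrite /F -!linearP; congr (lpi _ (lpi _ _)).
  rewrite scaler_sumr -big_split; apply: eq_bigr => i _ /=.
  by rewrite !mxE scalerDl scalerA.
- move=> h; have [x ->] := lpi_surj h; have [w ->] := lpi_surj x.
  have [c [g hg]] := hsurj w; exists c; apply/esym/eqP; rewrite -subr_eq0 -!raddfB.
  by apply/eqP/H1_eq0; exists g.
- by move=> c; rewrite -hker; exact: H1_eq0.
Qed.

End FibreCohomology.

(** * Uncountable fields and the Nullstellensatz *)

Local Open Scope classical_set_scope.

(** The pigeonhole form of uncountability. *)
Definition uncountable (T : Type) : Prop :=
  forall (I : countType) (F : T -> I), exists v, infinite_set [set c | F c = v].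

Section RealUncountable.
Context {R : realType}.

Lemma avoid_finite (s : seq R) (a b : R) : a < b ->
  exists a' b', [/\ a <= a', a' < b', b' <= b & forall x, x \in s -> ~~ (a' <= x <= b')].
Proof.
elim: s a b => [|x s IH] a b ab; first by exists a, b.
have [a1 [b1 [h1 h2 h3 h4]]] := IH a b ab.
have [xl|xr] := leP x (a1 + (b1 - a1) / 2%:R).
  exists (a1 + (b1 - a1) * 3%:R / 4%:R), b1; split => //; [lra|lra|].
  move=> y; rewrite inE => /orP[/eqP ->|ys]; apply/negP => /andP[y1 y2]; first by lra.
  by move/negP: (h4 y ys); apply; apply/andP; split => //; lra.
exists a1, (a1 + (b1 - a1) / 4%:R); split => //; [lra|lra|].
move=> y; rewrite inE => /orP[/eqP ->|ys]; apply/negP => /andP[y1 y2]; first by lra.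
by move/negP: (h4 y ys); apply; apply/andP; split => //; lra.
Qed.

(** Nested intervals. If all fibres of F were finite, the n-th interval
    could be chosen to avoid the finitely many points whose image has code
    at most n; a point common to all intervals would have no code. *)
Lemma real_uncountable : uncountable R.
Proof.
move=> I F; apply: contrapT => h.
have fin n : exists s : seq R, forall x, (pickle (F x) <= n)%N -> x \in s.
  elim: n => [|n [s hs]].
    have [v|] := pselect (exists x, pickle (F x) = 0%N).
      case: v => x0 Fx0; have : finite_set [set c | F c = F x0].
        by apply: contrapT => hi; apply: h; exists (F x0).
      move=> /finite_seqP[s Es]; exists s => x; rewrite leqn0 => /eqP Fx.
      have : [set c | F c = F x0] x by apply: (pcan_inj pickleK); rewrite Fx Fx0.
      by rewrite Es.
    by move=> nx; exists [::] => x; rewrite leqn0 => /eqP Fx; case: nx; exists x.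
  have [[x0 Fx0]|nx] := pselect (exists x, pickle (F x) = n.+1).
    have : finite_set [set c | F c = F x0].
      by apply: contrapT => hi; apply: h; exists (F x0).
    move=> /finite_seqP[s' Es]; exists (s' ++ s) => x; rewrite leq_eqVlt ltnS mem_cat.
    case/orP => [/eqP Fx|/hs ->]; last by rewrite orbT.
    have : [set c | F c = F x0] x by apply: (pcan_inj pickleK); rewrite Fx Fx0.
    by rewrite Es /= => ->.
  exists s => x; rewrite leq_eqVlt ltnS => /orP[/eqP Fx|/hs //].
  by case: nx; exists x.
have step (p : R * R * nat) : exists q : R * R, p.1.1 < p.1.2 ->
    [/\ p.1.1 <= q.1, q.1 < q.2, q.2 <= p.1.2 &
      forall x, (pickle (F x) <= p.2)%N -> ~~ (q.1 <= x <= q.2)].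
  have [ab|nab] := boolP (p.1.1 < p.1.2); last by exists (0, 0).
  have [s hs] := fin p.2; have [a' [b' [h1 h2 h3 h4]]] := avoid_finite s ab.
  by exists (a', b') => _; split=> // x /hs; exact: h4.
have [G hG] := choice step.
pose fix u n : R * R := if n is k.+1 then G (u k, k) else (0, 1).
have ult n : (u n).1 < (u n).2.
  by elim: n => [|n IH] /=; [exact: ltr01|case: (hG (u n, n) IH)].
have uS n : [/\ (u n).1 <= (u n.+1).1, (u n.+1).2 <= (u n).2 &
    forall x, (pickle (F x) <= n)%N -> ~~ ((u n.+1).1 <= x <= (u n.+1).2)].
  by case: (hG (u n, n) (ult n)).
have mono m n : (m <= n)%N -> (u m).1 <= (u n).1 /\ (u n).2 <= (u m).2.
  move=> /subnKC <-; elim: (n - m)%N => [|k [h1 h2]]; first by rewrite addn0.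
  have [h3 h4 _] := uS (m + k)%N; rewrite addnS; split.
    exact: le_trans h1 h3.
  exact: le_trans h4 h2.
have ub m n : (u m).1 <= (u n).2.
  have [h1 _] := mono m (maxn m n) (leq_maxl _ _).
  have [_ h2] := mono n (maxn m n) (leq_maxr _ _).
  exact: le_trans h1 (le_trans (ltW (ult _)) h2).
pose S := [set x | exists n, x = (u n).1].
have Ssup : has_sup S.
  split; first by exists (u 0%N).1, 0%N.
  by exists (u 0%N).2 => x [n ->].
pose c := sup S.
have cl n : (u n).1 <= c by apply: ub_le_sup; [case: Ssup|exists n].
have cr n : c <= (u n).2 by apply: ge_sup; [case: Ssup|move=> x [k ->]].
have [_ _ /(_ c)] := uS (pickle (F c)).
by rewrite leqnn cl cr => /(_ isT).
Qed.

Lemma complex_uncountable : uncountable R[i].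
Proof.
move=> I F; have [v hv] := real_uncountable (fun x : R => F x%:C%C).
exists v => /finite_seqP[s Es]; apply: hv.
apply/finite_setP; apply/finite_setP.
apply: (@sub_finite_set _ _ [set` [seq complex.Re z | z <- s]]); last exact: finite_seq.
move=> x /= Fx; apply/mapP; exists x%:C%C => //.
by have : [set c | F c = v] x%:C%C by []; rewrite Es.
Qed.

End RealUncountable.

Lemma infinite_uniq_seq (T : choiceType) (A : set T) n : infinite_set A ->
  exists s : seq T, [/\ uniq s, size s = n & forall x, x \in s -> A x].
Proof.
move=> /(@infinite_set_fset _ _ n) [B BA nB]; exists (take n (finmap.enum_fset B)); split.
- by rewrite take_uniq // finmap.fset_uniq.
- by rewrite size_takel.
- by move=> x /mem_take xB; exact: BA.
Qed.

Section Nullstellensatz.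
Context {K : closedFieldType} {n : nat}.
Hypothesis uncK : uncountable K.
Implicit Types J : set {mpoly K[n]}.

Record is_ideal J : Prop := IsIdeal {
  ideal0 : J 0;
  idealD : forall a b, J a -> J b -> J (a + b);
  idealM : forall a b, J b -> J (a * b) }.

Lemma idealN J a : is_ideal J -> J a -> J (- a).
Proof. by move=> idJ Ja; rewrite -mulN1r; exact: idealM. Qed.

Lemma idealB J a b : is_ideal J -> J a -> J b -> J (a - b).
Proof. by move=> idJ Ja Jb; apply: idealD => //; exact: idealN. Qed.

Lemma idealZ J c a : is_ideal J -> J a -> J (c *: a).
Proof. by move=> idJ Ja; rewrite -mul_mpolyC; exact: idealM. Qed.

Lemma ideal_sum J (I : eqType) (s : seq I) (F : I -> {mpoly K[n]}) : is_ideal J ->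
  (forall i, i \in s -> J (F i)) -> J (\sum_(i <- s) F i).
Proof.
move=> idJ h; rewrite big_seq; apply: (big_ind J) => //; first exact: ideal0.
by move=> a b; exact: idealD.
Qed.

Definition adjoin J g : set {mpoly K[n]} := [set x | exists a, J (x - a * g)].

Lemma adjoin_ideal J g : is_ideal J -> is_ideal (adjoin J g).
Proof.
move=> idJ; split.
- by exists 0; rewrite mul0r subrr; exact: ideal0.
- move=> a b [a' ha] [b' hb]; exists (a' + b').
  by rewrite mulrDl opprD addrACA; exact: idealD.
- move=> a b [b' hb]; exists (a * b').
  by rewrite -mulrA -mulrBr; exact: idealM.
Qed.

Lemma sub_adjoin J g : is_ideal J -> J `<=` adjoin J g.
Proof. by move=> idJ x Jx; exists 0; rewrite mul0r subr0. Qed.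

Lemma adjoin_gen J g : is_ideal J -> adjoin J g g.
Proof. by move=> idJ; exists 1; rewrite mul1r subrr; exact: ideal0. Qed.

(** Polynomials form a space of countable dimension, the union of the
    finite-dimensional spaces of bounded degree, so uncountably many of them
    are linearly dependent. The label F0 is made constant along the
    relation. *)
Lemma uncountable_relation (I : countType) (F0 : K -> I) (a : K -> {mpoly K[n]}) :
  exists (s : seq K) (gam : K -> K) v, [/\ uniq s, exists2 c, c \in s & gam c != 0,
    \sum_(c <- s) gam c *: a c = 0 & forall c, c \in s -> F0 c = v].
Proof.
have [[v D] hD] := uncK (fun c => (F0 c, msize (a c))).
(* along the infinite fibre of uncK the a c have the same size D, so they
   lie in a space of dimension N *)
pose N := #|{: 'X_{1..n < D}}|.
have [s [us ss hs]] := infinite_uniq_seq N.+1 hD.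
pose M : 'M[K]_(N.+1, N) := \matrix_(i, j) (a s`_i)@_(bmnm (enum_val (j : 'I_#|{: 'X_{1..n < D}}|))).
have : kermx M != 0.
  rewrite -mxrank_eq0 mxrank_ker subn_eq0 -ltnNge ltnS; exact: rank_leq_col.
move=> /rowV0Pn[w wker w0].
have wM : w *m M = 0 by exact/sub_kermxP.
exists s, (fun c => if c \in s then w 0 (inord (index c s)) else 0), v; split => //.
- have [i wi] : exists i, w 0 i != 0.
    apply: contrapT => hw; case/eqP: w0; apply/rowP => i; rewrite mxE; apply: contrapT => /eqP wi.
    by apply: hw; exists i.
  have is_ : (i < size s)%N by rewrite ss.
  exists s`_i; first exact: mem_nth.
  by rewrite mem_nth // index_uniq // inord_val.
- apply/mpolyP => m; rewrite mcoeff0 raddf_sum /=.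
  have [mD|Dm] := ltnP (mdeg m) D; last first.
    rewrite big_seq big1 // => c cs; rewrite mcoeffZ.
    have [_ E] := hs c cs; rewrite [X in _ * X](_ : _ = 0) ?mulr0 //.
    by apply/eqP; rewrite mcoeff_eq0 msize_mdeg_ge // E.
  have := congr1 (fun A : 'rV_N => A 0 (enum_rank (BMultinom mD))) wM.
  rewrite !mxE => E; rewrite -[RHS]E (big_nth 0) ss big_mkord.
  apply: eq_bigr => i _; rewrite mcoeffZ mem_nth ?ss // index_uniq ?ss // inord_val.
  by rewrite mxE enum_rankK.
- by move=> c /hs [].
Qed.

(** Amitsur's trick: b_c is a_c (u - c) modulo J for every c, and a linear
    relation between the a_c gives, after multiplication by the product of
    all the u - c, a relation between the b_c in which no a_c appears. *)
Lemma amitsur J u (I : countType) (F0 : K -> I) (b : K -> {mpoly K[n]}) : is_ideal J ->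
  (forall c, adjoin J (u - c%:MP) (b c)) ->
  exists (s : seq K) (gam : K -> K) v, [/\ uniq s, exists2 c, c \in s & gam c != 0,
    forall c, c \in s -> F0 c = v &
    J (\sum_(c <- s) (gam c *: \prod_(c' <- rem c s) (u - c'%:MP)) * b c)].
Proof.
move=> idJ /choice[a ha].
have [s [gam [v [us h1 h2 h3]]]] := uncountable_relation F0 a.
exists s, gam, v; split => //.
pose Pi := \prod_(c' <- s) (u - c'%:MP).
have -> : \sum_(c <- s) (gam c *: \prod_(c' <- rem c s) (u - c'%:MP)) * b c =
    \sum_(c <- s) (gam c *: \prod_(c' <- rem c s) (u - c'%:MP)) * (b c - a c * (u - c%:MP))
    + Pi * \sum_(c <- s) gam c *: a c.
  rewrite mulr_sumr -big_split big_seq [RHS]big_seq; apply: eq_bigr => c cs /=.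
  rewrite /Pi (perm_big _ (perm_to_rem cs)) big_cons /= -scalerAl -!scalerAr -scalerAl -scalerDr.
  by congr (_ *: _); ring.
rewrite h2 mulr0 addr0; apply: ideal_sum => // c cs.
exact: idealM.
Qed.

(** The summand of index c is the only one that does not vanish at c. *)
Lemma lagrange_neq0 (s : seq K) (gam : K -> K) : uniq s ->
  (exists2 c, c \in s & gam c != 0) ->
  \sum_(c <- s) gam c *: \prod_(c' <- rem c s) ('X - c'%:P) != 0.
Proof.
move=> us [c cs gc]; apply/eqP => /(congr1 (fun p => p.[c])).
rewrite horner0 horner_sum (bigD1_seq c) //= [X in _ + X]big_seq_cond [X in _ + X]big1 => [|c' /andP[c's c'c]]; last first.
  rewrite hornerZ (_ : _.[c] = 0) ?mulr0 //; apply/eqP.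
  by rewrite -[_ == 0]/(root _ c) root_prod_XsubC mem_rem_uniq // inE eq_sym c'c.
rewrite addr0 hornerZ => /eqP; rewrite mulf_eq0 (negbTE gc) /=.
by rewrite -[_ == 0]/(root _ c) root_prod_XsubC mem_rem_uniq // inE eqxx.
Qed.

Definition fproper f J : Prop := forall k, ~ J (f ^+ k).

Lemma lift_XsubC (u : {mpoly K[n]}) c : lift u ('X - c%:P) = u - c%:MP.
Proof. by rewrite rmorphB /= liftX liftC. Qed.

(** If every J + (u - c) contained a power of f, Amitsur's trick would give
    a nonzero polynomial P with P(u) f^v in J. Over an algebraically closed
    field P splits into factors u - r, and modulo each of them a power of f
    vanishes, so a power of f would lie in J. *)
Lemma fproper_adjoin J f u : is_ideal J -> fproper f J ->
  exists c, fproper f (adjoin J (u - c%:MP)).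
Proof.
move=> idJ fJ; apply: contrapT => h.
have hc c : exists k, adjoin J (u - c%:MP) (f ^+ k).
  by apply: contrapT => hk; apply: h; exists c => k hk'; apply: hk; exists k.
have [k hk] := choice hc.
have [s [gam [v [us h1 h2 h3]]]] := amitsur k idJ hk.
set P := \sum_(c <- s) gam c *: \prod_(c' <- rem c s) ('X - c'%:P).
have P0 : P != 0 by exact: lagrange_neq0.
have JP : J (lift u P * f ^+ v).
  move: h3; congr (J _); rewrite /P rmorph_sum mulr_suml big_seq [RHS]big_seq.
  apply: eq_bigr => c cs /=; rewrite (h2 c cs); congr (_ * _).
  rewrite -mul_polyC rmorphM /= liftC mul_mpolyC; congr (_ *: _).
  by rewrite rmorph_prod; apply: eq_bigr => c' _; rewrite /= lift_XsubC.
have [rs Prs] := closed_field_poly_normal P.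
have hrs : exists k', adjoin J (\prod_(r <- rs) (u - r%:MP)) (f ^+ k').
  elim: (rs) => [|r l [k1 [a1 ha1]]].
    by exists 0%N, 1; rewrite big_nil expr0 mul1r subrr; exact: ideal0.
  have [k2 [a2 ha2]] := hc r.
  exists (k2 + k1)%N, (a2 * a1); rewrite big_cons exprD.
  have -> : f ^+ k2 * f ^+ k1 - a2 * a1 * ((u - r%:MP) * \prod_(j <- l) (u - j%:MP)) =
    f ^+ k1 * (f ^+ k2 - a2 * (u - r%:MP)) +
    a2 * (u - r%:MP) * (f ^+ k1 - a1 * \prod_(j <- l) (u - j%:MP)) by ring.
  by apply: idealD => //; exact: idealM.
have [k' [a' ha']] := hrs; apply: (fJ (v + k')%N).
have lP : lift u P = lead_coef P *: \prod_(r <- rs) (u - r%:MP).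
  rewrite {1}Prs -mul_polyC rmorphM /= liftC mul_mpolyC; congr (_ *: _).
  by rewrite rmorph_prod; apply: eq_bigr => c' _; rewrite /= lift_XsubC.
have -> : f ^+ (v + k') = f ^+ v * (f ^+ k' - a' * \prod_(r <- rs) (u - r%:MP)) +
    (lead_coef P)^-1 *: (a' * (lift u P * f ^+ v)).
  rewrite lP -!scalerAl -scalerAr scalerA mulVf ?lead_coef_eq0 // scale1r exprD; ring.
by apply: idealD; [|exact: idealM|apply: idealZ => //; exact: idealM].
Qed.

Definition zeros J : set ('I_n -> K) := [set x | forall p, J p -> p.@[x] = 0].

(** Adjoin X_i - c_i for each coordinate in turn, keeping all powers of f
    outside the ideal; the result is the ideal of a point, where f does not
    vanish. *)
Lemma nullstellensatz J f : is_ideal J -> (forall x, zeros J x -> f.@[x] = 0) ->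
  exists k, J (f ^+ k).
Proof.
move=> idJ hf; apply: contrapT => h.
have fJ : fproper f J by move=> k hk; apply: h; exists k.
have [J' [idJ' fJ' JJ' hc]] : exists J', [/\ is_ideal J', fproper f J', J `<=` J' &
    forall i, exists c, J' ('X_i - c%:MP)].
  suff H (l : seq 'I_n) : exists J', [/\ is_ideal J', fproper f J', J `<=` J' &
      forall i, i \in l -> exists c, J' ('X_i - c%:MP)].
    have [J' [h1 h2 h3 h4]] := H (enum 'I_n); exists J'; split => // i.
    by apply: h4; rewrite mem_enum.
  elim: l => [|i l [J1 [h1 h2 h3 h4]]]; first by exists J; split => // x.
  have [c hc] := fproper_adjoin ('X_i) h1 h2.
  exists (adjoin J1 ('X_i - c%:MP)); split => //.
  - exact: adjoin_ideal.
  - by apply: subset_trans h3 _; exact: sub_adjoin.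
  - move=> j; rewrite inE => /orP[/eqP ->|/h4[d hd]]; first by exists c; exact: adjoin_gen.
    by exists d; exact: sub_adjoin.
have [x hx] := choice hc.
have ev p : J' (p - (p.@[x])%:MP).
  move: p; apply: mpoly_ring_ind => [c|p q hp hq|c p hp|i p hp].
  - by rewrite mevalC subrr; exact: ideal0.
  - by rewrite mevalD mpolyCD opprD addrACA; exact: idealD.
  - rewrite mevalZ mpolyCM -mul_mpolyC -mulrBr; exact: idealM.
  - rewrite mevalM mevalXU mpolyCM.
    have -> : 'X_i * p - (x i)%:MP * (p.@[x])%:MP =
      'X_i * (p - (p.@[x])%:MP) + (p.@[x])%:MP * ('X_i - (x i)%:MP) by ring.
    by apply: idealD => //; exact: idealM.
have J'1 : ~ J' 1 by move=> h1; apply: (fJ' 0%N); rewrite expr0.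
have xJ : zeros J x.
  move=> p /JJ' J'p; apply: contrapT => /eqP px; apply: J'1.
  have : J' ((p.@[x])%:MP) by rewrite -[X in J' X](subKr p); apply: idealB.
  move/(idealM idJ' ((p.@[x])^-1)%:MP); rewrite -mpolyCM mulVf // mpolyC1 //.
have := ev f; rewrite hf // mpolyC0 subr0 => h1.
by apply: (fJ' 1%N); rewrite expr1.
Qed.

Definition is_prime J : Prop :=
  [/\ is_ideal J, ~ J 1 & forall a b, J (a * b) -> J a \/ J b].

(** An ideal maximal among those that avoid a multiplicative set is prime. *)
Lemma prime_avoiding J (S : set {mpoly K[n]}) : is_ideal J -> S 1 ->
  (forall a b, S a -> S b -> S (a * b)) -> (forall a, S a -> ~ J a) ->
  exists Q, [/\ is_prime Q, J `<=` Q & forall a, S a -> ~ Q a].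
Proof.
move=> idJ S1 SM SJ.
pose good (Q : set {mpoly K[n]}) := [/\ is_ideal Q, J `<=` Q & forall a, S a -> ~ Q a].
have [|Q [PQ Qmax]] := @Zorn_bigcup {mpoly K[n]} [set Q | Q = set0 \/ good Q].
  move=> F FP Ftot.
  have [[Q0 FQ0 [q0 Qq0]]|noQ] := pselect (exists2 Q, F Q & Q !=set0); last first.
    left; apply/seteqP; split => // x [Q FQ Qx]; case: noQ; exists Q => //.
    by exists x.
  have gF Q x : F Q -> Q x -> good Q.
    by move=> FQ Qx; case: (FP Q FQ) => // E; move: Qx; rewrite E.
  right; split; first split.
  - by exists Q0 => //; case: (gF _ _ FQ0 Qq0) => -[].
  - move=> a b [Qa FQa Qaa] [Qb FQb Qbb].
    have [ab|ba] := Ftot _ _ FQa FQb.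
      by exists Qb => //; case: (gF _ _ FQb Qbb) => idQ _ _; apply: idealD => //; exact: ab.
    by exists Qa => //; case: (gF _ _ FQa Qaa) => idQ _ _; apply: idealD => //; exact: ba.
  - move=> a b [Qb FQb Qbb]; exists Qb => //.
    by case: (gF _ _ FQb Qbb) => idQ _ _; exact: idealM.
  - by move=> x Jx; exists Q0 => //; case: (gF _ _ FQ0 Qq0) => _ h _; exact: h.
  - by move=> a Sa [Qb FQb Qba]; case: (gF _ _ FQb Qba) => _ _ /(_ a Sa).
have [idQ JQ SQ] : good Q.
  case: PQ => // Q0; exfalso; apply: (Qmax J); last by right; split.
  rewrite Q0; split=> // h; have := h 0 (ideal0 idJ); by [].
exists Q; split => //; split => //; first by move=> Q1; exact: (SQ 1).
move=> a b Qab; apply: contrapT => /not_orP[na nb].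
have big c : ~ Q c -> exists2 s, S s & adjoin Q c s.
  move=> nc; apply: contrapT => hs; apply: (Qmax (adjoin Q c)).
    split; first exact: sub_adjoin.
    by move=> /(_ c (adjoin_gen _ idQ)).
  right; split; first exact: adjoin_ideal.
    by apply: subset_trans JQ _; exact: sub_adjoin.
  by move=> s Ss hsa; apply: hs; exists s.
have [s Ss [x hx]] := big a na; have [t St [y hy]] := big b nb.
apply: (SQ (s * t)); first exact: SM.
have -> : s * t = t * (s - x * a) + x * a * (t - y * b) + x * y * (a * b) by ring.
by apply: idealD => //; [apply: idealD => //; exact: idealM|exact: idealM].
Qed.

End Nullstellensatz.

Local Close Scope classical_set_scope.

(** * Algebraic dependence on a surface *)

Local Open Scope classical_set_scope.

(** Towers of polynomial rings stand for algebraic independence: a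
    polynomial over R is evaluated at u after its coefficients are mapped by
    phi, and iterating the construction evaluates polynomials in several
    elements. *)
Section PolynomialEvaluation.
Context {R S : comNzRingType}.

Definition evp (phi : {rmorphism R -> S}) (u : S) (P : {poly R}) : S :=
  (map_poly phi P).[u].

Lemma evp_is_zmod_morphism phi u : zmod_morphism (evp phi u).
Proof. by move=> P Q; rewrite /evp rmorphB hornerD hornerN. Qed.

Lemma evp_is_monoid_morphism phi u : monoid_morphism (evp phi u).
Proof. by split=> [|P Q]; rewrite /evp ?rmorph1 ?hornerC // rmorphM hornerM. Qed.

HB.instance Definition _ phi u :=
  GRing.isZmodMorphism.Build {poly R} S (evp phi u) (evp_is_zmod_morphism phi u).
HB.instance Definition _ phi u :=
  GRing.isMonoidMorphism.Build {poly R} S (evp phi u) (evp_is_monoid_morphism phi u).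

Lemma evpC phi u c : evp phi u c%:P = phi c.
Proof. by rewrite /evp map_polyC hornerC. Qed.

Lemma evpX phi u : evp phi u 'X = u.
Proof. by rewrite /evp map_polyX hornerX. Qed.

Lemma evpE phi u P : evp phi u P = \sum_(i < size P) phi P`_i * u ^+ i.
Proof.
rewrite -{1}[P]coefK poly_def rmorph_sum; apply: eq_bigr => i _ /=.
by rewrite -mul_polyC rmorphM rmorphXn /= evpC evpX.
Qed.

Lemma poly_split (P : {poly R}) : P = \poly_(i < size P) P`_i.+1 * 'X + (P`_0)%:P.
Proof.
apply/polyP => -[|i]; rewrite coefD coefMX coefC /= ?add0r // addr0 coef_poly.
by case: ltnP => // h; rewrite nth_default // ltnW.
Qed.

End PolynomialEvaluation.

Section AffineVarieties.
Context {K : closedFieldType} {n : nat}.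
Hypothesis uncK : uncountable K.
Implicit Types (X Z : set ('I_n -> K)) (J Q : set {mpoly K[n]}).

Lemma vanishing_is_ideal Z : is_ideal (vanishing_ideal Z).
Proof.
split=> [x _|a b ha hb x Zx|a b hb x Zx].
- by rewrite meval0.
- by rewrite mevalD ha // hb // addr0.
- by rewrite mevalM hb // mulr0.
Qed.

Lemma zeros_vanishing Z : zariski_closed Z -> zeros (vanishing_ideal Z) = Z.
Proof.
move=> [S ->]; apply/seteqP; split=> x /= h p; first by move=> Sp; apply: h => y; apply.
by move=> hp; exact: hp.
Qed.

Lemma zeros_closed J : zariski_closed (zeros J).
Proof. by exists J. Qed.

Lemma variety_prime X : affine_variety X -> is_prime (vanishing_ideal X).
Proof.
move=> [Xcl [[x0 Xx0] Xirr]]; split; first exact: vanishing_is_ideal.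
  by move=> /(_ x0 Xx0) /eqP; rewrite meval1 oner_eq0.
move=> a b hab.
have cl g : zariski_closed [set x : 'I_n -> K | g.@[x] = 0].
  by exists [set g]; apply/seteqP; split=> x /= h; [move=> p ->|exact: h].
have := Xirr _ _ (cl a) (cl b); case => [x Xx|h|h]; [|by left|by right].
have /eqP := hab x Xx; rewrite mevalM mulf_eq0 => /orP[] /eqP h; [left|right]; exact: h.
Qed.

Lemma vanishing_zeros Q : is_prime Q -> vanishing_ideal (zeros Q) = Q.
Proof.
move=> [idQ Q1 Qp]; apply/seteqP; split=> [g hg|g Qg x]; last exact.
have [k] := nullstellensatz uncK idQ hg.
elim: k => [|k IH]; first by rewrite expr0.
by rewrite exprS => /Qp[].
Qed.

Lemma prime_variety Q : is_prime Q -> affine_variety (zeros Q).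
Proof.
move=> pQ; have VQ := vanishing_zeros pQ; have [idQ Q1 Qp] := pQ.
split; first exact: zeros_closed; split.
  apply: contrapT => /set0P/negP; rewrite negbK => /eqP Z0.
  by apply: Q1; rewrite -VQ Z0 => x.
move=> _ _ [S1 ->] [S2 ->] hZ; apply: contrapT => /not_orP[n1 n2].
have [x1 Zx1 [g1 [S1g1 g1x]]] : exists2 x, zeros Q x & exists g, S1 g /\ g.@[x] <> 0.
  apply: contrapT => h; apply: n1 => x Zx g Sg; apply: contrapT => gx.
  by apply: h; exists x => //; exists g.
have [x2 Zx2 [g2 [S2g2 g2x]]] : exists2 x, zeros Q x & exists g, S2 g /\ g.@[x] <> 0.
  apply: contrapT => h; apply: n2 => x Zx g Sg; apply: contrapT => gx.
  by apply: h; exists x => //; exists g.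
have : Q (g1 * g2).
  rewrite -VQ => x Zx; rewrite mevalM; case: (hZ x Zx) => h.
    by rewrite (h g1 S1g1) mul0r.
  by rewrite (h g2 S2g2) mulr0.
by move/Qp => [h|h]; [apply: g1x|apply: g2x]; [exact: Zx1|exact: Zx2].
Qed.

(** Modulo J, the element u is transcendental over the image of phi. *)
Definition transc (R : idomainType) (phi : {rmorphism R -> {mpoly K[n]}}) J u : Prop :=
  forall P : {poly R}, J (evp phi u P) -> P = 0.

(** A hypersurface section u = c lowers the transcendence degree by one
    only. If for every c some nonzero element of R vanished modulo J + (u -
    c), Amitsur's trick would produce a nonzero polynomial over R that kills
    u. For a good c, an ideal maximal among those that avoid R is prime. *)
Lemma cut_prime (R : idomainType) (phi : {rmorphism R -> {mpoly K[n]}})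
    (kap : {rmorphism K -> R}) J u :
  (forall c, phi (kap c) = c%:MP) -> is_prime J -> transc phi J u ->
  exists Q c, [/\ is_prime Q, J `<=` Q, Q (u - c%:MP) & forall r, Q (phi r) -> r = 0].
Proof.
move=> phikap [idJ J1 Jp] tr.
have [c hc] : exists c, forall r, adjoin J (u - c%:MP) (phi r) -> r = 0.
  apply: contrapT => h.
  have /choice[r hr] c : exists r, r != 0 /\ adjoin J (u - c%:MP) (phi r).
    apply: contrapT => hr; apply: h; exists c => r Jr; apply: contrapT => /eqP r0.
    by apply: hr; exists r.
  have [s [gam [v [us [c cs gc] _ h3]]]] :=
    amitsur uncK (fun _ => tt) idJ (fun c => (hr c).2).
  pose P := \sum_(c <- s) (kap (gam c))%:P * \prod_(c' <- rem c s) ('X - (kap c')%:P) * (r c)%:P.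
  have : P != 0.
    apply/eqP => /(congr1 (fun p => p.[kap c])).
    rewrite horner0 horner_sum (bigD1_seq c) //= [X in _ + X]big_seq_cond.
    have root_rem c' : root (\prod_(j <- rem c' s) ('X - (kap j)%:P)) (kap c) = (c \in rem c' s).
      rewrite -(big_map kap predT (fun x => 'X - x%:P)) root_prod_XsubC mem_map //.
      exact: fmorph_inj.
    rewrite [X in _ + X]big1 => [|c' /andP[c's c'c]]; last first.
      rewrite !hornerM [(\prod_(_ <- _) _).[_]](_ : _ = 0) ?mulr0 ?mul0r //; apply/eqP.
      by rewrite -[_ == 0]/(root _ _) root_rem mem_rem_uniq // inE eq_sym c'c.
    rewrite addr0 !hornerM !hornerC => /eqP; rewrite !mulf_eq0 fmorph_eq0 (negbTE gc) /=.
    rewrite (negbTE (hr c).1) orbF.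
    by rewrite -[_ == 0]/(root _ _) root_rem mem_rem_uniq // inE eqxx.
  move/eqP; apply; apply: tr; move: h3; congr (J _).
  rewrite rmorph_sum; apply: eq_bigr => d _; rewrite !rmorphM /= !evpC phikap mul_mpolyC.
  congr (_ *: _ * _); rewrite rmorph_prod; apply: eq_bigr => d' _.
  by rewrite rmorphB /= evpX evpC phikap.
have idJc := adjoin_ideal (u - c%:MP) idJ.
have [||a|Q [pQ JQ SQ]] := @prime_avoiding _ _ _ [set phi r | r in [set r | r != 0]] idJc.
- by exists 1 => /=; [exact: oner_neq0|exact: rmorph1].
- move=> _ _ [r /= r0 <-] [s /= s0 <-]; exists (r * s); rewrite ?rmorphM //=.
  by rewrite mulf_neq0.
- by move=> [r /= r0 <-] /hc; apply/eqP.
exists Q, c; split => //; first by apply: subset_trans (sub_adjoin _ idJ) JQ.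
  by apply: JQ; exact: adjoin_gen.
move=> r Qr; apply: contrapT => /eqP r0; apply: (SQ (phi r)) => //.
by exists r.
Qed.

Lemma cut_variety (R : idomainType) (phi : {rmorphism R -> {mpoly K[n]}})
    (kap : {rmorphism K -> R}) J u :
  (forall c, phi (kap c) = c%:MP) -> is_prime J -> transc phi J u ->
  exists Q, [/\ is_prime Q, zeros Q `<` zeros J & forall r, Q (phi r) -> r = 0].
Proof.
move=> phikap pJ tr; have [Q [c [pQ JQ Qu hQ]]] := cut_prime phikap pJ tr.
exists Q; split => //; split; first by move=> x h p Jp; apply: h; exact: JQ.
move=> sub; have : J (u - c%:MP).
  by rewrite -(vanishing_zeros pJ) => x /sub /(_ _ Qu).
move=> Ju; have := tr ('X - (kap c)%:P).
rewrite rmorphB /= evpX evpC phikap => /(_ Ju) /eqP.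
by rewrite polyXsubC_eq0.
Qed.

Local Notation phi1 p := (evp (@mpolyC n K) p).

Lemma transc_chain X (p a b : {mpoly K[n]}) : affine_variety X ->
  transc (evp (phi1 p) a) (vanishing_ideal X) b ->
  exists W, variety_chain X 3 W.
Proof.
move=> vX tr; have pX := variety_prime vX.
have ZX : zeros (vanishing_ideal X) = X by apply: zeros_vanishing; case: vX.
have [Q2 [pQ2 lt2 tr2]] := @cut_variety _ (evp (phi1 p) a) (polyC \o polyC) _ b
  (fun c => etrans (evpC _ _ _) (evpC _ _ _)) pX tr.
have [Q1 [pQ1 lt1 tr1]] := @cut_variety _ (phi1 p) polyC _ a
  (fun c => evpC _ _ _) pQ2 tr2.
have [Q0 [pQ0 lt0 tr0]] := @cut_variety _ (@mpolyC n K) idfun _ p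
  (fun c => erefl) pQ1 tr1.
rewrite ZX in lt2.
exists (nth X [:: zeros Q0; zeros Q1; zeros Q2; X]); split.
  have s21 : zeros Q1 `<=` X by apply: subset_trans (properW lt1) (properW lt2).
  move=> [|[|[|[|i]]]] //= _; split => //; try exact: prime_variety.
  - by apply: subset_trans (properW lt0) s21.
  - exact: properW lt2.
by move=> [|[|[|i]]].
Qed.

(** The length of chains bounds the transcendence degree from above, by
    [transc_chain]. *)
Lemma dim2_algdep X (p : {mpoly K[n]}) : affine_variety X -> variety_dim X 2 ->
  forall a b, exists2 P : {poly {poly {poly K}}}, P != 0 &
    vanishing_ideal X (evp (evp (phi1 p) a) b P).
Proof.
move=> vX [_ nch] a b; apply: contrapT => h; apply: nch.
apply: (@transc_chain _ p a b) => // P hP; apply: contrapT => /eqP P0.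
by apply: h; exists P.
Qed.

Lemma prime_split_root J (u : {mpoly K[n]}) (P : {poly K}) : is_prime J -> P != 0 ->
  J (phi1 u P) -> exists c, J (u - c%:MP).
Proof.
move=> [idJ J1 Jp] P0; have [rs ->] := closed_field_poly_normal P.
rewrite -mul_polyC rmorphM /= evpC rmorph_prod /= => /Jp[].
  move=> Jc; case: J1; move: (idealM idJ ((lead_coef P)^-1)%:MP Jc).
  by rewrite -mpolyCM mulVf ?lead_coef_eq0 // mpolyC1.
elim: rs => [|r rs IH]; first by rewrite big_nil => /J1.
rewrite big_cons => /Jp[|/IH //].
by rewrite rmorphB /= evpX evpC => h; exists r.
Qed.

(** Suppose that every function is algebraic over p. A proper irreducible
    subset W of X lies in the zero set of some q that is not zero on X; the
    constant coefficient of an equation of q over p then shows that p is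
    constant on W. Every coordinate satisfies an equation over p that stays
    nontrivial for this value of p, so W is a point, and there is no chain
    of length two. *)
Lemma dim2_transc X (p : {mpoly K[n]}) : affine_variety X -> variety_dim X 2 ->
  transc (@mpolyC n K) (vanishing_ideal X) p ->
  exists a, transc (phi1 p) (vanishing_ideal X) a.
Proof.
move=> vX [[W [Wv Wlt]] _] trp; apply: contrapT => hna.
have pI := variety_prime vX; set I := vanishing_ideal X in pI trp hna.
have [idI I1 Ip] := pI.
have alg a : exists2 P : {poly {poly K}}, P != 0 & I (evp (phi1 p) a P).
  apply: contrapT => h; apply: hna; exists a => P hP; apply: contrapT => /eqP P0.
  by apply: h; exists P.
have [v0 _] := Wv 0%N isT; have [v1 W1X] := Wv 1%N isT; have [v2 W2X] := Wv 2%N isT.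
have lt01 := Wlt 0%N isT; have lt12 := Wlt 1%N isT.
have pJ := variety_prime v1; set J := vanishing_ideal (W 1%N) in pJ.
have [idJ J1 Jp] := pJ.
have IJ : I `<=` J by move=> g hg x W1x; apply: hg; exact: W1X.
have [q Jq nIq] : exists2 q, J q & ~ I q.
  apply: contrapT => h; apply: lt12.2 => x W2x.
  rewrite -(zeros_vanishing v1.1) => q Jq; apply: contrapT => qx; apply: h.
  by exists q => // Iq; apply: qx; apply: Iq; exact: W2X.
(* q is not in the prime ideal I, so factors X can be removed from an
   equation of q *)
have [P [P0 IP]] : exists P : {poly {poly K}}, P`_0 != 0 /\ I (evp (phi1 p) q P).
  have [P P0 IP] := alg q; have [N] := ubnP (size P).
  elim: N P P0 IP => // N IH P P0 IP; rewrite ltnS => PN.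
  have [c0|] := eqVneq P`_0 0; last by exists P.
  have [P' E] : exists P', P = P' * 'X.
    by exists (\poly_(i < size P) P`_i.+1); rewrite {1}(poly_split P) c0 addr0.
  have P'0 : P' != 0 by apply: contraNneq P0 => E'; rewrite E E' mul0r.
  apply: (IH P') => //; last by move: PN; rewrite E size_mulX.
  by move: IP; rewrite E rmorphM /= evpX => /Ip[].
have [y0 Jy0] : exists c, J (p - c%:MP).
  apply: (prime_split_root pJ P0); move: (IJ _ IP).
  rewrite {1}(poly_split P) rmorphD rmorphM /= evpX evpC => h.
  set x := _ * q in h; have Jx : J x by exact: (idealM idJ).
  have -> : phi1 p P`_0 = x + phi1 p P`_0 - x by rewrite addrC addKr.
  exact: (idealB idJ).
have py0 : ~ I (p - y0%:MP).
  move=> h; have := trp ('X - y0%:P); rewrite rmorphB /= evpX evpC => /(_ h) /eqP.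
  by rewrite polyXsubC_eq0.
have coord i : exists c, J ('X_i - c%:MP).
  have [Q Q0 IQ] := alg 'X_i.
  have [Q' [Q'0 IQ']] : exists Q : {poly {poly K}},
      map_poly (horner_eval y0) Q != 0 /\ I (evp (phi1 p) 'X_i Q).
    have [N] : exists N : nat, forall k : nat, (size (Q`_k)%R <= N)%N.
      exists (\max_(k < size Q) size (Q`_k)%R)%N => k.
      have [kQ|Qk] := ltnP k (size Q); last by rewrite nth_default // size_poly0.
      exact: (leq_bigmax (Ordinal kQ)).
    elim: N Q Q0 IQ => [|N IH] Q Q0 IQ hN.
      case/eqP: Q0; apply/polyP => k; rewrite coef0; apply/eqP.
      by rewrite -size_poly_eq0 -leqn0.
    have [Qy|] := eqVneq (map_poly (horner_eval y0) Q) 0; last by exists Q.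
    have Qk k : root Q`_k y0.
      by apply/rootP; rewrite -[LHS]/(horner_eval y0 Q`_k) -coef_map Qy coef0.
    pose Q1 := map_poly (fun c => c %/ ('X - y0%:P)) Q.
    have Q1k k : Q1`_k = Q`_k %/ ('X - y0%:P) by rewrite coef_map_id0 // div0p.
    have QE : Q = ('X - y0%:P)%:P * Q1.
      apply/polyP => k; rewrite coefCM Q1k mulrC divpK //.
      by rewrite dvdp_XsubCl.
    apply: (IH Q1).
    - by apply: contraNneq Q0 => E; rewrite QE E mulr0.
    - move: IQ; rewrite QE rmorphM /= evpC rmorphB /= evpX evpC => /Ip[] //.
    - move=> k; rewrite Q1k size_divp ?polyXsubC_eq0 // size_XsubC subn1 /=.
      by have := hN k; case: (size _).
  apply: (prime_split_root pJ Q'0).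
  have HJ r : J (phi1 p r - (r.[y0])%:MP).
    have /factor_theorem[d Ed] : root (r - (r.[y0])%:P) y0.
      by rewrite /root hornerD hornerN hornerC subrr.
    have -> : phi1 p r - (r.[y0])%:MP = phi1 p d * (p - y0%:MP).
      by rewrite -(evpC (@mpolyC n K) p) -rmorphB /= Ed rmorphM rmorphB /= evpX evpC.
    exact: (idealM idJ).
  move: (IJ _ IQ') => h; rewrite -[phi1 _ _](subKr (evp (phi1 p) 'X_i Q')).
  apply: (idealB idJ) => //; rewrite /evp; set F := map_poly _ Q'; set G := map_poly _ (map_poly _ _).
  rewrite -hornerN -hornerD (horner_coef_wide _ (_ : (size (F - G)%R <= size Q')%N)); last first.
    rewrite (leq_trans (size_polyD _ _)) // geq_max size_poly size_polyN.
    by apply: leq_trans (size_poly _ _) (size_poly _ _).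
  apply: (ideal_sum idJ) => // k _; rewrite mulrC; apply: (idealM idJ) => //.
  rewrite coefB coef_map coef_map_id0 ?rmorph0 //= coef_map_id0 ?horner0 //.
  by rewrite /horner_eval horner0.
have [c hc] := choice coord.
have pt x : W 1%N x -> x = c.
  move=> Wx; apply/funext => i; apply/eqP; rewrite -subr_eq0; apply/eqP.
  by have := hc i x Wx; rewrite mevalB mevalXU mevalC.
apply: lt01.2 => x W1x; have [_ [[z Wz] _]] := v0.
by rewrite (pt x W1x) -(pt z (lt01.1 z Wz)).
Qed.

End AffineVarieties.

Local Close Scope classical_set_scope.

(** * Noether normalisation with a parameter *)

(** Pad the matrix with zero columns to a square matrix of determinant zero. *)
Lemma tall_kernel (R : idomainType) a b (M : 'M[R]_(a, b)) : (b < a)%N ->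
  exists2 v : 'rV_a, v != 0 & v *m M = 0.
Proof.
move=> ba; pose N : 'M[R]_a := \matrix_(i, j) if insub (val j) is Some j' then M i j' else 0.
have : \det N == 0.
  rewrite (expand_det_col N (Ordinal ba)) big1 // => i _.
  by rewrite mxE insubF ?mul0r //= ltnn.
move/det0P => [v v0 vN]; exists v => //; apply/rowP => j; rewrite [RHS]mxE.
have ja : (j < a)%N by apply: ltn_trans ba.
have := congr1 (fun A : 'rV_a => A 0 (Ordinal ja)) vN; rewrite !mxE => E.
by rewrite -[RHS]E; apply: eq_bigr => i _; rewrite mxE /= valK.
Qed.

(** A submodule N of R[x]^m that contains a basis of the fraction space is
    free up to multiplication by nonzero elements of R: over the fraction
    field of R, the ring R[x] is a principal ideal domain. *)
Section LatticeBasis.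
Context {R : idomainType} {m : nat}.
Variable N : 'rV[{poly R}]_m -> Prop.
Hypothesis ND : forall v w, N v -> N w -> N (v + w).
Hypothesis NZ : forall a v, N v -> N (a *: v).
Hypothesis Nfull : exists2 P : 'M_m, \det P != 0 & forall i, N (row i P).

Lemma det_replace (P : 'M[{poly R}]_m) i (v : 'rV_m) :
  \det (\matrix_(j, k) if j == i then v 0 k else P j k) = (v *m \adj P) 0 i.
Proof.
rewrite (expand_det_row _ i) mxE; apply: eq_bigr => k _; rewrite mxE eqxx; congr (_ * _).
rewrite [RHS]mxE /cofactor; congr (_ * \det _); apply/matrixP => x y; rewrite !mxE.
by rewrite eq_sym (negbTE (neq_lift _ _)).
Qed.

(** Choose vectors of N whose determinant is nonzero of minimal degree. By
    Cramer's rule the coordinates of v in N have this determinant d as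
    denominator. Pseudo-divide them by d: if some remainder were nonzero,
    replacing a row by the corresponding vector of N would give a smaller
    determinant. *)
Lemma lattice_basis : exists P : 'M_m, [/\ \det P != 0, forall i, N (row i P) &
  forall v, N v -> exists s q, s != 0 /\ s%:P *: v = q *m P].
Proof.
pose good k := `[< exists P : 'M_m, [/\ \det P != 0, forall i, N (row i P) & size (\det P) = k] >].
have exg : exists k, good k.
  by have [P P0 hP] := Nfull; exists (size (\det P)); apply/asboolP; exists P.
have [k /asboolP[P [P0 hP szP]] kmin] := ex_minnP exg.
exists P; split => // v Nv; set d := \det P in P0 szP.
have dI (x y : 'rV[{poly R}]_m) : d *: x = d *: y -> x = y.
  by move/rowP => h; apply/rowP => i; have := h i; rewrite !mxE => /(mulfI P0).
pose w := v *m \adj P.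
have Hw : d *: v = w *m P by rewrite /w -mulmxA mul_adj_mx mul_mx_scalar.
pose lc := lead_coef d; have lc0 : lc != 0 by rewrite lead_coef_eq0.
pose e i := scalp (w 0 i) d.
pose L := lc ^+ (\sum_i e i).
have L0 : L != 0 by rewrite expf_neq0.
pose c i := lc ^+ (\sum_(j | j != i) e j).
have cE i : c i * lc ^+ e i = L by rewrite /c /L -exprD addnC [in RHS](bigD1 i).
pose q := \row_i ((c i)%:P * (w 0 i %/ d)).
pose r := \row_i ((c i)%:P * (w 0 i %% d)).
have Er : L%:P *: w = d *: q + r.
  apply/rowP => i; rewrite [LHS]mxE [RHS]mxE [(d *: q) _ _]mxE [q 0 i]mxE [r 0 i]mxE.
  rewrite -(cE i) polyCM -mulrA [(lc ^+ e i)%:P * _]mul_polyC.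
  by rewrite Pdiv.Idomain.divp_eq; ring.
have rsz i : (size (r 0 i)%R < size d)%N.
  rewrite mxE mul_polyC size_scale ?ltn_modp // /c expf_neq0 //.
pose v' := L%:P *: v - q *m P.
have Nv' : N v'.
  have -> : v' = L%:P *: v + \sum_i (- q 0 i) *: row i P.
    rewrite /v' mulmx_sum_row -sumrN; congr (_ + _).
    by apply: eq_bigr => i _; rewrite scaleNr.
  apply: ND; first exact: NZ.
  apply: (big_ind N) => [|x y|i _]; [|exact: ND|by apply: NZ].
  by rewrite -(scale0r v); exact: NZ.
have Hv' : d *: v' = r *m P.
  rewrite scalerBr scalerA mulrC -scalerA Hw scalemxAl Er mulmxDl -scalemxAl.
  by rewrite [X in X - _]addrC addrK.
have v'adj : v' *m \adj P = r.
  apply: dI; rewrite scalemxAl Hv' -mulmxA mul_mx_adj mul_mx_scalar //.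
have r0 : r = 0.
  apply/rowP => i; rewrite [RHS]mxE; apply: contrapT => /eqP ri.
  suff /kmin : good (size (r 0 i)) by rewrite leqNgt -szP rsz.
  pose P' : 'M_m := \matrix_(j, l) if j == i then v' 0 l else P j l.
  apply/asboolP; exists P'; rewrite det_replace v'adj; split => // j.
  have [->|ji] := eqVneq j i.
    by have -> : row i P' = v' by apply/rowP => l; rewrite !mxE eqxx.
  by have -> : row j P' = row j P by apply/rowP => l; rewrite !mxE (negbTE ji).
exists L, q; split => //; apply/eqP; rewrite -subr_eq0 -/v'; apply/eqP.
by apply: dI; rewrite Hv' r0 mul0mx scaler0.
Qed.

End LatticeBasis.

Section DomainOverLine.
Context {K : fieldType} {A : comNzRingType}.
Hypothesis domA : forall a b : A, a * b = 0 -> a = 0 \/ b = 0.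
Variable phi1 : {rmorphism {poly K} -> A}.
Hypothesis phi1_inj : forall s, phi1 s = 0 -> s = 0.

Lemma mulAI (a b c : A) : a != 0 -> a * b = a * c -> b = c.
Proof.
move=> a0 /eqP; rewrite -subr_eq0 -mulrBr => /eqP /domA[/eqP|/eqP].
  by rewrite (negbTE a0).
by rewrite subr_eq0 => /eqP.
Qed.

Lemma phi1_neq0 s : s != 0 -> phi1 s != 0.
Proof. by apply: contra_neq; exact: phi1_inj. Qed.

Section Membership.
Context {R : comNzRingType} (psi : {rmorphism R -> A}).
Hypothesis psi_phi1 : forall s, exists r, psi r = phi1 s.
Context {I : finType} (u : I -> A).

(** Membership in the module spanned by u over the localisation of R at the
    nonzero elements of K[t], written without denominators. *)
Definition spanned a : Prop :=
  exists2 s, s != 0 & exists V : I -> R, phi1 s * a = \sum_i psi (V i) * u i.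

Lemma spannedD a b : spanned a -> spanned b -> spanned (a + b).
Proof.
move=> [s s0 [V hV]] [t t0 [W hW]]; exists (s * t); first by rewrite mulf_neq0.
have [rs Es] := psi_phi1 s; have [rt Et] := psi_phi1 t.
exists (fun i => rt * V i + rs * W i).
have -> : phi1 (s * t) * (a + b) = phi1 t * (phi1 s * a) + phi1 s * (phi1 t * b).
  by rewrite rmorphM; ring.
rewrite hV hW !mulr_sumr -big_split; apply: eq_bigr => i _ /=.
by rewrite rmorphD !rmorphM Es Et; ring.
Qed.

Lemma spanned_scale r a : spanned a -> spanned (psi r * a).
Proof.
move=> [s s0 [V hV]]; exists s => //; exists (fun i => r * V i).
by rewrite mulrCA hV mulr_sumr; apply: eq_bigr => i _; rewrite rmorphM mulrA.
Qed.

Lemma spanned_gen i : spanned (u i).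
Proof.
exists 1; first exact: oner_neq0; exists (fun j => (i == j)%:R).
rewrite rmorph1 mul1r (bigD1 i) //= eqxx rmorph1 mul1r big1 ?addr0 // => j ji.
by rewrite eq_sym (negbTE ji) rmorph0 mul0r.
Qed.

Lemma spanned0 : spanned 0.
Proof.
exists 1; first exact: oner_neq0; exists (fun=> 0).
by rewrite mulr0 big1 // => i _; rewrite rmorph0 mul0r.
Qed.

Lemma spannedN a : spanned a -> spanned (- a).
Proof. by move=> h; rewrite -mulN1r -(rmorphN1 psi); exact: spanned_scale. Qed.

Lemma spanned_div s a : s != 0 -> spanned (phi1 s * a) -> spanned a.
Proof.
move=> s0 [t t0 [V hV]]; exists (t * s); first by rewrite mulf_neq0.
by exists V; rewrite rmorphM -mulrA.
Qed.

Lemma spanned_sum (J : Type) (l : seq J) (P : pred J) (F : J -> A) :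
  (forall j, P j -> spanned (F j)) -> spanned (\sum_(j <- l | P j) F j).
Proof. by move=> h; apply: (big_ind spanned) => //; [exact: spanned0|exact: spannedD]. Qed.

End Membership.

Lemma spanned_sub (R R' : comNzRingType) (psi : {rmorphism R -> A})
    (psi' : {rmorphism R' -> A}) (I I' : finType) (u : I -> A) (u' : I' -> A) r a :
  (forall s, exists r, psi' r = phi1 s) ->
  (forall i, spanned psi' u' (r * u i)) ->
  (forall c b, spanned psi' u' b -> spanned psi' u' (psi c * b)) ->
  spanned psi u a -> spanned psi' u' (r * a).
Proof.
move=> h h1 h2 [s s0 [V hV]]; apply: (spanned_div s0).
have -> : phi1 s * (r * a) = r * (phi1 s * a) by ring.
rewrite hV mulr_sumr; apply: spanned_sum => // i _.
by rewrite mulrCA; exact: h2.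
Qed.

Lemma evp_phi1 x s : exists r, evp phi1 x r = phi1 s.
Proof. by exists s%:P; rewrite evpC. Qed.

(** Let P be a relation between x and b, of degree less than M in b. The
    substitution x = b^M + x' turns it into an equation for b over K[t][x']
    whose leading coefficient lies in K[t], so that b becomes integral over
    K(t)[x']. *)
Section Nagata.
Variable M : nat.
Hypothesis M_gt0 : (0 < M)%N.

Definition emb : {poly {poly K}} -> {poly {poly {poly K}}} := map_poly polyC.

HB.instance Definition _ := GRing.RMorphism.on emb.

Definition nagata (P : {poly {poly {poly K}}}) : {poly {poly {poly K}}} :=
  evp emb ('X^M + 'X%:P) P.

Lemma lead_coef_nagata (P : {poly {poly {poly K}}}) : P != 0 -> (forall i, (size (P`_i)%R <= M)%N) ->
  nagata P != 0 /\ lead_coef (nagata P) = (lead_coef (lead_coef P))%:P.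
Proof.
have Y_size : size ('X^M + 'X%:P : {poly {poly {poly K}}}) = M.+1.
  rewrite size_polyDl ?size_polyXn // (leq_ltn_trans (size_polyC_leq1 _)) //.
have Y_monic : ('X^M + 'X%:P : {poly {poly {poly K}}}) \is monic.
  rewrite monicE lead_coefDl ?lead_coefXn // size_polyXn.
  by rewrite (leq_ltn_trans (size_polyC_leq1 _)).
have embE c : size (emb c) = size c /\ lead_coef (emb c) = (lead_coef c)%:P.
  by split; [apply: size_map_inj_poly => //|apply: lead_coef_map_inj => //]; exact: polyC_inj.
elim/poly_ind: P => [|P c IH] P0 hM; first by rewrite eqxx in P0.
have cM : (size c <= M)%N.
  by have := hM 0%N; rewrite coefD coefMX coefC eqxx add0r.
rewrite /nagata rmorphD rmorphM /= evpX evpC -/(nagata P).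
have [P1|P1] := eqVneq P 0.
  rewrite P1 /nagata (rmorph0 (evp emb _)) mul0r mul0r !add0r.
  have [s1 l1] := embE c; rewrite l1 lead_coefC; split => //.
  rewrite -size_poly_eq0 s1 size_poly_eq0; apply: contraNneq P0 => ->.
  by rewrite P1 mul0r add0r polyC0.
have [Q0 lQ] : nagata P != 0 /\ lead_coef (nagata P) = (lead_coef (lead_coef P))%:P.
  apply: IH => // i; have := hM i.+1.
  by rewrite coefD coefMX coefC /= addr0.
have Qsz : (size (emb c) < size (nagata P * ('X^M + 'X%:P))%R)%N.
  rewrite size_Mmonic // Y_size addnS /= (embE c).1.
  by rewrite (leq_ltn_trans cM) // -add1n leq_add2r size_poly_gt0.
split; last first.
  rewrite lead_coefDl // lead_coef_Mmonic // lQ lead_coefDl ?lead_coefMX //.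
  by rewrite size_mulX // ltnS (leq_trans (size_polyC_leq1 _)) // size_poly_gt0.
rewrite -size_poly_eq0 size_polyDl //; apply: contraTneq Qsz => ->.
by rewrite ltn0.
Qed.

Lemma evp_nagata x x' b P : x = x' + b ^+ M ->
  evp (evp phi1 x') b (nagata P) = evp (evp phi1 b) x P.
Proof.
move=> Ex; elim/poly_ind: P => [|P c IH].
  by rewrite /nagata !rmorph0.
rewrite /nagata !rmorphD !rmorphM /= !evpX !evpC -/(nagata P) IH; congr (_ * _ + _).
  rewrite rmorphD rmorphXn /= ?evpC ?evpX Ex addrC; congr (_ + _); exact: evpX.
elim/poly_ind: c => [|c d IHc]; first by rewrite !rmorph0.
rewrite !rmorphD !rmorphM /= IHc /emb map_polyX map_polyC /= !evpX !evpC.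
by congr (_ + _); exact: evpC.
Qed.

End Nagata.

Hypothesis algdep2 : forall a b, exists2 P : {poly {poly {poly K}}}, P != 0 &
  evp (evp phi1 a) b P = 0.

Lemma integral_substitution x b : exists x' M (Q : {poly {poly {poly K}}}) s,
  [/\ s != 0, lead_coef Q = s%:P, evp (evp phi1 x') b Q = 0 & x = x' + b ^+ M].
Proof.
have [P P0 hP] := algdep2 b x.
pose M := (\max_(i < size P) size (P`_i)%R).+1.
have hM i : (size (P`_i)%R <= M)%N.
  have [iP|Pi] := ltnP i (size P); last by rewrite nth_default // size_poly0.
  by apply: leqW; exact: (leq_bigmax (Ordinal iP)).
have [Q0 lQ] := lead_coef_nagata (ltn0Sn _) P0 hM.
exists (x - b ^+ M), M, (nagata M P), (lead_coef (lead_coef P)); split => //.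
- by rewrite !lead_coef_eq0.
- by rewrite (@evp_nagata M x) // subrK.
- by rewrite subrK.
Qed.

(** Over a domain R, clear denominators and apply [tall_kernel] to the
    matrix of coordinates. *)
Lemma spanned_dependent (R : idomainType) (psi : {rmorphism R -> A}) (I : finType)
    (u : I -> A) k (a : 'I_k -> A) :
  (forall s, exists r, psi r = phi1 s) -> (#|I| < k)%N ->
  (forall i, spanned psi u (a i)) ->
  exists2 V : 'I_k -> R, exists i, V i != 0 & \sum_i psi (V i) * a i = 0.
Proof.
move=> psi_phi1 Ik ha.
have /choice[s hs] i : exists s, s != 0 /\ exists V : I -> R, phi1 s * a i = \sum_j psi (V j) * u j.
  by have [s s0 hV] := ha i; exists s.
have /choice[V hV] i : exists V : I -> R, phi1 (s i) * a i = \sum_j psi (V j) * u j.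
  by case: (hs i).
have [r hr] := choice psi_phi1.
pose M : 'M[R]_(k, #|I|) := \matrix_(i, j) V i (enum_val j).
have [v v0 vM] := tall_kernel M Ik.
have [i vi] : exists i, v 0 i != 0.
  apply: contrapT => h; case/eqP: v0; apply/rowP => i; rewrite mxE.
  by apply: contrapT => /eqP vi; apply: h; exists i.
exists (fun i => v 0 i * r (s i)).
  exists i; rewrite mulf_neq0 //; apply: contraNneq (phi1_neq0 (hs i).1) => ri.
  by rewrite -hr ri rmorph0.
transitivity (\sum_i \sum_j psi (v 0 i * V i j) * u j).
  apply: eq_bigr => l _; rewrite rmorphM hr -mulrA hV mulr_sumr.
  by apply: eq_bigr => j _; rewrite rmorphM mulrA.
rewrite exchange_big big1 // => j _ /=; rewrite -mulr_suml -rmorph_sum.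
have := congr1 (fun A : 'rV_#|I| => A 0 (enum_rank j)) vM; rewrite !mxE => E.
rewrite (_ : \sum_i _ = 0) ?rmorph0 ?mul0r // -[RHS]E.
by apply: eq_bigr => l _; rewrite mxE enum_rankK.
Qed.

Section Powers.
Context {R : comNzRingType} (psi : {rmorphism R -> A}).
Hypothesis psi_phi1 : forall s, exists r, psi r = phi1 s.
Variables (b : A) (Q : {poly R}) (s : {poly K}).
Hypotheses (s0 : s != 0) (Qs : psi (lead_coef Q) = phi1 s) (Qb : evp psi b Q = 0).
Context {I : finType} (u : I -> A).
Local Notation d := (size Q).-1.

Definition powers (ji : I * 'I_d) : A := u ji.1 * b ^+ ji.2.

Lemma spanned_power i j : spanned psi powers (b ^+ i * u j).
Proof.
have [N] := ubnP i; elim: N i => // N IH i; rewrite ltnS => iN.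
have [id|di] := ltnP i d.
  by rewrite mulrC; exact: (spanned_gen psi powers (j, Ordinal id)).
have Qsz : size Q = d.+1.
  rewrite prednK // size_poly_gt0; apply: contraNneq (phi1_neq0 s0) => Q0.
  by rewrite -Qs Q0 lead_coef0 rmorph0.
have E0 : \sum_(l < size Q) psi Q`_l * b ^+ l = 0 by rewrite -evpE.
have E : phi1 s * b ^+ d = - \sum_(l < d) psi Q`_l * b ^+ l.
  apply/eqP; rewrite -addr_eq0 addrC -Qs; apply/eqP.
  by rewrite Qsz big_ord_recr /= in E0.
apply: (spanned_div s0).
rewrite -(subnK di) exprD [phi1 s * _](_ : _ = b ^+ (i - d) * (phi1 s * b ^+ d) * u j); last by ring.
rewrite E mulrN mulNr; apply: spannedN => //; rewrite mulr_sumr mulr_suml.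
apply: spanned_sum => // l _.
rewrite (_ : _ * u j = psi Q`_l * (b ^+ (i - d + l) * u j)); last by rewrite exprD; ring.
apply: spanned_scale => //; apply: IH.
by apply: leq_trans iN; rewrite -{2}(subnK di) ltn_add2l.
Qed.

Lemma spanned_mulb a : spanned psi powers a -> spanned psi powers (b * a).
Proof.
apply: spanned_sub => // [[j i]|c a']; last exact: spanned_scale.
rewrite (_ : b * _ = b ^+ i.+1 * u j); first exact: spanned_power.
by rewrite /powers /= exprS; ring.
Qed.

Lemma spanned_mulbX k a : spanned psi powers a -> spanned psi powers (b ^+ k * a).
Proof.
move=> h; elim: k => [|k IH]; first by rewrite mul1r.
by rewrite exprS -mulrA; exact: spanned_mulb.
Qed.

End Powers.

Lemma spanned_evp (R : comNzRingType) (psi : {rmorphism R -> A}) (I : finType) (u : I -> A) x :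
  (forall s, exists r, psi r = phi1 s) ->
  (forall a, spanned psi u a -> spanned psi u (x * a)) ->
  forall c a, spanned psi u a -> spanned psi u (evp phi1 x c * a).
Proof.
move=> psi_phi1 hx c a ha; rewrite evpE mulr_suml; apply: spanned_sum => // l _.
have [r <-] := psi_phi1 c`_l; rewrite -mulrA; apply: spanned_scale => //.
elim: (l : nat) => [|k IH]; first by rewrite mul1r.
by rewrite exprS -mulrA; exact: hx.
Qed.

Variables (nn : nat) (X : 'I_nn -> A).
Hypothesis gen_ind : forall Q : A -> Prop, (forall c, Q (phi1 c%:P)) ->
  (forall a b, Q a -> Q b -> Q (a + b)) -> (forall i a, Q a -> Q (X i * a)) ->
  forall a, Q a.

(** One generator X_k of the ring at a time: the substitution of
    [integral_substitution] replaces x by x' = x - X_k^M, over which both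
    X_k and the former x are integral. *)
Lemma noether : exists (x : A) (I : finType) (u : I -> A), forall a, spanned (evp phi1 x) u a.
Proof.
have gens k : (k <= nn)%N -> exists (x : A) (I : finType) (u : I -> A),
    spanned (evp phi1 x) u 1 /\ forall (i : 'I_nn) j, (i < k)%N -> spanned (evp phi1 x) u (X i * u j).
  elim: k => [|k IH] knn.
    by exists 0, unit, (fun=> 1); split => //; exact: spanned_gen _ _ tt.
  have [x [I [u [h1 hX]]]] := IH (ltnW knn).
  pose b := X (Ordinal knn).
  have [x' [M [Q [s [s0 lQ hQ Ex]]]]] := integral_substitution x b.
  pose psi' : {rmorphism _ -> _} := evp phi1 x'.
  have psP := evp_phi1 x'.
  have Qs : psi' (lead_coef Q) = phi1 s by rewrite lQ; exact: evpC.
  have mb := @spanned_mulbX _ psi' psP b Q s s0 Qs hQ I u.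
  pose u' := powers (Q := Q) b u.
  have mx a : spanned psi' u' a -> spanned psi' u' (x * a).
    move=> ha; rewrite Ex mulrDl; apply: spannedD => //; last exact: mb.
    by rewrite -{1}(evpX phi1 x'); exact: spanned_scale.
  have mev := spanned_evp psP mx.
  have sub a : spanned (evp phi1 x) u a -> spanned psi' u' a.
    rewrite -{2}[a]mul1r; apply: spanned_sub => // j; rewrite mul1r -[u j]mul1r -(expr0 b).
    exact: (spanned_power psP s0 Qs hQ u 0 j).
  exists x', (I * 'I_(size Q).-1)%type, u'; split; first exact: sub.
  move=> i [j l]; rewrite ltnS leq_eqVlt => /orP[/eqP ik|ik].
    have -> : X i = b by congr X; apply: val_inj.
    by rewrite -[b]expr1; apply: mb; exact: spanned_gen.
  rewrite /u' /powers /= mulrA mulrC; apply: mb; apply: sub; exact: hX.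
have [x [I [u [h1 hX]]]] := gens nn (leqnn nn).
exists x, I, u; apply: gen_ind.
- move=> c; rewrite -[phi1 _]mulr1 -(evpC phi1 x); exact: spanned_scale.
- by move=> a b; apply: spannedD; exact: evp_phi1.
- move=> i a; apply: spanned_sub => [|j|c b]; first exact: evp_phi1.
    exact: hX.
  exact: spanned_scale.
Qed.

Hypothesis transc1 : exists a0, forall P, evp phi1 a0 P = 0 -> P = 0.

(** If x were algebraic over K(t), the whole ring would be a finite
    K(t)-module, and the powers of a transcendental element would be
    dependent. *)
Lemma noether_transc x (I : finType) (u : I -> A) :
  (forall a, spanned (evp phi1 x) u a) -> forall P, evp phi1 x P = 0 -> P = 0.
Proof.
move=> hu P hP; apply: contrapT => /eqP P0; have [a0 ha0] := transc1.
have ps s : exists r, phi1 r = phi1 s by exists s.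
have l0 : lead_coef P != 0 by rewrite lead_coef_eq0.
have mb := @spanned_mulb _ phi1 ps x P _ l0 erefl hP I u.
pose w := powers (Q := P) x u.
have all_w a : spanned phi1 w a.
  rewrite -[a]mul1r; apply: (@spanned_sub _ _ (evp phi1 x) phi1 I _ u) => // [j|].
    by rewrite mul1r -[u j]mul1r -(expr0 x); exact: (spanned_power ps l0 erefl hP u 0 j).
  exact: spanned_evp.
pose k := #|{: I * 'I_(size P).-1}|.
have [V [i Vi] hV] := spanned_dependent (a := fun i : 'I_k.+1 => a0 ^+ i) ps (ltnSn _) (fun i => all_w _).
case/eqP: Vi; have := ha0 (\poly_(i < k.+1) V (inord i)).
rewrite /evp (_ : (map_poly _ _).[_] = \sum_(i < k.+1) phi1 (V i) * a0 ^+ i) => [/(_ hV)|].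
  by move/(congr1 (fun p : {poly _} => p`_i)); rewrite coef_poly ltn_ord coef0 inord_val.
rewrite (horner_coef_wide _ (_ : (size _ <= k.+1)%N)); last first.
  exact: leq_trans (size_poly _ _) (size_poly _ _).
by apply: eq_bigr => j _; rewrite coef_map coef_poly ltn_ord /= inord_val.
Qed.

(** A maximal independent family v in the finitely generated module puts the
    ring, up to a common denominator D, inside K[t, x]^m as a lattice. Such
    a lattice has a basis by [lattice_basis]. *)
Lemma free_basis : exists (x : A) m' (e : 'I_m'.+1 -> A),
  (forall V : 'I_m'.+1 -> {poly {poly K}}, \sum_i evp phi1 x (V i) * e i = 0 -> forall i, V i = 0)
  /\ forall a, spanned (evp phi1 x) e a.
Proof.
have [x [I [u hu]]] := noether; have tr := noether_transc hu.
set psi : {rmorphism _ -> _} := evp phi1 x in hu tr *.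
have psP : forall s, exists r, psi r = phi1 s := evp_phi1 x.
have psiC c : psi c%:P = phi1 c := evpC phi1 x c.
pose indep k (v : 'I_k -> A) := forall V : 'I_k -> {poly {poly K}},
  \sum_i psi (V i) * v i = 0 -> forall i, V i = 0.
pose Q k := `[< exists v : 'I_k -> A, indep k v >].
have Q1 : Q 1%N.
  apply/asboolP; exists (fun=> 1) => V; rewrite big_ord1 mulr1 => /tr V0 i.
  by rewrite ord1.
have Qub k : Q k -> (k <= #|I|)%N.
  move=> /asboolP[v hv]; rewrite leqNgt; apply/negP => Ik.
  have [V [i /eqP Vi] hV] := spanned_dependent psP Ik (fun i => hu (v i)).
  by apply: Vi; exact: hv.
have [m /asboolP[v hv] mmax] := @ex_maxnP Q #|I| (@ex_intro nat (fun k => Q k) 1%N Q1) Qub.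
have m0 : (0 < m)%N by exact: mmax.
have dep a : exists2 D, D != 0 & exists W : 'I_m -> {poly {poly K}}, psi D * a = \sum_i psi (W i) * v i.
  apply: contrapT => h; have /mmax : Q m.+1; last by rewrite ltnn.
  apply/asboolP; exists (fun i => if unlift ord0 i is Some j then v j else a) => V.
  rewrite big_ord_recl unlift_none => hV.
  have V0 : V ord0 = 0.
    apply: contrapT => /eqP V0; apply: h; exists (V ord0) => //.
    exists (fun j => - V (fintype.lift ord0 j)); apply/eqP; rewrite -subr_eq0 -sumrN; apply/eqP.
    rewrite -[RHS]hV; congr (_ + _); apply: eq_bigr => j _.
    by rewrite liftK rmorphN mulNr opprK.
  move=> i; have [j ->|->] := unliftP ord0 i; last by [].
  apply: (hv (fun j => V (fintype.lift ord0 j))); move: hV; rewrite V0 rmorph0 mul0r add0r => hV.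
  by rewrite -[RHS]hV; apply: eq_bigr => l _; rewrite liftK.
have /choice[D0 hD0] j : exists D, D != 0 /\ exists W : 'I_m -> {poly {poly K}}, psi D * u j = \sum_i psi (W i) * v i.
  by have [D D0 hW] := dep (u j); exists D.
pose D := \prod_j D0 j.
have DN0 : D != 0 by apply/prodf_neq0 => j _; case: (hD0 j).
have psiD a : spanned psi u a -> exists2 s, s != 0 &
    exists W : 'rV_m, psi (s%:P * D) * a = \sum_i psi (W 0 i) * v i.
  move=> [s s0 [V hV]]; exists s => //.
  have /choice[W hW] j : exists W : 'I_m -> {poly {poly K}}, psi D * u j = \sum_i psi (W i) * v i.
    have [_ [W hW]] := hD0 j; pose c := \prod_(l | l != j) D0 l.
    exists (fun i => c * W i); rewrite /D (bigD1 j) //= -/c mulrC rmorphM.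
    have -> : u j * (psi (D0 j) * psi c) = psi c * (psi (D0 j) * u j) by ring.
    by rewrite hW mulr_sumr; apply: eq_bigr => i _; rewrite rmorphM mulrA.
  exists (\row_i \sum_j V j * W j i).
  have -> : psi (s%:P * D) * a = psi D * (phi1 s * a).
    by rewrite rmorphM /= psiC; ring.
  rewrite hV mulr_sumr.
  transitivity (\sum_j \sum_i psi (V j * W j i) * v i).
    apply: eq_bigr => j _; rewrite mulrCA hW mulr_sumr; apply: eq_bigr => i _.
    by rewrite rmorphM mulrA.
  rewrite exchange_big; apply: eq_bigr => i _ /=.
  by rewrite mxE rmorph_sum mulr_suml.
pose N (W : 'rV[{poly {poly K}}]_m) := exists a s, s != 0 /\
  psi D * a = phi1 s * \sum_i psi (W 0 i) * v i.
have ND w1 w2 : N w1 -> N w2 -> N (w1 + w2).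
  move=> [a [s [s0 ha]]] [b [t [t0 hb]]].
  exists (phi1 t * a + phi1 s * b), (s * t); rewrite mulf_neq0 //; split => //.
  have -> : psi D * (phi1 t * a + phi1 s * b) = phi1 t * (psi D * a) + phi1 s * (psi D * b) by ring.
  have -> : \sum_i psi ((w1 + w2) 0 i) * v i = \sum_i psi (w1 0 i) * v i + \sum_i psi (w2 0 i) * v i.
    by rewrite -big_split; apply: eq_bigr => i _ /=; rewrite mxE rmorphD mulrDl.
  by rewrite ha hb rmorphM /=; ring.
have NZ c w : N w -> N (c *: w).
  move=> [a [s [s0 ha]]]; exists (psi c * a), s; split => //.
  rewrite mulrCA ha mulrCA; congr (_ * _); rewrite mulr_sumr.
  by apply: eq_bigr => i _; rewrite mxE rmorphM mulrA.
have Nfull : exists2 P : 'M_m, \det P != 0 & forall i, N (row i P).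
  exists D%:M; first by rewrite det_scalar expf_neq0.
  move=> i; exists (v i), 1; split; first exact: oner_neq0.
  rewrite rmorph1 mul1r (bigD1 i) //= !mxE eqxx big1 ?addr0 // => j ji.
  by rewrite !mxE eq_sym (negbTE ji) rmorph0 mul0r.
have [P [P0 hP latP]] := lattice_basis ND NZ Nfull.
have /choice[e /choice[s hs]] i : exists e s, s != 0 /\
    psi D * e = phi1 s * \sum_j psi (P i j) * v j.
  have [e [s [s0 E]]] := hP i; exists e, s; split => //; rewrite E; congr (_ * _).
  by apply: eq_bigr => j _; rewrite mxE.
have mulD_inj a b : psi D * a = psi D * b -> a = b.
  by apply: mulAI; apply: contra_neq DN0 => /tr.
have indep_e V : \sum_i psi (V i) * e i = 0 -> forall i, V i = 0.
  move=> hV; pose w := \row_i (V i * (s i)%:P).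
  have wP : w *m P = 0.
    apply/rowP => j; rewrite [RHS]mxE; move: j; apply: hv.
    transitivity (psi D * \sum_i psi (V i) * e i); last by rewrite hV mulr0.
    transitivity (\sum_j \sum_i psi (w 0 i * P i j) * v j).
      by apply: eq_bigr => j _; rewrite mxE rmorph_sum mulr_suml.
    rewrite exchange_big mulr_sumr; apply: eq_bigr => i _ /=.
    rewrite mulrCA (hs i).2 !mulr_sumr; apply: eq_bigr => j _.
    by rewrite !mxE !rmorphM /= psiC; ring.
  have w0 : w = 0.
    by apply: contraNeq P0 => w0; apply/det0P; exists w.
  move=> i; have /eqP := congr1 (fun w : 'rV_m => w 0 i) w0; rewrite !mxE mulf_eq0 polyC_eq0.
  by rewrite (negbTE (hs i).1) orbF => /eqP.
have span_e a : spanned psi e a.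
  have [t t0 [W hW]] := psiD a (hu a).
  have [|t' [q [t'0 hq]]] := latP W.
    exists (phi1 t * a), 1; split; first exact: oner_neq0.
    rewrite rmorph1 mul1r -hW rmorphM /= psiC /=; ring.
  pose S := \prod_i s i; pose c l := \prod_(i | i != l) s i.
  have S0 : S != 0 by apply/prodf_neq0 => l _; case: (hs l).
  exists (S * t' * t); first by rewrite !mulf_neq0.
  exists (fun l => (c l)%:P * q 0 l); apply: mulD_inj.
  transitivity (phi1 S * \sum_i psi ((t'%:P *: W) 0 i) * v i).
    transitivity (phi1 S * phi1 t' * (psi (t%:P * D) * a)).
      by rewrite !rmorphM /= psiC; ring.
    rewrite hW -mulrA; congr (_ * _); rewrite mulr_sumr; apply: eq_bigr => i _.
    by rewrite mxE rmorphM /= psiC mulrA.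
  rewrite hq mulr_sumr.
  transitivity (phi1 S * \sum_l psi (q 0 l) * \sum_i psi (P l i) * v i).
    rewrite mulr_sumr; under [RHS]eq_bigr do rewrite mulr_sumr mulr_sumr.
    rewrite exchange_big; apply: eq_bigr => i _ /=; rewrite mxE rmorph_sum mulr_suml mulr_sumr.
    by apply: eq_bigr => l _; rewrite rmorphM /=; ring.
  rewrite !mulr_sumr; apply: eq_bigr => l _; rewrite rmorphM /= psiC.
  have -> : phi1 S = phi1 (s l) * phi1 (c l) by rewrite -rmorphM /S (bigD1 l).
  have [_ E] := hs l; have -> : psi D * (phi1 (c l) * psi (q 0 l) * e l) = phi1 (c l) * psi (q 0 l) * (psi D * e l) by ring.
  by rewrite E; ring.
exists x; clear -m0 indep_e span_e; case: m m0 e indep_e span_e => // m' _ e h1 h2.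
by exists m', e.
Qed.

End DomainOverLine.

(** * Quotient rings and the trace form of a domain *)

Section QuotientRing.
Context {R : comNzRingType} (J : R -> Prop).
Hypotheses (J0 : J 0) (J1 : ~ J 1) (JD : forall a b, J a -> J b -> J (a + b))
  (JM : forall a b, J b -> J (a * b)).

Definition ideal_pred : R -> bool := fun a => `[< J a >].

Lemma ideal_pred_closed : idealr_closed ideal_pred.
Proof.
split=> [||a u v]; first exact/asboolP.
  by apply/negP => /asboolP.
by move=> /asboolP hu /asboolP hv; apply/asboolP; apply: (JD) => //; exact: (JM).
Qed.

HB.instance Definition _ := isIdealr.Build R ideal_pred ideal_pred_closed.

Let I : idealr R := Idealr.clone R ideal_pred _.

Lemma quotient_ring : exists (A : comNzRingType) (pi : {rmorphism R -> A}),
  (forall a, exists g, pi g = a) /\ forall g, pi g = 0 <-> J g.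
Proof.
exists {ideal_quot I}, (GRing.RMorphism.clone _ _ (\pi_({ideal_quot I})%qT) _).
split=> [a|g] /=; first by exists (repr a); rewrite reprK.
have E := Quotient.idealrBE I g 0; rewrite subr0 in E.
rewrite -(rmorph0 (\pi_({ideal_quot I})%qT)); split=> [e|Jg].
  by apply/asboolP; move: E; rewrite (introT eqP e).
by apply/eqP; rewrite -E; exact/asboolP.
Qed.

End QuotientRing.

(** If a is orthogonal to everything for the trace form, then all positive
    powers of the matrix of a multiple of a have trace zero. The trace of
    its Cayley-Hamilton relation is then m times the determinant, up to
    sign, so in characteristic zero the determinant vanishes; but in a
    domain multiplication by a nonzero element is injective. *)
Section TraceForm.
Context {B : idomainType} {A : comNzRingType} {m' : nat}.
Local Notation m := m'.+1.
Hypothesis domA : forall a b : A, a * b = 0 -> a = 0 \/ b = 0.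
Variables (psi : {rmorphism B -> A}) (e : 'I_m -> A).
Hypothesis indep : forall V, \sum_i psi (V i) * e i = 0 -> forall i, V i = 0.
Hypothesis span : forall a, exists2 s, s != 0 & exists V, psi s * a = \sum_i psi (V i) * e i.

Lemma indep_eq V W : \sum_i psi (V i) * e i = \sum_i psi (W i) * e i -> V =1 W.
Proof.
move=> E i; apply/eqP; rewrite -subr_eq0; apply/eqP.
move: i; apply: (@indep (fun i => V i - W i)).
transitivity (\sum_i psi (V i) * e i - \sum_i psi (W i) * e i); last by rewrite E subrr.
by rewrite -sumrB; apply: eq_bigr => i _; rewrite rmorphB mulrBl.
Qed.

(** Row k holds the coordinates of c e_k, which is the transpose of the
    convention of [Mx]. *)
Definition matrix_of c (N : 'M[B]_m) := forall k, c * e k = \sum_l psi (N k l) * e l.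

Lemma matrix_ofM c d N N' : matrix_of c N -> matrix_of d N' -> matrix_of (c * d) (N' *m N).
Proof.
move=> h h' k; rewrite -mulrA h' mulr_sumr.
transitivity (\sum_l psi (N' k l) * \sum_j psi (N l j) * e j).
  by apply: eq_bigr => l _; rewrite mulrCA h.
under eq_bigr do rewrite mulr_sumr; rewrite exchange_big; apply: eq_bigr => j _ /=.
rewrite mxE rmorph_sum mulr_suml; apply: eq_bigr => l _.
by rewrite rmorphM mulrA.
Qed.

Lemma matrix_ofX c N k : matrix_of c N -> matrix_of (c ^+ k) (N ^+ k).
Proof.
move=> h; elim: k => [|k IH]; last first.
  by rewrite exprSr exprS; exact: (matrix_ofM IH h).
move=> i; rewrite mul1r (bigD1 i) //= !mxE eqxx rmorph1 mul1r big1 ?addr0 // => j ji.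
by rewrite !mxE eq_sym (negbTE ji) rmorph0 mul0r.
Qed.

Lemma matrix_of_scaled a : exists2 s, s != 0 & exists N, matrix_of (psi s * a) N.
Proof.
have /choice[s /choice[V hV]] k : exists s V, s != 0 /\ psi s * (a * e k) = \sum_i psi (V i) * e i.
  by have [s s0 [V hV]] := span (a * e k); exists s, V.
exists (\prod_k s k); first by apply/prodf_neq0 => k _; case: (hV k).
exists (\matrix_(k, l) ((\prod_(j | j != k) s j) * V k l)) => k.
rewrite (bigD1 k) //= mulrC rmorphM mulrA.
transitivity (psi (\prod_(j | j != k) s j) * (psi (s k) * (a * e k))); first by ring.
rewrite (hV k).2 mulr_sumr; apply: eq_bigr => l _; rewrite mxE rmorphM mulrA //.
Qed.

Variables (gam : B) (T : 'I_m -> 'I_m -> 'M[B]_m).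
Hypothesis gam0 : gam != 0.
Hypothesis hT : forall i j, matrix_of (psi gam * (e i * e j)) (T i j).
Hypothesis m_neq0 : m%:R != 0 :> B.

Lemma trace_form_nondegenerate : \det (\matrix_(i, j) \tr (T i j)) != 0.
Proof.
set G := \matrix_(i, j) _; apply/negP => /det0P[v v0 vG].
pose a := \sum_i psi (v 0 i) * e i.
have a0 : a <> 0.
  by move/indep => h; case/eqP: v0; apply/rowP => i; rewrite mxE h.
have [s s0 [N hN]] := matrix_of_scaled a; set b := psi s * a in hN.
have psi0 c : c != 0 -> psi c <> 0.
  move=> c0 pc; have := @indep (fun=> c); rewrite big1 => [/(_ erefl ord0)/eqP|i _].
    by rewrite (negbTE c0).
  by rewrite pc mul0r.
have trN c Nc : matrix_of c Nc -> \tr (Nc *m N) = 0.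
  move=> hc; have [sig sig0 [U hU]] := span c.
  have hbc := matrix_ofM hN hc.
  have E k l : gam * sig * (Nc *m N) k l = s * \sum_i \sum_j v 0 i * U j * T i j k l.
    move: l; apply: indep_eq.
    transitivity (psi (gam * sig) * (b * c * e k)).
      rewrite hbc mulr_sumr; apply: eq_bigr => l _; rewrite rmorphM mulrA //.
    transitivity (psi s * psi gam * (a * (psi sig * c) * e k)).
      by rewrite rmorphM /b /=; ring.
    transitivity (psi s * \sum_i \sum_j psi (v 0 i * U j) * (psi gam * (e i * e j) * e k)).
      rewrite hU -!mulrA; congr (_ * _).
      rewrite [in LHS]/a mulr_suml mulr_sumr; apply: eq_bigr => i _.
      rewrite mulr_suml !mulr_sumr; apply: eq_bigr => j _.
      by rewrite rmorphM /=; ring.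
    under eq_bigr do under eq_bigr do rewrite hT mulr_sumr.
    under eq_bigr do rewrite exchange_big; rewrite exchange_big mulr_sumr.
    apply: eq_bigr => l _ /=; rewrite rmorphM -mulrA; congr (_ * _).
    rewrite rmorph_sum mulr_suml; apply: eq_bigr => i _.
    rewrite rmorph_sum mulr_suml; apply: eq_bigr => j _.
    by rewrite [in RHS]rmorphM mulrA.
  have : gam * sig * \tr (Nc *m N) = 0.
    rewrite /mxtrace mulr_sumr; under eq_bigr do rewrite E.
    rewrite -mulr_sumr exchange_big /=.
    under eq_bigr do rewrite exchange_big /=.
    rewrite exchange_big big1 ?mulr0 // => j _.
    transitivity ((\sum_i v 0 i * G i j) * U j).
      rewrite mulr_suml; apply: eq_bigr => i _; rewrite -mulr_sumr /G mxE /mxtrace; ring.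
    by have := congr1 (fun w : 'rV_m => w 0 j) vG; rewrite !mxE => ->; rewrite mul0r.
  by move/eqP; rewrite !mulf_eq0 (negbTE gam0) (negbTE sig0) => /eqP.
have detN : \det N = 0.
  have /(congr1 mxtrace) := Cayley_Hamilton N; rewrite mxtrace0.
  rewrite /horner_mx /horner_morph /= (horner_coef_wide _ (_ : (size _ <= (size (char_poly N)).+1)%N)); last first.
    by apply: leqW; exact: size_poly.
  rewrite raddf_sum big_ord_recl big1 => [|i _].
    rewrite expr0 mulr1 addr0 coef_map /= mxtrace_scalar char_poly_det => /eqP.
    rewrite -mulr_natr mulf_eq0 (negbTE m_neq0) orbF mulf_eq0 signr_eq0 => /eqP //.
  rewrite coef_map /= -mulmxE mul_scalar_mx mxtraceZ /bump /= add1n exprSr -mulmxE.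
  by rewrite (trN (b ^+ i)) ?mulr0 //; exact: matrix_ofX.
have /eqP/det0P[w w0 wN] := detN.
have bw : b * \sum_k psi (w 0 k) * e k = 0.
  transitivity (\sum_l psi ((w *m N) 0 l) * e l); last first.
    by rewrite wN big1 // => l _; rewrite mxE rmorph0 mul0r.
  rewrite mulr_sumr; transitivity (\sum_k \sum_l psi (w 0 k * N k l) * e l).
    apply: eq_bigr => k _; rewrite mulrCA hN mulr_sumr; apply: eq_bigr => l _.
    by rewrite rmorphM mulrA.
  by rewrite exchange_big; apply: eq_bigr => l _ /=; rewrite mxE rmorph_sum mulr_suml.
have [/domA[]|/indep h] := domA bw; first exact: psi0.
  exact: a0.
by case/eqP: w0; apply/rowP => i; rewrite mxE h.
Qed.

End TraceForm.

(** * Specialisation of the parameter *)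

Lemma rmorph_expD (R S : comNzRingType) (h : {rmorphism R -> S}) u v a b :
  h (u ^+ (a + b) * v) = h (u ^+ a) * h (u ^+ b * v).
Proof. by rewrite -rmorphM mulrA -exprD. Qed.

Lemma rmorph_mulA (R S : comNzRingType) (h : {rmorphism R -> S}) a b c :
  h (a * (b * c)) = h (a * b) * h c.
Proof. by rewrite mulrA rmorphM. Qed.

(** The coordinate ring A of the surface is a quotient of the ring of
    polynomials, by pi; el and xx are polynomials that represent a basis of
    A over K[t, x] and the function x, and p represents t. The equation numE
    writes g(t)^(ex P) P in this basis with coordinates num P. On the fibre
    over a point y with g(y) nonzero, this equation can be divided by
    g(y)^(ex P). *)
Section Specialization.
Context {K : numClosedFieldType} {n m' : nat} {A : comNzRingType}.
Local Notation m := m'.+1.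
Variables (pi : {rmorphism {mpoly K[n]} -> A}).
Variables (p xx : {mpoly K[n]}) (el : 'I_m -> {mpoly K[n]}) (g : {poly K}).
Local Notation phi := (evp (@mpolyC n K) p).
Local Notation Psi := (evp phi xx).
Hypothesis indep : forall V, pi (\sum_i Psi (V i) * el i) = 0 -> forall i, V i = 0.
Variables (ex : {mpoly K[n]} -> nat) (num : {mpoly K[n]} -> 'I_m -> {poly {poly K}}).
Hypothesis numE : forall P, pi (phi g ^+ ex P * P) = pi (\sum_i Psi (num P i) * el i).

Lemma Psi_C c : Psi c%:P = phi c. Proof. exact: evpC. Qed.

Lemma relation_unique V W :
  pi (\sum_i Psi (V i) * el i) = pi (\sum_i Psi (W i) * el i) -> V =1 W.
Proof.
move=> E i; apply/eqP; rewrite -subr_eq0; apply/eqP.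
move: i; apply: (@indep (fun i => V i - W i)).
transitivity (pi (\sum_i Psi (V i) * el i) - pi (\sum_i Psi (W i) * el i)); last by rewrite E subrr.
rewrite -rmorphB; congr (pi _).
by rewrite -sumrB; apply: eq_bigr => i _; rewrite rmorphB mulrBl.
Qed.

Section Fibre.
Variable y : K.
Hypothesis gy0 : g.[y] != 0.

Definition spec : {poly {poly K}} -> {poly K} := map_poly (horner_eval y).
HB.instance Definition _ := GRing.RMorphism.on spec.

Lemma spec_C c : spec c%:P = c.[y]%:P. Proof. by rewrite /spec map_polyC. Qed.

(** The coordinates of P on the fibre over y. *)
Definition cof P i : {poly K} := g.[y] ^- ex P *: spec (num P i).

Lemma spec_num P i : spec (num P i) = (g.[y] ^+ ex P)%:P * cof P i.
Proof. by rewrite /cof mul_polyC scalerA divff ?scale1r // expf_neq0. Qed.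

(** The coordinates on the fibre do not depend on the chosen relation
    between P and the basis, by independence of the basis over K[t, x]. *)
Lemma cof_rel G P V : pi (Psi G * P) = pi (\sum_i Psi (V i) * el i) ->
  forall i, spec G * cof P i = spec (V i).
Proof.
move=> E i; have /(congr1 spec) : G * num P i = (g ^+ ex P)%:P * V i.
  move: i; apply: relation_unique.
  transitivity (pi (Psi G * (phi g ^+ ex P * P))).
    rewrite rmorphM numE -rmorphM; congr (pi _); rewrite mulr_sumr.
    by apply: eq_bigr => i _; rewrite rmorphM mulrA.
  transitivity (pi (Psi (g ^+ ex P)%:P) * pi (Psi G * P)).
    by rewrite -!rmorphM Psi_C rmorphXn; congr (pi _); rewrite /=; ring.
  rewrite E -rmorphM; congr (pi _); rewrite mulr_sumr.
  by apply: eq_bigr => i _; rewrite rmorphM mulrA.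
rewrite !rmorphM /= spec_C hornerE spec_num mulrCA => /mulfI; apply.
by rewrite polyC_eq0 expf_neq0.
Qed.

Lemma cof_cong P Q i : pi P = pi Q -> cof P i = cof Q i.
Proof.
move=> E; have := @cof_rel (g ^+ ex Q)%:P P (num Q).
rewrite Psi_C rmorphXn => /(_ _ i); rewrite spec_num spec_C hornerE => H.
apply: (mulfI _ (H _)); first by rewrite polyC_eq0 expf_neq0.
by rewrite rmorphM E -rmorphM numE.
Qed.

Lemma cofD P Q i : cof (P + Q) i = cof P i + cof Q i.
Proof.
have := @cof_rel (g ^+ (ex P + ex Q))%:P (P + Q)
  (fun i => (g ^+ ex Q)%:P * num P i + (g ^+ ex P)%:P * num Q i).
move=> /(_ _ i); rewrite rmorphD !rmorphM /= !spec_num !spec_C !hornerE => H.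
apply: (mulfI _ (_ : (g.[y] ^+ (ex P + ex Q))%:P * _ = _)).
  by rewrite polyC_eq0 expf_neq0.
rewrite H; first by rewrite exprD polyCM /=; ring.
transitivity (pi (phi g ^+ ex Q) * pi (phi g ^+ ex P * P) + pi (phi g ^+ ex P) * pi (phi g ^+ ex Q * Q)).
  rewrite -!rmorphM -rmorphD; congr (pi _); rewrite Psi_C rmorphXn /= exprD; ring.
rewrite !numE -!rmorphM -rmorphD; congr (pi _); rewrite !mulr_sumr -big_split.
apply: eq_bigr => i' _ /=; rewrite rmorphD !rmorphM /= !Psi_C !rmorphXn /=; ring.
Qed.

Lemma cof_Psi V i : cof (\sum_i Psi (V i) * el i) i = spec (V i).
Proof.
rewrite -[LHS]mul1r -(rmorph1 spec); apply: (cof_rel _ i).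
by rewrite rmorph1 mul1r.
Qed.

Lemma cof0 i : cof 0 i = 0.
Proof. by apply: (addrI (cof 0 i)); rewrite -cofD !addr0. Qed.

Lemma cofN P i : cof (- P) i = - cof P i.
Proof. by apply/eqP; rewrite -addr_eq0 -cofD addNr cof0. Qed.

Lemma cofPsiM G P i : cof (Psi G * P) i = spec G * cof P i.
Proof.
have g0 : (g.[y] ^+ ex P)%:P != 0 by rewrite polyC_eq0 expf_neq0.
apply: (mulfI g0); rewrite mulrCA -spec_num -(rmorphM spec).
rewrite -horner_exp -spec_C; apply: (cof_rel (V := fun i => G * num P i)).
transitivity (pi (Psi G) * pi (phi g ^+ ex P * P)).
  by rewrite -rmorphM Psi_C rmorphXn /=; congr (pi _); ring.
rewrite numE -rmorphM mulr_sumr; congr (pi _); apply: eq_bigr => j _.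
by rewrite rmorphM mulrA.
Qed.

Lemma cof_sum (J : Type) (s : seq J) (Q : pred J) (F : J -> {mpoly K[n]}) i :
  cof (\sum_(j <- s | Q j) F j) i = \sum_(j <- s | Q j) cof (F j) i.
Proof. by apply: (big_morph (fun P => cof P i)) => [P1 P2|]; rewrite ?cofD ?cof0. Qed.

(** Multiplication by Q is linear over K[t, x], hence determined on the
    fibre by its values on the basis. *)
Lemma cofM P Q i : cof (Q * P) i = \sum_j cof P j * cof (Q * el j) i.
Proof.
have H : (g.[y] ^+ ex P)%:P * cof (Q * P) i = \sum_j spec (num P j) * cof (Q * el j) i.
  rewrite (_ : _%:P = spec (g ^+ ex P)%:P); last by rewrite spec_C hornerE.
  rewrite -cofPsiM Psi_C rmorphXn /=.
  rewrite (cof_cong (Q := \sum_j Psi (num P j) * (Q * el j))).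
    by rewrite cof_sum; apply: eq_bigr => j _; rewrite cofPsiM.
  transitivity (pi Q * pi (phi g ^+ ex P * P)); first by rewrite -rmorphM; congr (pi _); ring.
  rewrite numE -rmorphM mulr_sumr; congr (pi _); apply: eq_bigr => j _; ring.
apply: (mulfI _ (_ : (g.[y] ^+ ex P)%:P * _ = _)); first by rewrite polyC_eq0 expf_neq0.
by rewrite H mulr_sumr; apply: eq_bigr => j _; rewrite spec_num mulrA.
Qed.

Lemma cof_el j i : cof (el j) i = (j == i)%:R.
Proof.
rewrite (_ : el j = \sum_i Psi ((j == i)%:R) * el i).
  by rewrite (cof_Psi (fun i => (j == i)%:R)) rmorph_nat.
rewrite (bigD1 j) //= eqxx rmorph1 mul1r big1 ?addr0 // => k /negbTE ki.
by rewrite eq_sym ki rmorph0 mul0r.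
Qed.

(** Polynomials in x as polynomials in x over K[t] that are constant in t. *)
Definition const_param (c : {poly K}) : {poly {poly K}} := map_poly polyC c.

Lemma Psi_const_param c : Psi (const_param c) = lift xx c.
Proof.
rewrite /const_param; elim/poly_ind: c => [|c d IH]; first by rewrite !rmorph0.
rewrite !rmorphD !rmorphM /= map_polyX map_polyC /= IH liftX liftC; congr (_ * _ + _).
  exact: evpX.
by rewrite Psi_C; exact: evpC.
Qed.

Lemma spec_const_param c : spec (const_param c) = c.
Proof. by apply/polyP => i; rewrite !coef_map /= /horner_eval hornerC. Qed.

Lemma cof_lift V i : cof (\sum_i lift xx (V i) * el i) i = V i.
Proof.
under eq_bigr do rewrite -Psi_const_param.
by rewrite (cof_Psi (fun i => const_param (V i))) spec_const_param.
Qed.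

Lemma cof_liftM c P i : cof (lift xx c * P) i = c * cof P i.
Proof. by rewrite -Psi_const_param cofPsiM spec_const_param. Qed.

Lemma cofZ c P i : cof (c *: P) i = c *: cof P i.
Proof. by rewrite -mul_mpolyC -(liftC xx) cof_liftM mul_polyC. Qed.

(** The ideal of the fibre, defined as the kernel of the coordinates; it
    contains p - y and the kernel of pi. *)
Definition fibre_ideal (P : {mpoly K[n]}) : Prop := forall i, cof P i = 0.

Lemma fibre_ideal1 : ~ fibre_ideal 1.
Proof.
move=> h; have := cof_el ord0 ord0; rewrite eqxx -[el ord0]mulr1 cofM big1.
  by move/esym/eqP; rewrite oner_eq0.
by move=> i _; rewrite h mul0r.
Qed.

Lemma fibre_idealM Q P : fibre_ideal P -> fibre_ideal (Q * P).
Proof. by move=> h i; rewrite cofM big1 // => j _; rewrite h mul0r. Qed.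

Lemma fibre_idealD P Q : fibre_ideal P -> fibre_ideal Q -> fibre_ideal (P + Q).
Proof. by move=> h h' i; rewrite cofD h h' addr0. Qed.

Lemma fibre_is_ideal : is_ideal fibre_ideal.
Proof. by split; [move=> i; rewrite cof0|exact: fibre_idealD|exact: fibre_idealM]. Qed.

Lemma kernel_sub_fibre_ideal P : pi P = 0 -> fibre_ideal P.
Proof. by move=> h i; rewrite (cof_cong (Q := 0)) ?cof0 // h rmorph0. Qed.

Lemma fibre_ideal_param : fibre_ideal (p - y%:MP).
Proof.
move=> i; have -> : p - y%:MP = Psi ('X - y%:P)%:P * 1.
  by rewrite mulr1 Psi_C rmorphB /= evpC evpX.
by rewrite cofPsiM spec_C !hornerE subrr polyC0 mul0r.
Qed.

(** At a point of the fibre the relation numE reads g(y)^(ex P) P = 0 when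
    the coordinates of P on the fibre vanish. *)
Lemma fibre_ideal_vanishes P x : fibre_ideal P -> (forall Q, pi Q = 0 -> Q.@[x] = 0) -> p.@[x] = y -> P.@[x] = 0.
Proof.
move=> hP hx px.
have phix c : (phi c).@[x] = c.[y].
  elim/poly_ind: c => [|c d IH]; first by rewrite rmorph0 meval0 horner0.
  by rewrite rmorphD rmorphM /= evpX evpC mevalD mevalM mevalC IH px !hornerE.
have Psix G : spec G = 0 -> (Psi G).@[x] = 0.
  move=> G0; suff -> : (Psi G).@[x] = (spec G).[xx.@[x]] by rewrite G0 horner0.
  elim/poly_ind: G {G0} => [|G c IH]; first by rewrite !rmorph0 horner0.
  rewrite (rmorphD Psi) (rmorphM Psi) (rmorphD spec) (rmorphM spec) /= mevalD mevalM IH evpX Psi_C phix spec_C /spec map_polyX.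
  by rewrite hornerD hornerMX hornerC.
have /hx : pi (phi g ^+ ex P * P - \sum_i Psi (num P i) * el i) = 0.
  by rewrite rmorphB numE subrr.
have S0 : (\sum_i Psi (num P i) * el i).@[x] = 0.
  rewrite (raddf_sum (meval x)) big1 // => i _ /=.
  by rewrite mevalM Psix ?mul0r // spec_num hP mulr0.
rewrite mevalB mevalM S0 subr0 (rmorphXn (meval x)) /= phix => /eqP.
by rewrite mulf_eq0 expf_eq0 (negbTE gy0) andbF => /eqP.
Qed.

Definition num_size P := (\max_i size (num P i))%N.

Lemma size_cof P i : (size (cof P i) <= num_size P)%N.
Proof.
apply: leq_trans (size_scale_leq _ _) _; apply: leq_trans (size_poly _ _) _.
exact: (leq_bigmax i).
Qed.

Lemma dg_cof P i k : (num_size P <= k)%N -> dg (cof P i) k%:R.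
Proof.
move=> Pk; apply: (dgW _ (@dg_size _ _)); rewrite ler_nat.
apply: leq_trans Pk; apply: leq_trans (leq_pred _) (size_cof P i).
Qed.

Section FibreAlgebra.
Context {Ay : comNzRingType} (piy : {rmorphism {mpoly K[n]} -> Ay}) (rp : Ay -> {mpoly K[n]}).
Hypothesis rpK : forall a, piy (rp a) = a.
Hypothesis piy0 : forall P, piy P = 0 <-> fibre_ideal P.

Definition fibre_co (a : Ay) i := cof (rp a) i.
Let fibre_iota : {rmorphism {poly K} -> Ay} := GRing.RMorphism.clone _ _ (piy \o lift xx) _.
Let fibre_e i := piy (el i).

Lemma fibre_co_pi P i : fibre_co (piy P) i = cof P i.
Proof.
apply/eqP; rewrite -subr_eq0 /fibre_co -cofN -cofD; apply/eqP.
by move: i; apply/piy0; rewrite rmorphB rpK subrr.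
Qed.

Lemma fibre_coK a : a = \sum_i fibre_iota (fibre_co a i) * fibre_e i.
Proof.
rewrite -[LHS]rpK; apply/eqP; rewrite -subr_eq0; apply/eqP.
transitivity (piy (rp a - \sum_i lift xx (fibre_co a i) * el i)).
  by rewrite rmorphB rmorph_sum; congr (_ - _); apply: eq_bigr => i _; rewrite rmorphM.
by apply/piy0 => i; rewrite cofD cofN cof_lift subrr.
Qed.

Lemma fibre_coE P i : fibre_co (\sum_j fibre_iota (P j) * fibre_e j) i = P i.
Proof.
rewrite -[RHS](cof_lift P) -fibre_co_pi; congr (fibre_co _ _).
by rewrite rmorph_sum; apply: eq_bigr => j _; rewrite rmorphM.
Qed.

Definition trace_ex := (\sum_i \sum_j \sum_k ex (el i * el j * el k)%R)%N.
(** The matrix of multiplication by e_i e_j over K[t, x], multiplied by the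
    common denominator g^trace_ex. *)
Definition trace_num i j : 'M[{poly {poly K}}]_m :=
  \matrix_(k, l) ((g ^+ (trace_ex - ex (el i * el j * el k)))%:P * num (el i * el j * el k) l).
Definition gram_num : 'M[{poly {poly K}}]_m := \matrix_(i, j) \tr (trace_num i j).

Lemma trace_ex_ge i j k : (ex (el i * el j * el k)%R <= trace_ex)%N.
Proof.
rewrite /trace_ex (bigD1 i) //= (bigD1 j) //= (bigD1 k) //=.
by rewrite -!addnA leq_addr.
Qed.

Lemma trace_num_matrix i j : @matrix_of _ _ _ (pi \o Psi) (pi \o el) (pi (Psi (g ^+ trace_ex)%:P) * (pi (el i) * pi (el j))) (trace_num i j).
Proof.
move=> k; set Q := el i * el j * el k; pose c := (trace_ex - ex Q)%N.
have Ec : trace_ex = (c + ex Q)%N by rewrite subnK // trace_ex_ge.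
have E S : pi (phi g ^+ trace_ex * S) = pi (phi g ^+ c) * pi (phi g ^+ ex Q * S).
  by rewrite Ec; exact: rmorph_expD.
have -> : pi (Psi (g ^+ trace_ex)%:P) * (pi (el i) * pi (el j)) * (pi \o el) k = pi (phi g ^+ trace_ex * Q).
  rewrite Psi_C (rmorphXn phi) (rmorphM pi) /= -mulrA; congr (_ * _).
  by rewrite /Q (rmorphM pi _ (el k)) (rmorphM pi (el i)).
rewrite E numE -(rmorphM pi) mulr_sumr (rmorph_sum pi); apply: eq_bigr => l _ /=.
rewrite mxE -/Q -/c (rmorphM Psi) /= Psi_C (rmorphXn phi) /=.
exact: rmorph_mulA.
Qed.

Lemma disc_spec : spec (\det gram_num) = ((g.[y] ^+ trace_ex) ^+ m)%:P * disc fibre_co fibre_e.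
Proof.
rewrite -det_map_mx polyC_exp -detZ; congr (\det _); apply/matrixP => i j.
rewrite !mxE raddf_sum mulr_sumr; apply: eq_bigr => k _ /=.
rewrite !mxE rmorphM /= spec_num spec_C horner_exp mulrA -polyCM -exprD subnK ?trace_ex_ge //.
by rewrite /fibre_e -!(rmorphM piy) fibre_co_pi.
Qed.

(** A single bound for the degrees of all the constants that the estimates
    on the fibre depend on; it does not depend on y. *)
Definition fibre_bound : nat := (\sum_i \sum_j num_size (el i * el j)%R + num_size 1%R + \sum_j num_size 'X_j
  + \sum_k num_size (mderiv k xx) + \sum_i \sum_k num_size (mderiv k (el i)))%N.
Definition lift_bound : nat := (msize xx + \sum_i msize (el i))%N.
Local Notation kap := (fibre_bound%:R : rat).

Lemma co_ee i j k : dg (fibre_co (fibre_e i * fibre_e j) k) kap.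
Proof.
rewrite -rmorphM fibre_co_pi; apply: dg_cof.
by rewrite /fibre_bound (bigD1 i) //= (bigD1 j) //= -!addnA leq_addr.
Qed.

Lemma co_1 k : dg (fibre_co 1 k) kap.
Proof.
rewrite -(rmorph1 piy) fibre_co_pi; apply: dg_cof; rewrite /fibre_bound -!addnA.
by apply: leq_trans (leq_addl _ _); exact: leq_addr.
Qed.

Lemma pi_X j : adeg fibre_co (piy 'X_j) kap.
Proof.
move=> i; rewrite fibre_co_pi; apply: dg_cof; rewrite /fibre_bound -!addnA addnCA addnC -!addnA.
by rewrite addnCA (bigD1 j) //= -!addnA leq_addr.
Qed.

Lemma pi_dxx k : adeg fibre_co (piy (mderiv k xx)) kap.
Proof.
move=> i; rewrite fibre_co_pi; apply: dg_cof; rewrite /fibre_bound -addnA addnC -addnA.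
by rewrite (bigD1 k) //= -!addnA leq_addr.
Qed.

Lemma pi_del j k : adeg fibre_co (piy (mderiv k (el j))) kap.
Proof.
move=> i; rewrite fibre_co_pi; apply: dg_cof; rewrite /fibre_bound addnC.
by rewrite (bigD1 j) //= (bigD1 k) //= -!addnA leq_addr.
Qed.

Lemma xx_size : (msize xx <= lift_bound)%N. Proof. exact: leq_addr. Qed.

Lemma el_size i : (msize (el i) <= lift_bound)%N.
Proof. by rewrite /lift_bound (bigD1 i) //=; lia. Qed.

Hypothesis disc0 : disc fibre_co fibre_e != 0.

(** The fibre algebra has a nonzero discriminant, so it has no nilpotents. *)
Lemma fibre_ideal_reduced P k : fibre_ideal (P ^+ k) -> fibre_ideal P.
Proof.
move=> h; apply/piy0; apply: (nilp0 fibre_coK fibre_coE disc0 co_ee co_1 (n := k)).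
by rewrite -rmorphXn; apply/piy0.
Qed.

Local Notation D := (nbound (@kcoh m' kap)).
Local Notation msz := (@msz_prim m' kap lift_bound D%:R).

Local Notation coef_index L := ('I_L * 'I_m * 'I_n)%type.

(** The forms x^d e_j dX_k with d bounded, which generate H1 of the fibre by
    [dvec_coker]. *)
Definition basis_form (b : 'I_#|{: coef_index D}|) : @Defs.form K n :=
  [ffun k => if k == (enum_val b).2 then xx ^+ (enum_val b).1.1 * el (enum_val b).1.2 else 0].

Definition mon_size : nat := (\max_(w : 'X_{1..n < msz}) \max_k num_size (mderiv k 'X_[w]))%N.
Definition rel_ex : nat := (\sum_(w : 'X_{1..n < msz}) \sum_k ex (mderiv k 'X_[w]))%N.

Definition dmon (a : 'I_#|{: 'X_{1..n < msz}}|) k : {mpoly K[n]} := mderiv k 'X_[enum_val a].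

(** The coordinates of degree off <= d < off + L of the differentials of
    monomials, over K[t], multiplied by the common denominator g^rel_ex;
    [fibre_mx] is the value at y without that denominator. *)
Definition rel_mx off L : 'M[{poly K}]_(#|{: 'X_{1..n < msz}}|, #|{: coef_index L}|) :=
  \matrix_(a < _, b < #|{: coef_index L}|) (g ^+ (rel_ex - ex (dmon a (enum_val b).2)) *
    (num (dmon a (enum_val b).2) (enum_val b).1.2)`_(off + (enum_val b).1.1)%N).

Definition fibre_mx off L : 'M[K]_(#|{: 'X_{1..n < msz}}|, #|{: coef_index L}|) :=
  \matrix_(a < _, b < #|{: coef_index L}|) (cof (dmon a (enum_val b).2) (enum_val b).1.2)`_(off + (enum_val b).1.1)%N.

Lemma rel_mx_spec off L : map_mx (horner_eval y) (rel_mx off L) = g.[y] ^+ rel_ex *: fibre_mx off L.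
Proof.
apply/matrixP => a b; rewrite !mxE /horner_eval hornerM horner_exp.
set P := dmon _ _; set j := (enum_val b).1.2.
have -> : ((num P j)`_(off + (enum_val b).1.1)%N).[y] = (spec (num P j))`_(off + (enum_val b).1.1)%N.
  by rewrite coef_map.
rewrite spec_num coefCM mulrA -exprD subnK //.
by rewrite /rel_ex (bigD1 (enum_val a)) //= (bigD1 (enum_val b).2) //= -addnA leq_addr.
Qed.

Lemma cof_basis_form (c : 'rV_#|{: coef_index D}|) k j :
  cof ((\sum_b c 0 b *: basis_form b) k) j = \sum_(d < D) c 0 (enum_rank (d, j, k)) *: 'X^d.
Proof.
rewrite sum_ffunE cof_sum.
transitivity (\sum_(b : coef_index D) cof ((c 0 (enum_rank b) *: basis_form (enum_rank b)) k) j).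
  rewrite [RHS](reindex_onto enum_val enum_rank) => [|b _]; last by rewrite enum_rankK.
  by apply: eq_big => b; rewrite enum_valK ?eqxx.
transitivity (\sum_d \sum_j' \sum_k' cof ((c 0 (enum_rank (d, j', k')) *: basis_form (enum_rank (d, j', k'))) k) j).
  by rewrite pair_bigA pair_bigA /=; apply: eq_bigr => -[[d j'] k'].
apply: eq_bigr => d _.
have E j' k' : cof ((c 0 (enum_rank (d, j', k')) *: basis_form (enum_rank (d, j', k'))) k) j =
    if (j' == j) && (k == k') then c 0 (enum_rank (d, j', k')) *: 'X^d else 0.
  rewrite !ffunE enum_rankK /=; case: (k == k'); last by rewrite andbF scaler0 cof0.
  rewrite cofZ andbT -(liftX xx) -rmorphXn cof_liftM cof_el.
  by case: (j' == j); rewrite ?mulr1 ?mulr0 ?scaler0.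
rewrite (bigD1 j) //= (bigD1 k) //= E !eqxx /= big1 => [|k' kk]; last first.
  by rewrite E eq_sym (negbTE kk) andbF.
rewrite big1 ?addr0 // => j' jj; rewrite big1 // => k' _.
by rewrite E (negbTE jj).
Qed.

Lemma coef_basis_sum (c : 'I_D -> K) i :
  (\sum_(d < D) c d *: 'X^d)`_i = if insub i is Some d then c d else 0.
Proof.
rewrite coef_sum; case: insubP => [d _ <-|iD].
  rewrite (bigD1 d) //= coefZ coefXn eqxx mulr1 big1 ?addr0 // => l ld.
  by rewrite coefZ coefXn; have := negbTE ld; rewrite -val_eqE eq_sym => /= ->; rewrite mulr0.
rewrite big1 // => d _; rewrite coefZ coefXn; case: eqP => [E|_]; last by rewrite mulr0.
by rewrite E ltn_ord in iD.
Qed.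

Lemma cof_deriv_mon (u : 'rV_#|{: 'X_{1..n < msz}}|) k j :
  cof (mderiv k (\sum_a u 0 a *: 'X_[enum_val a])) j = \sum_a u 0 a *: cof (dmon a k) j.
Proof.
rewrite raddf_sum cof_sum; apply: eq_bigr => a _ /=.
by rewrite mderivZ cofZ.
Qed.

Variable Z : set ('I_n -> K).
Hypothesis idealZ : forall P, vanishing_ideal Z P <-> fibre_ideal P.

(** By [dvec_coker] the basic forms generate H1, and by [dvec_primitive] a
    combination of them is exact if and only if it is the differential of a
    combination of monomials of bounded degree. The second block of the
    matrix collects the coordinates of degree at least D of these
    differentials, which must vanish. *)
Theorem fibre_cohomology : has_dim (H1 Z) (#|{: coef_index D}| -
  (\rank (row_mx (fibre_mx 0 D) (fibre_mx D mon_size)) - \rank (fibre_mx D mon_size))).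
Proof.
have kap0 : 0 <= kap by exact: ler0n.
have piC c : piy c%:MP = cst fibre_iota c by rewrite /cst /fibre_iota /= liftC.
have pixx : piy xx = fibre_iota 'X by rewrite /fibre_iota /= liftX.
apply: (@H1_dim _ _ Z _ _ _ basis_form) => [w|c].
  have [g0 hg0] := dvec_coker fibre_coK fibre_coE disc0 kap0 co_ee co_1 piC pixx
    (fun=> erefl) pi_X pi_dxx (fun k => piy (w k)).
  pose V k := fibre_co (piy (w k) - dvec piy g0 k).
  have VE k j : V k j = cof (w k) j - cof (mderiv k g0) j.
    by rewrite /V /dvec -rmorphB fibre_co_pi cofD cofN.
  exists (\row_(b < #|{: coef_index D}|) (V (enum_val b).2 (enum_val b).1.2)`_(enum_val b).1.1), g0 => k.
  apply/idealZ => j; rewrite !ffunE !cofD !cofN cof_basis_form addrAC -VE.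
  apply/eqP; rewrite subr_eq0; apply/eqP/polyP => i.
  rewrite (coef_basis_sum (fun d => (\row_b _) 0 (enum_rank (d, j, k)))).
  case: insubP => [d _ <-|iD]; first by rewrite mxE enum_rankK.
  rewrite -leqNgt in iD; rewrite nth_default //; apply: leq_trans iD.
  by apply: dg_nbound; exact: hg0.
have coefE k j i : (cof ((\sum_b c 0 b *: basis_form b) k) j)`_i =
    if insub i is Some d then c 0 (enum_rank (d, j, k)) else 0.
  by rewrite cof_basis_form (coef_basis_sum (fun d => c 0 (enum_rank (d, j, k)))).
have fibreE off L (u : 'rV_#|{: 'X_{1..n < msz}}|) d j k :
    (u *m fibre_mx off L) 0 (enum_rank (d, j, k)) =
    (cof (mderiv k (\sum_a u 0 a *: 'X_[enum_val a])) j)`_(off + d)%N.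
  rewrite cof_deriv_mon coef_sum mxE; apply: eq_bigr => a _.
  by rewrite [fibre_mx _ _ _ _]mxE enum_rankK [RHS]coefZ.
split=> [[g0 hg0]|[u u1 u2]].
  have cofg0 k j : cof (mderiv k g0) j = cof ((\sum_b c 0 b *: basis_form b) k) j.
    have /idealZ/(_ j) := hg0 k; rewrite cofD cofN => /eqP.
    by rewrite subr_eq0 => /eqP.
  have [||g1 szg1 hg1] := @dvec_primitive _ _ _ _ _ _ fibre_coK fibre_coE disc0 _ kap0 co_ee co_1 _ _ _ _
    piC pixx (fun=> erefl) pi_X pi_dxx pi_del _ xx_size el_size D%:R g0.
  - exact: ler0n.
  - move=> k j i; rewrite ltr_nat /dvec fibre_co_pi cofg0 coefE => Di.
    by rewrite insubF //; apply/negbTE; rewrite -leqNgt ltnW.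
  pose u : 'rV_#|{: 'X_{1..n < msz}}| := \row_(a < #|{: 'X_{1..n < msz}}|) g1@_(enum_val a).
  have g1E : g1 = \sum_a u 0 a *: 'X_[enum_val a].
    rewrite [LHS](mpolywE szg1) [LHS](reindex_onto enum_val enum_rank) => [|b _]; last by rewrite enum_rankK.
    by apply: eq_big => b; rewrite ?enum_valK ?eqxx // mxE.
  have cofg1 k j : cof (mderiv k g1) j = cof ((\sum_b c 0 b *: basis_form b) k) j.
    by rewrite -cofg0 -!fibre_co_pi; congr (fibre_co _ _); exact: hg1.
  exists u; apply/rowP => b; rewrite -[b]enum_valK; case: (enum_val b) => [[d j] k].
    by rewrite fibreE -g1E cofg1 coefE add0n valK.
  rewrite fibreE -g1E cofg1 coefE mxE insubF //.
  by apply/negbTE; rewrite -leqNgt leq_addr.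
exists (\sum_a u 0 a *: 'X_[enum_val a]) => k; apply/idealZ => j.
rewrite cofD cofN; apply/eqP; rewrite subr_eq0; apply/eqP/polyP => i.
rewrite coefE; case: insubP => [d _ <-|]; first by rewrite -u1 fibreE add0n.
rewrite -leqNgt => Di; have [iL|Li] := ltnP (i - D) mon_size.
  have := congr1 (fun v : 'rV_#|{: coef_index mon_size}| => v 0 (enum_rank (Ordinal iL, j, k))) u2.
  by rewrite fibreE mxE /= subnKC // => ->.
rewrite cof_deriv_mon coef_sum big1 // => a _; rewrite coefZ nth_default ?mulr0 //.
apply: leq_trans (size_cof _ _) _; apply: leq_trans (leq_trans _ Li) (leq_subr _ _).
rewrite /mon_size /dmon (bigD1 (enum_val a)) //=; apply: leq_trans (leq_maxl _ _).
exact: (leq_bigmax k).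
Qed.

End FibreAlgebra.

End Fibre.
End Specialization.

(** * The generic fibre *)

Lemma evp_comp (R S T : comNzRingType) (h : {rmorphism R -> S}) (h' : {rmorphism R -> T})
    (pi : {rmorphism S -> T}) u P : (forall c, pi (h c) = h' c) ->
  pi (evp h u P) = evp h' (pi u) P.
Proof.
move=> E; rewrite !evpE rmorph_sum; apply: eq_bigr => i _.
by rewrite rmorphM rmorphXn /= E.
Qed.

Section CommonDenominator.
Context {K : fieldType} {A : comNzRingType} {n m : nat}.
Variables (phi1 : {rmorphism {poly K} -> A}) (psi : {rmorphism {poly {poly K}} -> A}).
Hypothesis psiC : forall c, psi c%:P = phi1 c.
Variables (X : 'I_n -> A) (e : 'I_m -> A).
Hypothesis gen_ind : forall Q : A -> Prop, (forall c, Q (phi1 c%:P)) ->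
  (forall a b, Q a -> Q b -> Q (a + b)) -> (forall i a, Q a -> Q (X i * a)) ->
  forall a, Q a.
Hypothesis span : forall a, spanned phi1 psi e a.

(** Since the ring is generated by the X_i, it is enough that g clears the
    denominators of 1 and of the products X_i e_j. *)
Lemma common_denominator : exists2 g, g != 0 &
  forall a, exists k V, phi1 g ^+ k * a = \sum_i psi (V i) * e i.
Proof.
have /choice[s0 hs0] (u : unit) : exists s, s != 0 /\ exists V, phi1 s * 1 = \sum_i psi (V i) * e i.
  by have [s s0 hV] := span 1; exists s.
have /choice[s hs] ij : exists s, s != 0 /\ exists V, phi1 s * (X ij.1 * e ij.2) = \sum_i psi (V i) * e i.
  by have [s sn0 hV] := span (X ij.1 * e ij.2); exists s.
pose g := s0 tt * \prod_ij s ij.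
have g0 : g != 0.
  by rewrite mulf_neq0 ?(hs0 tt).1 //; apply/prodf_neq0 => ij _; case: (hs ij).
have scale (c : {poly K}) a : (exists V, a = \sum_i psi (V i) * e i) ->
    exists V, phi1 c * a = \sum_i psi (V i) * e i.
  move=> [V ->]; exists (fun i => c%:P * V i); rewrite mulr_sumr; apply: eq_bigr => i _.
  by rewrite rmorphM /= psiC mulrA.
have g1 : exists V, phi1 g = \sum_i psi (V i) * e i.
  have [V hV] := (hs0 tt).2; have [|W hW] := @scale (\prod_ij s ij) (phi1 (s0 tt)).
    by exists V; rewrite -hV mulr1.
  by exists W; rewrite -hW -rmorphM mulrC.
have gX i j : exists V, phi1 g * (X i * e j) = \sum_i psi (V i) * e i.
  have [W hW] := @scale (s0 tt * \prod_(ij | ij != (i, j)) s ij) _ (hs (i, j)).2.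
  by exists W; rewrite -hW [RHS]mulrA -rmorphM /g (bigD1 (i, j)) //=; congr (phi1 _ * _); ring.
exists g => //; apply: gen_ind => [c|a b [k [V hV]] [l [W hW]]|i a [k [V hV]]].
- have [V hV] := @scale c%:P _ g1; exists 1%N, V; rewrite -hV expr1 mulrC //.
- have [V' hV'] := @scale (g ^+ l) _ (ex_intro _ V erefl).
  have [W' hW'] := @scale (g ^+ k) _ (ex_intro _ W erefl).
  exists (k + l)%N, (fun i => V' i + W' i).
  transitivity (phi1 (g ^+ l) * (phi1 g ^+ k * a) + phi1 (g ^+ k) * (phi1 g ^+ l * b)).
    by rewrite !rmorphXn exprD /=; ring.
  rewrite hV hW hV' hW' -big_split; apply: eq_bigr => i _ /=.
  by rewrite rmorphD mulrDl.
have /choice[W hW] j := gX i j; exists k.+1, (fun l => \sum_j V j * W j l).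
transitivity (phi1 g * X i * (phi1 g ^+ k * a)); first by rewrite exprS; ring.
rewrite hV mulr_sumr.
transitivity (\sum_j \sum_l psi (V j * W j l) * e l).
  apply: eq_bigr => j _; rewrite mulrCA -mulrA hW mulr_sumr; apply: eq_bigr => l _.
  by rewrite rmorphM mulrA.
rewrite exchange_big; apply: eq_bigr => l _ /=.
by rewrite rmorph_sum mulr_suml.
Qed.

End CommonDenominator.

Section GenericFibre.
Context {K : numClosedFieldType} {n : nat}.
Hypothesis uncK : uncountable K.
Local Open Scope classical_set_scope.

(** The exceptional values of y are the zeros of the common denominator g,
    of the leading coefficient in x of the generic discriminant, and of the
    two polynomials off which the ranks of the relation matrices are
    constant. *)
Theorem generic_fibre_cohomology (X : set ('I_n -> K)) (p : {mpoly K[n]}) :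
  affine_variety X -> variety_dim X 2 -> transc (@mpolyC n K) (vanishing_ideal X) p ->
  exists h, exists2 q : {poly K}, q != 0 &
    forall y, q.[y] != 0 -> has_dim (H1 (X `&` [set x | p.@[x] = y])) h.
Proof.
move=> varX dimX trp; have [[I0 ID IM] I1 IP] := variety_prime varX.
have [A [pi [pi_surj pi0]]] := quotient_ring I0 I1 ID IM.
have domA (a b : A) : a * b = 0 -> a = 0 \/ b = 0.
  have [P <-] := pi_surj a; have [Q <-] := pi_surj b.
  by rewrite -rmorphM => /pi0/IP[]/pi0; [left|right].
pose phi : {rmorphism _ -> _} := evp (@mpolyC n K) p.
pose phi1 : {rmorphism _ -> _} := GRing.RMorphism.clone _ _ (pi \o phi) _.
have phi1_inj s : phi1 s = 0 -> s = 0 by move/pi0/trp.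
have algdep2 a b : exists2 P : {poly {poly {poly K}}}, P != 0 & evp (evp phi1 a) b P = 0.
  have [a' <-] := pi_surj a; have [b' <-] := pi_surj b.
  have [P P0 /pi0 hP] := dim2_algdep uncK p varX dimX a' b'; exists P => //.
  rewrite -[RHS]hP; apply/esym/evp_comp => c; exact: evp_comp.
have gen_ind (Q : A -> Prop) : (forall c, Q (phi1 c%:P)) ->
    (forall a b, Q a -> Q b -> Q (a + b)) -> (forall i a, Q a -> Q (pi 'X_i * a)) ->
    forall a, Q a.
  move=> QC QD QX a; have [P <-] := pi_surj a.
  suff H c : Q (pi (c *: P)) by rewrite -[P]scale1r; exact: H.
  elim/(@mpoly_ring_ind K n): P c => [c|P P' hP hP'|c P hP|i P hP] c'.
  - have := QC (c' * c); rewrite /phi1 /= evpC; congr Q; congr (pi _).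
    rewrite -mul_mpolyC; exact: mpolyCM.
  - by rewrite scalerDr rmorphD; exact: QD.
  - by rewrite scalerA.
  - by rewrite scalerAr rmorphM; exact: QX.
have transc1 : exists a0, forall P, evp phi1 a0 P = 0 -> P = 0.
  have [a ha] := dim2_transc varX dimX trp; exists (pi a) => P hP; apply: ha.
  by apply/pi0; rewrite -hP; exact: evp_comp.
have [x [m' [e [indep span]]]] := free_basis domA phi1_inj algdep2 gen_ind transc1.
have [xx xxE] := pi_surj x; have /choice[el elE] i := pi_surj (e i).
have [g g0 hg] := common_denominator (evpC phi1 x) gen_ind span.
have psiE V : pi (evp phi xx V) = evp phi1 x V by rewrite -xxE; exact: evp_comp.
have sumE V : pi (\sum_i evp phi xx (V i) * el i) = \sum_i evp phi1 x (V i) * e i.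
  by rewrite rmorph_sum; apply: eq_bigr => i _; rewrite rmorphM /= psiE elE.
have /choice[ex /choice[num numE]] P : exists k V,
    pi (phi g ^+ k * P) = pi (\sum_i evp phi xx (V i) * el i).
  have [k [V hV]] := hg (pi P); exists k, V.
  by rewrite sumE -hV rmorphM rmorphXn.
have indep' V : pi (\sum_i evp phi xx (V i) * el i) = 0 -> forall i, V i = 0.
  by rewrite sumE; exact: indep.
pose dt := \det (gram_num el g ex num).
have dt0 : dt != 0.
  apply: (@trace_form_nondegenerate _ _ _ domA (pi \o evp phi xx) (pi \o el) _ _
    (g ^+ trace_ex el ex)%:P).
  - by move=> V hV; apply: indep' => //; rewrite -[RHS]hV rmorph_sum; apply: eq_bigr => i _; rewrite rmorphM.
  - move=> a; have [s s0 [V hV]] := span a; exists s%:P; first by rewrite polyC_eq0.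
    exists V; rewrite /= psiE evpC hV; apply: eq_bigr => i _.
    by rewrite /= psiE elE.
  - by rewrite polyC_eq0 expf_neq0.
  - by move=> i j; exact: trace_num_matrix.
  - by rewrite -polyC_natr polyC_eq0 -polyC_natr polyC_eq0 pnatr_eq0.
pose D := nbound (@kcoh m' (fibre_bound xx el num)%:R).
pose M1 := rel_mx xx el g ex num 0 D.
pose M2 := rel_mx xx el g ex num D (mon_size xx el num).
have [r1 [d1 d10 hd1]] := rank_generic (row_mx M1 M2).
have [r2 [d2 d20 hd2]] := rank_generic M2.
exists (#|{: 'I_D * 'I_m'.+1 * 'I_n}| - (r1 - r2))%N, (g * lead_coef dt * d1 * d2).
  by rewrite !mulf_neq0 // lead_coef_eq0.
move=> y; rewrite !hornerM !mulf_eq0 !negb_or -!andbA => /and4P[gy lcy /hd1 r1y /hd2 r2y].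
have [J0 JD JM] := fibre_is_ideal indep' numE gy.
have [Ay [piy [piy_surj piy0]]] := quotient_ring J0 (fibre_ideal1 indep' numE gy) JD JM.
have [rp rpK] := choice piy_surj.
have disc0 : disc (fibre_co g ex num y rp) (fun i => piy (el i)) != 0.
  have := disc_spec indep' numE gy rpK piy0; rewrite -/dt => E.
  have : spec y dt != 0.
    apply: contraNneq lcy => /(congr1 (fun P : {poly K} => P`_(size dt).-1)).
    by rewrite coef_map coef0 => /eqP.
  by rewrite E mulf_eq0 negb_or => /andP[].
have idealZ P : vanishing_ideal (X `&` [set x | p.@[x] = y]) P <-> fibre_ideal g ex num y P.
  split=> [hP|hP z [Xz pz]]; last first.
    by apply: (fibre_ideal_vanishes numE gy hP) pz => Q /pi0; apply.
  have [z hz|k] := nullstellensatz uncK (fibre_is_ideal indep' numE gy) (f := P).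
    apply: hP; split.
      rewrite -(zeros_vanishing varX.1) => Q IQ; apply: hz.
      by apply: (kernel_sub_fibre_ideal indep' numE gy); exact/pi0.
    have := hz _ (fibre_ideal_param indep' numE gy); rewrite mevalB mevalC => /eqP.
    by rewrite subr_eq0 => /eqP.
  exact: (fibre_ideal_reduced indep' numE gy rpK piy0 disc0).
have gk : g.[y] ^+ rel_ex xx el ex num != 0 by rewrite expf_neq0.
have E1 : \rank (fibre_mx xx el g ex num y D (mon_size xx el num)) = r2.
  by rewrite -r2y /M2 rel_mx_spec // mxrank_scale_nz.
have E2 : \rank (row_mx (fibre_mx xx el g ex num y 0 D)
    (fibre_mx xx el g ex num y D (mon_size xx el num))) = r1.
  by rewrite -r1y map_row_mx !rel_mx_spec // -scale_row_mx mxrank_scale_nz.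
by have := fibre_cohomology indep' numE gy rpK piy0 disc0 idealZ; rewrite -/D E1 E2.
Qed.

End GenericFibre.

Local Open Scope classical_set_scope.

(** A polynomial relation satisfied by f on X cuts out a closed subset of
    the line that contains the image of f. *)
Lemma dominant_transc (K : closedFieldType) (n : nat) (X : set ('I_n -> K)) (f : ('I_n -> K) -> K) (p : {mpoly K[n]}) :
  (forall x, X x -> f x = p.@[x]) -> dominant X f -> transc (@mpolyC n K) (vanishing_ideal X) p.
Proof.
move=> fp dom P hP; apply: contrapT => /eqP /closed_nonrootP[z Pz].
pose Q := evp (@mpolyC 1 K) 'X_ord0 P.
have evE m (u : {mpoly K[m]}) x : (evp (@mpolyC m K) u P).@[x] = P.[u.@[x]].
  elim/poly_ind: P {hP Pz Q} => [|P c IH]; first by rewrite rmorph0 meval0 horner0.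
  by rewrite rmorphD rmorphM /= evpX evpC mevalD mevalM mevalC IH !hornerE.
have YT : [set x | Q.@[x] = 0] = setT.
  apply: dom => [|_ [y Xy <-]]; last by rewrite /= evE mevalXU (fp _ Xy) -evE; exact: hP.
  by exists [set Q]; apply/seteqP; split=> x /= hx; [move=> _ ->|exact: hx].
have : [set x | Q.@[x] = 0] (fun=> z) by rewrite YT.
by rewrite /= evE mevalXU => /eqP; rewrite -/(root P z) (negbTE Pz).
Qed.

Lemma finite_roots (K : closedFieldType) (q : {poly K}) : q != 0 -> finite_set [set y | q.[y] = 0].
Proof.
move=> q0; have [s Eq] := closed_field_poly_normal q.
apply: (@sub_finite_set _ _ [set` s]); last exact: finite_seq.
move=> y /= /eqP; rewrite -/(root q y) Eq rootZ ?lead_coef_eq0 // root_prod_XsubC //.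
Qed.

Theorem proposition1p3 (R : realType) (n : nat) (X : set ('I_n -> R[i]))
    (f : ('I_n -> R[i]) -> R[i]) :
  affine_variety X -> variety_dim X 2 -> regular_on X f -> dominant X f ->
  exists h : nat,
    finite_set [set y : R[i] | ~ has_dim (H1 (X `&` f @^-1` [set y])) h].
Proof.
move=> varX dimX [p fp] dom.
have [h [q q0 hq]] := generic_fibre_cohomology (@complex_uncountable R) varX dimX (dominant_transc fp dom).
exists h; apply: sub_finite_set (finite_roots q0) => y /= hy.
apply: contrapT => /eqP qy; apply: hy.
have -> : X `&` f @^-1` [set y] = X `&` [set x | p.@[x] = y].
  by apply/seteqP; split=> x [Xx] /=; rewrite fp.
exact: hq.
Qed.
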